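(* Let $n\ge 2$ and $2\le k\le n+2$. Each of the maps $R_{n+k},I_{n+k}:\mathbb{B}^n\to D^{IV}_{n+k}$ defined below (for every admissible choice of the parameters) is a minimum holomorphic isometry.
   Context: $\mathbb{B}^n=\{z\in\mathbb{C}^n:|z|^2<1\}$; $D^{IV}_m=\{Z\in\mathbb{C}^m: Z\overline{Z}^t<2,\ 1-Z\overline{Z}^t+\tfrac14|ZZ^t|^2>0\}$ (row vectors). Bergman metric $\omega_\Omega=\sqrt{-1}\partial\bar\partial\log K_\Omega$, where $K_{\mathbb{B}^n}=c(1-|z|^2)^{-(n+1)}$, $K_{D^{IV}_m}=c'(1-Z\overline{Z}^t+\tfrac14|ZZ^t|^2)^{-m}$. A holomorphic map $F:D\to\Omega$ is a holomorphic isometry if $F^*\omega_\Omega=\lambda\omega_D$ for a constant $\lambda>0$. Maps $F_1,F_2:\mathbb{B}^n\to D^{IV}_m$ are equivalent if $F_1=\phi\circ F_2\circ\psi$ with $\psi\in\mathrm{Aut}(\mathbb{B}^n)$, $\phi\in\mathrm{Aut}(D^{IV}_m)$ (biholomorphic automorphisms). A holomorphic map $F:\mathbb{B}^n\to D^{IV}_m$ is minimum if there is no holomorphic map $G:\mathbb{B}^n\to D^{IV}_{m-1}$ with $F$ equivalent to $(G,0)$. Write $i=\sqrt{-1}$, and $\sqrt{\cdot}$ denotes the branch with $\sqrt1=1$ (the radicands below are $1-w$ with $|w|<1$ on $\mathbb{B}^n$). (a) For $2\le k\le n$, parameters $\theta_1,\dots,\theta_{k-1}\in(0,\pi/4]$;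 put $A=\sum_{j=1}^{k-1}\cos(2\theta_j)z_j^2+\sum_{j=k}^{n-1}z_j^2$ and $R_{n+k}(z)=\big(\cos\theta_1z_1, i\sin\theta_1z_1,\dots,\cos\theta_{k-1}z_{k-1}, i\sin\theta_{k-1}z_{k-1}, z_k,\dots,z_{n-1}, \frac{A-2z_n^2+2z_n}{2\sqrt2(1-z_n)}, \frac{A+2z_n^2-2z_n}{2\sqrt{2}\,i\,(1-z_n)}\big)$ (when $k=n$ the block $z_k,\dots,z_{n-1}$ is empty), and $I_{n+k}(z)=\big(\cos\theta_1z_1, i\sin\theta_1z_1,\dots,\cos\theta_{k-1}z_{k-1}, i\sin\theta_{k-1}z_{k-1}, z_k,\dots,z_n, 1-\sqrt{1-\sum_{j=1}^{k-1}\cos(2\theta_j)z_j^2-\sum_{j=k}^nz_j^2}\big)$. (b) $k=n+1$: $R_{2n+1}(z)=\big(\cos\theta_1z_1,i\sin\theta_1z_1,\dots,\cos\theta_{n-1}z_{n-1},i\sin\theta_{n-1}z_{n-1},z_n,\frac{S}{2\sqrt2},\frac{-iS}{2\sqrt2}\big)$ with $S=\sum_{j=1}^{n-1}\cos(2\theta_j)z_j^2+z_n^2$, $\theta_1,\dots,\theta_{n-1}\in(0,\pi/4]$; and $I_{2n+1}(z)=\big(\cos\theta_1z_1,i\sin\theta_1z_1,\dots,\cos\theta_nz_n,i\sin\theta_nz_n,1-\sqrt{1-\sum_{j=1}^n\cos(2\theta_j)z_j^2}\big)$ with $\theta_1,\dots,\theta_n\in(0,\pi/4]$ not all equal to $\pi/4$.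 (c) $k=n+2$: with $\theta_1,\dots,\theta_n\in(0,\pi/4]$ not all equal to $\pi/4$, $\theta\in(0,\pi/4)$, and $T=\sum_{j=1}^n\cos(2\theta_j)z_j^2$: $R_{2n+2}(z)=\big(\cos\theta_1z_1,i\sin\theta_1z_1,\dots,\cos\theta_nz_n,i\sin\theta_nz_n,\frac{T}{2\sqrt2},\frac{-iT}{2\sqrt2}\big)$ and $I_{2n+2}(z)=\big(\cos\theta_1z_1,i\sin\theta_1z_1,\dots,\cos\theta_nz_n,i\sin\theta_nz_n,\frac{\cos\theta}{\cos2\theta}(1-\sqrt{1-\cos(2\theta)T}),\frac{i\sin\theta}{\cos2\theta}(1-\sqrt{1-\cos(2\theta)T})\big)$. *)

(* Defs.v *)
From Stdlib Require Import Reals List Arith.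
Import ListNotations.
Open Scope R_scope.

Definition C := (R * R)%type.
Definition RtoC (x : R) : C := (x, 0).
Definition C0 : C := (0, 0).
Definition C1 : C := (1, 0).
Definition Cadd (a b : C) : C := (fst a + fst b, snd a + snd b).
Definition Copp (a : C) : C := (- fst a, - snd a).
Definition Csub (a b : C) : C := Cadd a (Copp b).
Definition Cmul (a b : C) : C :=
  (fst a * fst b - snd a * snd b, fst a * snd b + snd a * fst b).
Definition Cnorm2 (a : C) : R := fst a * fst a + snd a * snd a.
Definition Cinv (a : C) : C := (fst a / Cnorm2 a, - snd a / Cnorm2 a).
Definition Cdiv (a b : C) : C := Cmul a (Cinv b).
Definition Csq (a : C) : C := Cmul a a.
(* principal square root (branch with sqrt 1 = 1; holomorphic on Re w > 0) *)
Definition Csqrt (w : C) : C :=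
  let r := sqrt (Cnorm2 w) in
  (sqrt ((r + fst w) / 2),
   (if Rle_dec 0 (snd w) then 1 else -1) * sqrt ((r - fst w) / 2)).

(* ---------- points of C^m: nat -> C, coordinates 0..m-1 ---------- *)
Definition Vec := nat -> C.
Fixpoint sumR (m : nat) (f : nat -> R) : R :=
  match m with O => 0 | S p => sumR p f + f p end.
Fixpoint sumC (m : nat) (f : nat -> C) : C :=
  match m with O => C0 | S p => Cadd (sumC p f) (f p) end.
Definition sumL (l : list C) : C := fold_right Cadd C0 l.
(* a point of C^m: all coordinates of index >= m vanish *)
Definition tail0 (m : nat) (z : Vec) : Prop := forall k, (m <= k)%nat -> z k = C0.
Definition normsq (m : nat) (z : Vec) : R := sumR m (fun j => Cnorm2 (z j)).
Definition vecOfList (l : list C) : Vec := fun k => nth k l C0.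

Definition inBall (n : nat) (z : Vec) : Prop := normsq n z < 1 /\ tail0 n z.
Definition hIV (m : nat) (Z : Vec) : R :=
  1 - normsq m Z + / 4 * Cnorm2 (sumC m (fun j => Csq (Z j))).
Definition inDIV (m : nat) (Z : Vec) : Prop :=
  normsq m Z < 2 /\ hIV m Z > 0 /\ tail0 m Z.

(* log of the Bergman kernels on the diagonal, up to additive constants
   (log c, log c'), which are killed by the d d-bar operator *)
Definition logK_B (n : nat) (z : Vec) : R := - INR (n + 1) * ln (1 - normsq n z).
Definition logK_IV (m : nat) (Z : Vec) : R := - INR m * ln (hIV m Z).

Definition shift (z : Vec) (j : nat) (b : bool) (t : R) : Vec :=
  fun k => if Nat.eqb k j then Cadd (z k) (if b then (t, 0) else (0, t)) else z k.
Definition has_partial (f : Vec -> R) (j : nat) (b : bool) (z : Vec) (l : R) : Prop :=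
  derivable_pt_lim (fun t => f (shift z j b t)) 0 l.
Definition cont_on (n : nat) (U : Vec -> Prop) (g : Vec -> R) : Prop :=
  forall z, U z -> forall eps, eps > 0 -> exists delta, delta > 0 /\
    forall w, U w -> normsq n (fun k => Csub (w k) (z k)) < delta ->
      Rabs (g w - g z) < eps.

Definition holomorphic_on (n m : nat) (U : Vec -> Prop) (F : Vec -> Vec) : Prop :=
  forall a, (a < m)%nat ->
  exists Px Py Qx Qy : nat -> Vec -> R,
  forall j, (j < n)%nat ->
    (forall z, U z ->
       has_partial (fun w => fst (F w a)) j true z (Px j z) /\
       has_partial (fun w => fst (F w a)) j false z (Py j z) /\
       has_partial (fun w => snd (F w a)) j true z (Qx j z) /\
       has_partial (fun w => snd (F w a)) j false z (Qy j z) /\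
       Px j z = Qy j z /\ Py j z = - Qx j z) /\
    cont_on n U (Px j) /\ cont_on n U (Py j) /\
    cont_on n U (Qx j) /\ cont_on n U (Qy j).

Definition maps_into (U V : Vec -> Prop) (F : Vec -> Vec) : Prop :=
  forall z, U z -> V (F z).
Definition holo_map (n m : nat) (U V : Vec -> Prop) (F : Vec -> Vec) : Prop :=
  holomorphic_on n m U F /\ maps_into U V F.

Definition is_aut (m : nat) (U : Vec -> Prop) (phi : Vec -> Vec) : Prop :=
  holo_map m m U U phi /\
  exists psi, holo_map m m U U psi /\
    forall w, U w -> (forall k, phi (psi w) k = w k) /\ (forall k, psi (phi w) k = w k).

(* coefficients g_{i jbar} = d_{z_i} d_{zbar_j} phi of sqrt(-1) d dbar phi
   on U (subset of C^n), with all second real partials existing *)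
Definition levi_form (n : nat) (U : Vec -> Prop) (phi : Vec -> R)
    (L : nat -> nat -> Vec -> C) : Prop :=
  exists (D1 : nat -> bool -> Vec -> R) (D2 : nat -> bool -> nat -> bool -> Vec -> R),
    (forall z, U z -> forall j b, (j < n)%nat ->
        has_partial phi j b z (D1 j b z) /\
        forall i c, (i < n)%nat -> has_partial (D1 j b) i c z (D2 j b i c z)) /\
    (forall z, U z -> forall i j, (i < n)%nat -> (j < n)%nat ->
        L i j z = (/ 4 * (D2 j true i true z + D2 j false i false z),
                   / 4 * (D2 j false i true z - D2 j true i false z))).

(* F : B^n -> D^IV_m holomorphic with F^* omega_{D^IV_m} = lambda omega_{B^n};
   for holomorphic F, F^*(sqrt(-1) d dbar log K) = sqrt(-1) d dbar (log K o F) *)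
Definition is_holo_isometry (n m : nat) (F : Vec -> Vec) : Prop :=
  holo_map n m (inBall n) (inDIV m) F /\
  exists lambda, lambda > 0 /\
    exists L1 L2,
      levi_form n (inBall n) (fun z => logK_IV m (F z)) L1 /\
      levi_form n (inBall n) (logK_B n) L2 /\
      forall z, inBall n z -> forall i j, (i < n)%nat -> (j < n)%nat ->
        L1 i j z = (lambda * fst (L2 i j z), lambda * snd (L2 i j z)).

Definition append0 (m : nat) (v : Vec) : Vec :=
  fun k => if Nat.ltb k (m - 1) then v k else C0.

Definition is_minimum (n m : nat) (F : Vec -> Vec) : Prop :=
  ~ exists G, holo_map n (m - 1) (inBall n) (inDIV (m - 1)) G /\
      exists psi phi, is_aut n (inBall n) psi /\ is_aut m (inDIV m) phi /\
        forall z, inBall n z -> forall k, F z k = phi (append0 m (G (psi z))) k.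

Definition is_min_holo_isometry (n m : nat) (F : Vec -> Vec) : Prop :=
  is_holo_isometry n m F /\ is_minimum n m F.

(* ---------- the maps (1-based z_j is coordinate z (j-1)) ---------- *)
Definition zc (z : Vec) (j : nat) : C := z (j - 1)%nat.
Definition pairs (a : nat) (theta : nat -> R) (z : Vec) : list C :=
  flat_map (fun j => [Cmul (RtoC (cos (theta j))) (zc z j);
                      Cmul (0, sin (theta j)) (zc z j)]) (seq 1 a).
Definition cos2sum (a : nat) (theta : nat -> R) (z : Vec) : C :=
  sumL (map (fun j => Cmul (RtoC (cos (2 * theta j))) (Csq (zc z j))) (seq 1 a)).
Definition plain (a b : nat) (z : Vec) : list C := map (zc z) (seq a (S b - a)).
Definition sqsum (a b : nat) (z : Vec) : C :=
  sumL (map (fun j => Csq (zc z j)) (seq a (S b - a))).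
Definition two_sqrt2 : R := 2 * sqrt 2.

(* (a) 2 <= k <= n *)
Definition R_a (n k : nat) (theta : nat -> R) (z : Vec) : Vec :=
  let A := Cadd (cos2sum (k - 1) theta z) (sqsum k (n - 1) z) in
  let zn := zc z n in
  vecOfList (pairs (k - 1) theta z ++ plain k (n - 1) z ++
    [Cdiv (Cadd (Csub A (Cmul (RtoC 2) (Csq zn))) (Cmul (RtoC 2) zn))
          (Cmul (RtoC two_sqrt2) (Csub C1 zn));
     Cdiv (Csub (Cadd A (Cmul (RtoC 2) (Csq zn))) (Cmul (RtoC 2) zn))
          (Cmul (0, two_sqrt2) (Csub C1 zn))]).
Definition I_a (n k : nat) (theta : nat -> R) (z : Vec) : Vec :=
  vecOfList (pairs (k - 1) theta z ++ plain k n z ++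
    [Csub C1 (Csqrt (Csub (Csub C1 (cos2sum (k - 1) theta z)) (sqsum k n z)))]).

(* (b) k = n+1 *)
Definition R_b (n : nat) (theta : nat -> R) (z : Vec) : Vec :=
  let S := Cadd (cos2sum (n - 1) theta z) (Csq (zc z n)) in
  vecOfList (pairs (n - 1) theta z ++
    [zc z n; Cmul (RtoC (/ two_sqrt2)) S; Cmul (0, - / two_sqrt2) S]).
Definition I_b (n : nat) (theta : nat -> R) (z : Vec) : Vec :=
  vecOfList (pairs n theta z ++
    [Csub C1 (Csqrt (Csub C1 (cos2sum n theta z)))]).

(* (c) k = n+2 *)
Definition R_c (n : nat) (theta : nat -> R) (z : Vec) : Vec :=
  let T := cos2sum n theta z in
  vecOfList (pairs n theta z ++
    [Cmul (RtoC (/ two_sqrt2)) T; Cmul (0, - / two_sqrt2) T]).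
Definition I_c (n : nat) (theta : nat -> R) (th : R) (z : Vec) : Vec :=
  let T := cos2sum n theta z in
  let W := Csub C1 (Csqrt (Csub C1 (Cmul (RtoC (cos (2 * th))) T))) in
  vecOfList (pairs n theta z ++
    [Cmul (RtoC (cos th / cos (2 * th))) W;
     Cmul (0, sin th / cos (2 * th)) W]).

Definition theta_ok (a : nat) (theta : nat -> R) : Prop :=
  forall j, (1 <= j <= a)%nat -> 0 < theta j <= PI / 4.
Definition not_all_pi4 (a : nat) (theta : nat -> R) : Prop :=
  exists j, (1 <= j <= a)%nat /\ theta j <> PI / 4.

(* Main.v *)
(** Each of the maps pulls the polynomial [1 - |Z|^2 + |Z Z^t|^2 / 4] back to [1 - |z|^2], which
    gives the isometry.

    For minimality, suppose [F = phi o (G, 0) o psi].  Conjugating the reflection in the last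
    coordinate by [phi] gives an involution [tau] of the type IV domain that fixes the image of
    [F] pointwise, hence fixes 0.  The domain lies in the ball of radius [sqrt 2] and touches it
    at the real vectors of that length.  For a real vector [x] of length [sqrt 2], the Schwarz
    lemma (in its L^2 form, from Cauchy's formula on circles) applied to [tau (c x)] shows that
    the differential [x - 2 l(x) u] of [tau] at 0 does not increase the length of real vectors;
    a trace argument makes it a unitary reflection, and then [tau] is linear on complex
    multiples of real vectors, hence near 0.  Since the images of real boundary points stay in
    the closed domain, [u] must be a complex multiple of a real vector [a].  So the components
    of [F] satisfy a linear relation with real coefficients [a], which the explicit maps do
    not. *)

From Stdlib Require Import Reals List Arith Lra Lia Psatz FunctionalExtensionality Classical.
From Coquelicot Require Import Coquelicot.
Require Import Defs.
Import ListNotations.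
Open Scope R_scope.

(** * Complex numbers, sums, limits and derivatives of curves *)

(** The coordinates of these maps do satisfy complex linear relations, for instance the one between
    [cos theta z] and [i sin theta z]. What contradicts the formulas is a relation with real
    coefficients, and this is why so much effort goes into showing that the normal of the reflection
    is a multiple of a real vector.

    Nothing is used of [phi] beyond its being biholomorphic: the automorphism group of the type IV
    domain is never described, and all facts about [tau] come from one-variable discs. Knowledge on
    multiples of real vectors suffices because every small [Z] is the centre of a disc,
    [Z + c conj Z], whose boundary consists of such multiples.

    The L^2 form of the Schwarz lemma gives the bound for the Euclidean norm of a vector-valued map
    and its equality case from one integral identity. All integrals are real, taken over real parts;
    a complex constant placed in front of the function recovers what a real part loses. The bound
    [4 <= m], that is [n, k >= 2], is what excludes a non-real normal. *)

Ltac cunf := unfold Csub, Cadd, Copp, Cmul, Csq, C0, C1, RtoC, Cnorm2 in *; simpl fst in *; simpl snd in *.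

Lemma Ceq (a b : C) : fst a = fst b -> snd a = snd b -> a = b.
Proof. destruct a, b; simpl; congruence. Qed.

Lemma Cnorm2_pos (a : C) : 0 <= Cnorm2 a.
Proof. unfold Cnorm2; nra. Qed.

Lemma Cnorm2_eq0 (a : C) : Cnorm2 a = 0 -> a = C0.
Proof. unfold Cnorm2; intros H; apply Ceq; simpl; nra. Qed.

Lemma Cnorm2_neq0 (a : C) : a <> C0 -> 0 < Cnorm2 a.
Proof.
  intros H; destruct (Rle_lt_or_eq_dec _ _ (Cnorm2_pos a)) as [h|h]; auto.
  now elim H; apply Cnorm2_eq0.
Qed.

Lemma Cnorm2_mul (a b : C) : Cnorm2 (Cmul a b) = Cnorm2 a * Cnorm2 b.
Proof. cunf; ring. Qed.

Lemma Cfield : field_theory C0 C1 Cadd Cmul Csub Copp Cdiv Cinv (@eq C).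
Proof.
  split; [split| | |]; try (intros; apply Ceq; cunf; ring); try reflexivity.
  - intros H; injection H; lra.
  - intros p Hp; pose proof (Cnorm2_neq0 _ Hp) as H; unfold Cnorm2 in H.
    apply Ceq; unfold Cinv; cunf; field; lra.
Qed.
Add Field CField : Cfield.

Lemma Cmul_eq0 (a b : C) : Cmul a b = C0 -> a <> C0 -> b = C0.
Proof.
  intros H Ha; apply Cnorm2_eq0.
  assert (h : Cnorm2 a * Cnorm2 b = 0) by (rewrite <- Cnorm2_mul, H; cunf; ring).
  pose proof (Cnorm2_neq0 _ Ha); nra.
Qed.

Lemma Cmul_neq0 (a b : C) : a <> C0 -> b <> C0 -> Cmul a b <> C0.
Proof. intros Ha Hb H; apply Hb; now apply (Cmul_eq0 a). Qed.

Lemma sumR_ext m f g : (forall j, (j < m)%nat -> f j = g j) -> sumR m f = sumR m g.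
Proof.
  induction m as [|m IH]; intros H; simpl; auto.
  rewrite IH, H; auto; intros; apply H; lia.
Qed.

Lemma sumC_ext m f g : (forall j, (j < m)%nat -> f j = g j) -> sumC m f = sumC m g.
Proof.
  induction m as [|m IH]; intros H; simpl; auto.
  rewrite IH, H; auto; intros; apply H; lia.
Qed.

Lemma sumR_plus m f g : sumR m (fun j => f j + g j) = sumR m f + sumR m g.
Proof. induction m; simpl; [ring|rewrite IHm; ring]. Qed.

Lemma sumR_scal m c f : sumR m (fun j => c * f j) = c * sumR m f.
Proof. induction m; simpl; [ring|rewrite IHm; ring]. Qed.

Lemma sumR_le m f g : (forall j, (j < m)%nat -> f j <= g j) -> sumR m f <= sumR m g.
Proof.
  induction m as [|m IH]; intros H; simpl; [lra|].
  apply Rplus_le_compat; [apply IH; intros; apply H; lia|apply H; lia].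
Qed.

Lemma sumR_const m c : sumR m (fun _ => c) = INR m * c.
Proof. induction m; [simpl; ring|]. rewrite S_INR; simpl; rewrite IHm; ring. Qed.

Lemma sumR_pos m f : (forall j, (j < m)%nat -> 0 <= f j) -> 0 <= sumR m f.
Proof.
  intros H; replace 0 with (sumR m (fun _ => 0)); [now apply sumR_le|].
  rewrite sumR_const; ring.
Qed.

Lemma sumR_term m f j : (forall i, (i < m)%nat -> 0 <= f i) -> (j < m)%nat -> f j <= sumR m f.
Proof.
  induction m as [|m IH]; intros H Hj; [lia|]; simpl.
  destruct (Nat.eq_dec j m) as [->|h].
  - assert (0 <= sumR m f) by (apply sumR_pos; intros; apply H; lia); lra.
  - assert (f j <= sumR m f) by (apply IH; [intros; apply H; lia|lia]).
    assert (0 <= f m) by (apply H; lia); lra.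
Qed.

Lemma sumR_eq0 m f : (forall i, (i < m)%nat -> 0 <= f i) -> sumR m f <= 0 ->
  forall j, (j < m)%nat -> f j = 0.
Proof.
  intros H H0 j Hj; pose proof (sumR_term m f j H Hj); pose proof (H j Hj); lra.
Qed.

Lemma sumR_pick m j (c : R) : (j < m)%nat ->
  sumR m (fun i => if Nat.eqb i j then c else 0) = c.
Proof.
  induction m as [|m IH]; intros H; [lia|]; simpl.
  destruct (Nat.eqb_spec m j) as [->|h].
  - rewrite (sumR_ext _ _ (fun _ => 0)); [rewrite sumR_const; ring|].
    intros i Hi; destruct (Nat.eqb_spec i j); auto; lia.
  - rewrite IH; [ring|lia].
Qed.

Lemma sumC_plus m f g : sumC m (fun j => Cadd (f j) (g j)) = Cadd (sumC m f) (sumC m g).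
Proof. induction m; simpl; [|rewrite IHm]; ring. Qed.

Lemma sumC_scal m c f : sumC m (fun j => Cmul c (f j)) = Cmul c (sumC m f).
Proof. induction m; simpl; [|rewrite IHm]; ring. Qed.

Lemma sumC_0 m : sumC m (fun _ => C0) = C0.
Proof. induction m; simpl; [|rewrite IHm]; ring. Qed.

Lemma sumC_pick m j (f : nat -> C) : (j < m)%nat ->
  sumC m (fun i => if Nat.eqb i j then f i else C0) = f j.
Proof.
  induction m as [|m IH]; intros H; [lia|]; simpl.
  destruct (Nat.eqb_spec m j) as [->|h].
  - rewrite (sumC_ext _ _ (fun _ => C0)); [rewrite sumC_0; ring|].
    intros i Hi; destruct (Nat.eqb_spec i j); auto; lia.
  - rewrite IH; [ring|lia].
Qed.

Lemma fst_sumC m f : fst (sumC m f) = sumR m (fun j => fst (f j)).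
Proof. induction m; simpl; auto; now rewrite IHm. Qed.

Lemma snd_sumC m f : snd (sumC m f) = sumR m (fun j => snd (f j)).
Proof. induction m; simpl; auto; now rewrite IHm. Qed.

Lemma sumC_swap n m f : sumC n (fun i => sumC m (fun j => f i j)) =
  sumC m (fun j => sumC n (fun i => f i j)).
Proof.
  induction n; simpl; [now rewrite sumC_0|].
  now rewrite IHn, sumC_plus.
Qed.

Section Limits.
Context {T : Type} {F : (T -> Prop) -> Prop} {FF : Filter F}.

Lemma lim_plus (f g : T -> R) a b : filterlim f F (locally a) -> filterlim g F (locally b) ->
  filterlim (fun x => f x + g x) F (locally (a + b)).
Proof.
  intros Hf Hg.
  exact (filterlim_comp_2 _ _ Rplus Hf Hg (@filterlim_plus R_AbsRing R_NormedModule a b)).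
Qed.

Lemma lim_mult (f g : T -> R) a b : filterlim f F (locally a) -> filterlim g F (locally b) ->
  filterlim (fun x => f x * g x) F (locally (a * b)).
Proof.
  intros Hf Hg.
  exact (filterlim_comp_2 _ _ Rmult Hf Hg (@filterlim_mult R_AbsRing a b)).
Qed.

Lemma lim_comp (h : R -> R) (f : T -> R) a : continuous h a -> filterlim f F (locally a) ->
  filterlim (fun x => h (f x)) F (locally (h a)).
Proof. intros Hh Hf; exact (filterlim_comp _ _ _ f h _ _ _ Hf Hh). Qed.

Lemma lim_const (c : R) : filterlim (fun _ : T => c) F (locally c).
Proof. apply filterlim_const. Qed.

Lemma lim_opp (f : T -> R) a : filterlim f F (locally a) ->
  filterlim (fun x => - f x) F (locally (- a)).
Proof.
  intros H; apply (lim_comp Ropp); auto.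
  exact (@filterlim_opp R_AbsRing R_NormedModule a).
Qed.

Lemma lim_inv (f : T -> R) a : a <> 0 -> filterlim f F (locally a) ->
  filterlim (fun x => / f x) F (locally (/ a)).
Proof. intros Ha; apply (lim_comp Rinv); now apply continuous_Rinv. Qed.

Lemma lim_sqrt (f : T -> R) a : filterlim f F (locally a) ->
  filterlim (fun x => sqrt (f x)) F (locally (sqrt a)).
Proof. apply (lim_comp sqrt); apply continuous_sqrt. Qed.

(** Componentwise convergence along an arbitrary filter, so that the same rules serve relative
    neighbourhoods in [Vec], real curves and pairs of real parameters. *)
Definition clim (f : T -> C) (l : C) : Prop :=
  filterlim (fun x => fst (f x)) F (locally (fst l)) /\
  filterlim (fun x => snd (f x)) F (locally (snd l)).

Lemma clim_const c : clim (fun _ => c) c.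
Proof. split; apply lim_const. Qed.

Lemma clim_add f g a b : clim f a -> clim g b -> clim (fun x => Cadd (f x) (g x)) (Cadd a b).
Proof. intros [] []; split; simpl; now apply lim_plus. Qed.

Lemma clim_opp f a : clim f a -> clim (fun x => Copp (f x)) (Copp a).
Proof. intros []; split; simpl; now apply lim_opp. Qed.

Lemma clim_mul f g a b : clim f a -> clim g b -> clim (fun x => Cmul (f x) (g x)) (Cmul a b).
Proof.
  intros [] []; split; simpl; apply lim_plus; try apply lim_opp; now apply lim_mult.
Qed.

Lemma lim_Cnorm2 f a : clim f a -> filterlim (fun x => Cnorm2 (f x)) F (locally (Cnorm2 a)).
Proof. intros []; unfold Cnorm2; apply lim_plus; now apply lim_mult. Qed.

Lemma clim_inv f a : a <> C0 -> clim f a -> clim (fun x => Cinv (f x)) (Cinv a).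
Proof.
  intros Ha H; pose proof (lim_Cnorm2 _ _ H) as HN.
  assert (Cnorm2 a <> 0) by (pose proof (Cnorm2_neq0 _ Ha); lra).
  destruct H; split; simpl; apply lim_mult; try apply lim_opp; try apply lim_inv; auto.
Qed.

Lemma clim_sumC m (f : nat -> T -> C) a : (forall j, (j < m)%nat -> clim (f j) (a j)) ->
  clim (fun x => sumC m (fun j => f j x)) (sumC m a).
Proof.
  induction m as [|m IH]; intros H; simpl; [apply clim_const|].
  apply clim_add; [apply IH; intros; apply H; lia|apply H; lia].
Qed.

Lemma lim_sumR m (f : nat -> T -> R) a :
  (forall j, (j < m)%nat -> filterlim (f j) F (locally (a j))) ->
  filterlim (fun x => sumR m (fun j => f j x)) F (locally (sumR m a)).
Proof.
  induction m as [|m IH]; intros H; simpl; [apply lim_const|].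
  apply lim_plus; [apply IH; intros; apply H; lia|apply H; lia].
Qed.
End Limits.
Arguments clim {T} F f l.

Lemma clim_ext {T} {F : (T -> Prop) -> Prop} {FF : Filter F} f g l :
  F (fun x => f x = g x) -> clim F f l -> clim F g l.
Proof.
  intros H [H1 H2]; split.
  - apply filterlim_ext_loc with (2 := H1); revert H; apply filter_imp; intros x ->; auto.
  - apply filterlim_ext_loc with (2 := H2); revert H; apply filter_imp; intros x ->; auto.
Qed.

Definition vsub (w z : Vec) : Vec := fun k => Csub (w k) (z k).

(** This filter turns the epsilon-delta condition [cont_on] into [filterlim]. It is relative to [U]
    because nothing is known of the functions off [U]. *)
Definition near (n : nat) (U : Vec -> Prop) (z : Vec) : (Vec -> Prop) -> Prop :=
  fun P => exists d, d > 0 /\ forall w, U w -> normsq n (vsub w z) < d -> P w.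

Global Instance near_filter n U z : Filter (near n U z).
Proof.
  split.
  - exists 1; split; [lra|auto].
  - intros P Q [d [Hd HP]] [e [He HQ]]; exists (Rmin d e); split.
    + now apply Rmin_glb_lt.
    + intros w Hw Hn; pose proof (Rmin_l d e); pose proof (Rmin_r d e).
      split; [apply HP|apply HQ]; auto; lra.
  - intros P Q H [d [Hd HP]]; exists d; split; auto.
Qed.

Lemma cont_on_lim n U g : cont_on n U g <->
  forall z, U z -> filterlim g (near n U z) (locally (g z)).
Proof.
  split; intros H z Hz.
  - intros P [e He]; destruct (H z Hz e (cond_pos e)) as [d [Hd Hw]].
    exists d; split; auto; intros w Uw Hn; apply He; exact (Hw w Uw Hn).
  - intros e He; destruct (H z Hz (fun y => Rabs (y - g z) < e)) as [d [Hd Hw]].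
    { now exists (mkposreal e He). }
    exists d; split; auto.
Qed.

Definition Ccont n U (f : Vec -> C) := forall z, U z -> clim (near n U z) f (f z).

Lemma coord_le_normsq n z j : (j < n)%nat -> Cnorm2 (z j) <= normsq n z.
Proof.
  intros H; apply (sumR_term n (fun j => Cnorm2 (z j))); auto; intros; apply Cnorm2_pos.
Qed.

Lemma Cnorm2_small (a : C) e : 0 < e -> Cnorm2 a < e * e -> Rabs (fst a) < e /\ Rabs (snd a) < e.
Proof. unfold Cnorm2; intros He H; split; apply Rabs_def1; nra. Qed.

Lemma clim_coord n U z j : (j < n)%nat -> clim (near n U z) (fun w => w j) (z j).
Proof.
  intros Hj.
  assert (H : forall e, 0 < e -> near n U z (fun w =>
    Rabs (fst (w j) - fst (z j)) < e /\ Rabs (snd (w j) - snd (z j)) < e)).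
  { intros e He; exists (e * e); split; [nra|]; intros w _ Hn.
    apply (Cnorm2_small (vsub w z j)); auto.
    pose proof (coord_le_normsq _ (vsub w z) _ Hj); lra. }
  split; intros P [e HP]; destruct (H e (cond_pos e)) as [d [Hd Hw]]; exists d; split; auto;
    intros w Uw Hn; apply HP; destruct (Hw w Uw Hn); assumption.
Qed.

Definition cderiv (g : R -> C) (t : R) (l : C) : Prop :=
  is_derive (fun s => fst (g s)) t (fst l) /\ is_derive (fun s => snd (g s)) t (snd l).

Lemma der_plus (f g : R -> R) x a b : is_derive f x a -> is_derive g x b ->
  is_derive (fun x => f x + g x) x (a + b).
Proof. intros; now apply (is_derive_plus (K := R_AbsRing) (V := R_NormedModule) f g). Qed.

Lemma der_opp (f : R -> R) x a : is_derive f x a -> is_derive (fun x => - f x) x (- a).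
Proof. intros; now apply (is_derive_opp (K := R_AbsRing) (V := R_NormedModule) f). Qed.

Lemma der_mult (f g : R -> R) x a b : is_derive f x a -> is_derive g x b ->
  is_derive (fun x => f x * g x) x (a * g x + f x * b).
Proof.
  intros; apply (is_derive_mult (K := R_AbsRing) f g x a b); auto.
  exact Rmult_comm.
Qed.

Lemma der_const (c x : R) : is_derive (fun _ => c) x 0.
Proof. exact (is_derive_const (K := R_AbsRing) (V := R_NormedModule) c x). Qed.

Lemma der_inv (f : R -> R) x a : f x <> 0 -> is_derive f x a ->
  is_derive (fun x => / f x) x (- a / (f x)^2).
Proof. intros; now apply is_derive_inv. Qed.

Lemma der_eq (f : R -> R) x a b : is_derive f x a -> a = b -> is_derive f x b.
Proof. now intros H <-. Qed.

Lemma cderiv_eq f x a b : cderiv f x a -> a = b -> cderiv f x b.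
Proof. now intros H <-. Qed.

Lemma cderiv_ext_loc f g t l : locally t (fun s => f s = g s) -> cderiv f t l -> cderiv g t l.
Proof.
  intros H [H1 H2]; split.
  - apply is_derive_ext_loc with (2 := H1); revert H; apply filter_imp; now intros s ->.
  - apply is_derive_ext_loc with (2 := H2); revert H; apply filter_imp; now intros s ->.
Qed.

Lemma cderiv_const c t : cderiv (fun _ => c) t C0.
Proof. split; apply der_const. Qed.

Lemma cderiv_add f g t a b : cderiv f t a -> cderiv g t b ->
  cderiv (fun s => Cadd (f s) (g s)) t (Cadd a b).
Proof. intros [] []; split; simpl; now apply der_plus. Qed.

Lemma cderiv_opp f t a : cderiv f t a -> cderiv (fun s => Copp (f s)) t (Copp a).
Proof. intros []; split; simpl; now apply der_opp. Qed.

Lemma cderiv_mul f g t a b : cderiv f t a -> cderiv g t b ->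
  cderiv (fun s => Cmul (f s) (g s)) t (Cadd (Cmul a (g t)) (Cmul (f t) b)).
Proof.
  intros [] []; split; simpl.
  - eapply der_eq; [apply der_plus; [|apply der_opp]; apply der_mult; eassumption|]; simpl; ring.
  - eapply der_eq; [apply der_plus; apply der_mult; eassumption|]; simpl; ring.
Qed.

Lemma cderiv_inv f t a : f t <> C0 -> cderiv f t a ->
  cderiv (fun s => Cinv (f s)) t (Copp (Cmul a (Csq (Cinv (f t))))).
Proof.
  intros H0 [H1 H2]; pose proof (Cnorm2_neq0 _ H0) as HN.
  assert (HD : is_derive (fun s => Cnorm2 (f s)) t
      (fst a * fst (f t) + fst (f t) * fst a + (snd a * snd (f t) + snd (f t) * snd a))).
  { apply der_plus; now apply der_mult. }
  assert (Cnorm2 (f t) <> 0) by lra.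
  split; simpl.
  - eapply der_eq; [apply der_mult; [exact H1|apply der_inv; [assumption|exact HD]]|].
    simpl; unfold Cnorm2 in *; field; assumption.
  - eapply der_eq; [apply der_mult; [apply der_opp; exact H2|apply der_inv; [assumption|exact HD]]|].
    simpl; unfold Cnorm2 in *; field; assumption.
Qed.

Lemma cderiv_continuous f t l : cderiv f t l -> clim (locally t) f (f t).
Proof.
  intros [H1 H2]; split;
    apply (@ex_derive_continuous R_AbsRing R_NormedModule); eexists; eassumption.
Qed.

Lemma cderiv_unique f t a b : cderiv f t a -> cderiv f t b -> a = b.
Proof.
  intros [H1 H2] [H3 H4]; apply Ceq.
  - now rewrite <- (is_derive_unique _ _ _ H1), <- (is_derive_unique _ _ _ H3).
  - now rewrite <- (is_derive_unique _ _ _ H2), <- (is_derive_unique _ _ _ H4).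
Qed.

(** * Holomorphic functions of several variables *)

Ltac Req := match goal with |- @eq _ ?a ?b => change (@eq R a b) end; cbv beta.

(** Open inside the copy of C^n cut out by [tail0]; inside all sequences the ball and the type IV
    domain would have no interior. *)
Definition open_in n (U : Vec -> Prop) :=
  (forall z, U z -> tail0 n z) /\
  forall z, U z -> exists d, d > 0 /\ forall w, tail0 n w -> normsq n (vsub w z) < d -> U w.

(** The chain rule along all differentiable real curves is taken as the definition, with the complex
    linear differential [P] built in. Composition and inverse identities such as [chi o phi = id]
    then need no estimates. Continuity of [P] is kept for differentiation under the integral sign
    and for the way back to [holomorphic_on]. *)
Definition Hol n U (F : Vec -> C) (P : nat -> Vec -> C) : Prop :=
  (forall (g : R -> Vec) (l : nat -> C) t, locally t (fun s => U (g s)) ->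
     (forall j, (j < n)%nat -> cderiv (fun s => g s j) t (l j)) ->
     cderiv (fun s => F (g s)) t (sumC n (fun j => Cmul (P j (g t)) (l j)))) /\
  (forall j, (j < n)%nat -> Ccont n U (P j)) /\ Ccont n U F.

Definition isHol n U F := exists P, Hol n U F P.

Lemma isHol_const n U c : isHol n U (fun _ => c).
Proof.
  exists (fun _ _ => C0); split; [|split].
  - intros g l t _ _; eapply cderiv_eq; [apply cderiv_const|].
    rewrite (sumC_ext _ _ (fun _ => C0)); [now rewrite sumC_0|intros; ring].
  - intros j _ z _; apply clim_const.
  - intros z _; apply clim_const.
Qed.

Lemma isHol_coord n U k : (k < n)%nat -> isHol n U (fun z => z k).
Proof.
  intros Hk; exists (fun j _ => if Nat.eqb j k then C1 else C0); split; [|split].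
  - intros g l t _ H; eapply cderiv_eq; [now apply H|].
    rewrite <- (sumC_pick n k l Hk); apply sumC_ext; intros j _.
    destruct (Nat.eqb j k); ring.
  - intros j _ z _; apply clim_const.
  - intros z _; now apply clim_coord.
Qed.

Lemma isHol_add n U F G : isHol n U F -> isHol n U G -> isHol n U (fun z => Cadd (F z) (G z)).
Proof.
  intros [P [H1 [H2 H3]]] [Q [K1 [K2 K3]]]; exists (fun j z => Cadd (P j z) (Q j z)).
  split; [|split].
  - intros g l t Ht Hl; eapply cderiv_eq; [apply cderiv_add; [exact (H1 g l t Ht Hl)|exact (K1 g l t Ht Hl)]|].
    rewrite <- sumC_plus; apply sumC_ext; intros; ring.
  - intros j Hj z Hz; apply clim_add; [now apply H2|now apply K2].
  - intros z Hz; apply clim_add; auto.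
Qed.

Lemma isHol_mul n U F G : isHol n U F -> isHol n U G -> isHol n U (fun z => Cmul (F z) (G z)).
Proof.
  intros [P [H1 [H2 H3]]] [Q [K1 [K2 K3]]].
  exists (fun j z => Cadd (Cmul (G z) (P j z)) (Cmul (F z) (Q j z))).
  split; [|split].
  - intros g l t Ht Hl; eapply cderiv_eq; [apply cderiv_mul; [exact (H1 g l t Ht Hl)|exact (K1 g l t Ht Hl)]|].
    rewrite (sumC_ext _ (fun j => Cmul (Cadd _ _) _)
      (fun j => Cadd (Cmul (G (g t)) (Cmul (P j (g t)) (l j)))
                     (Cmul (F (g t)) (Cmul (Q j (g t)) (l j))))) by (intros; ring).
    rewrite sumC_plus, !sumC_scal; ring.
  - intros j Hj z Hz; apply clim_add; apply clim_mul; auto; [now apply H2|now apply K2].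
  - intros z Hz; apply clim_mul; auto.
Qed.

Lemma isHol_ext n U F G : (forall z, U z -> F z = G z) -> isHol n U F -> isHol n U G.
Proof.
  intros E [P [H1 [H2 H3]]]; exists P; split; [|split; auto].
  - intros g l t Ht Hl; apply cderiv_ext_loc with (2 := H1 g l t Ht Hl).
    revert Ht; apply filter_imp; auto.
  - intros z Hz; rewrite <- E by auto; apply clim_ext with (2 := H3 z Hz).
    exists 1; split; [lra|auto].
Qed.

Lemma isHol_opp n U F : isHol n U F -> isHol n U (fun z => Copp (F z)).
Proof.
  intros H; apply isHol_ext with (fun z => Cmul (Copp C1) (F z)); [intros; ring|].
  apply isHol_mul; auto; apply isHol_const.
Qed.

Lemma isHol_sub n U F G : isHol n U F -> isHol n U G -> isHol n U (fun z => Csub (F z) (G z)).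
Proof. intros; unfold Csub; apply isHol_add; auto; now apply isHol_opp. Qed.

Lemma isHol_inv n U F : (forall z, U z -> F z <> C0) -> isHol n U F ->
  isHol n U (fun z => Cinv (F z)).
Proof.
  intros E [P [H1 [H2 H3]]]; exists (fun j z => Cmul (Copp (Csq (Cinv (F z)))) (P j z)).
  split; [|split].
  - intros g l t Ht Hl; pose proof (locally_singleton _ _ Ht) as h.
    eapply cderiv_eq; [apply cderiv_inv; [apply (E _ h)|exact (H1 g l t Ht Hl)]|].
    rewrite (sumC_ext _ (fun j => Cmul (Cmul _ _) _)
      (fun j => Cmul (Copp (Csq (Cinv (F (g t))))) (Cmul (P j (g t)) (l j)))) by (intros; ring).
    rewrite sumC_scal; ring.
  - intros j Hj z Hz; apply clim_mul; [|now apply H2].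
    apply clim_opp; apply clim_mul; apply clim_inv; auto.
  - intros z Hz; apply clim_inv; auto.
Qed.

Lemma isHol_div n U F G : (forall z, U z -> G z <> C0) -> isHol n U F -> isHol n U G ->
  isHol n U (fun z => Cdiv (F z) (G z)).
Proof. intros; unfold Cdiv; apply isHol_mul; auto; now apply isHol_inv. Qed.

(** * The principal square root on the right half plane *)

Lemma Cnorm2_abs_bound (w : C) : Rabs (fst w) <= sqrt (Cnorm2 w).
Proof.
  rewrite <- sqrt_Rsqr_abs; apply sqrt_le_1_alt; unfold Rsqr, Cnorm2; nra.
Qed.

Lemma Csqrt_fst_pos w : 0 < fst w -> 0 < fst (Csqrt w).
Proof.
  intros H; simpl; apply sqrt_lt_R0.
  pose proof (sqrt_pos (Cnorm2 w)); lra.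
Qed.

(** From [2 a b = Im w] for a root [a + i b]. The sign test in [Csqrt] is thereby replaced by a
    formula that is smooth wherever [Re w > 0]. *)
Lemma Csqrt_snd w : 0 < fst w -> snd (Csqrt w) = snd w / (2 * fst (Csqrt w)).
Proof.
  intros H; pose proof (Csqrt_fst_pos _ H) as Ha.
  assert (E : 2 * fst (Csqrt w) * snd (Csqrt w) = snd w); [|rewrite <- E; field; lra].
  pose proof (Cnorm2_abs_bound w) as Hb; apply Rabs_le_between in Hb.
  pose proof (sqrt_sqrt _ (Cnorm2_pos w)) as Hr.
  simpl; set (r := sqrt (Cnorm2 w)) in *; unfold Cnorm2 in Hr.
  set (sg := if Rle_dec 0 (snd w) then 1 else -1).
  replace (2 * sqrt ((r + fst w) / 2) * (sg * sqrt ((r - fst w) / 2)))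
    with (sg * (2 * (sqrt ((r + fst w) / 2) * sqrt ((r - fst w) / 2)))) by ring.
  rewrite <- sqrt_mult by lra.
  replace ((r + fst w) / 2 * ((r - fst w) / 2)) with (Rsqr (snd w / 2))
    by (unfold Rsqr; nra).
  rewrite sqrt_Rsqr_abs; unfold sg; destruct (Rle_dec 0 (snd w)).
  - rewrite Rabs_pos_eq by lra; lra.
  - rewrite Rabs_left by lra; lra.
Qed.

Lemma Csqrt_fst_sq w : fst (Csqrt w) * fst (Csqrt w) = (sqrt (Cnorm2 w) + fst w) / 2.
Proof.
  pose proof (Cnorm2_abs_bound w) as Hb; apply Rabs_le_between in Hb.
  simpl; rewrite sqrt_sqrt; lra.
Qed.

Lemma Csqrt_sq w : 0 < fst w -> Csq (Csqrt w) = w.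
Proof.
  intros H; pose proof (Csqrt_fst_pos _ H) as Ha; pose proof (Csqrt_snd _ H) as Hb.
  pose proof (Csqrt_fst_sq w) as Hc; pose proof (sqrt_sqrt _ (Cnorm2_pos w)) as Hr.
  pose proof (sqrt_pos (Cnorm2 w)) as Hp.
  set (r := sqrt (Cnorm2 w)) in *; unfold Cnorm2 in Hr.
  destruct (Csqrt w) as [a b]; simpl in *; subst b; apply Ceq; cunf; [|field; lra].
  assert (E : snd w / (2 * a) * (snd w / (2 * a)) = (r - fst w) / 2); [|lra].
  replace (snd w / (2 * a) * (snd w / (2 * a))) with (snd w * snd w / (4 * (a * a))) by (field; lra).
  rewrite Hc; replace (snd w * snd w) with ((r - fst w) * (r + fst w)) by lra.
  field; nra.
Qed.

Lemma clim_Csqrt {T} {F : (T -> Prop) -> Prop} {FF : Filter F} (f : T -> C) a :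
  0 < fst a -> F (fun x => 0 < fst (f x)) -> clim F f a -> clim F (fun x => Csqrt (f x)) (Csqrt a).
Proof.
  intros Ha Hf H.
  assert (H1 : filterlim (fun x => fst (Csqrt (f x))) F (locally (fst (Csqrt a)))).
  { simpl; unfold Rdiv; apply lim_sqrt; apply lim_mult; [|apply lim_const].
    apply lim_plus; [|apply H]; apply lim_sqrt; now apply lim_Cnorm2. }
  split; auto.
  apply filterlim_ext_loc with (fun x => snd (f x) / (2 * fst (Csqrt (f x)))).
  - revert Hf; apply filter_imp; intros x Hx; now rewrite Csqrt_snd.
  - rewrite Csqrt_snd by auto; apply lim_mult; [apply H|]; apply lim_inv.
    + pose proof (Csqrt_fst_pos _ Ha); lra.
    + apply lim_mult; auto; apply lim_const.
Qed.

Lemma cderiv_Csqrt f t l : locally t (fun s => 0 < fst (f s)) -> cderiv f t l ->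
  cderiv (fun s => Csqrt (f s)) t (Cdiv l (Cmul (RtoC 2) (Csqrt (f t)))).
Proof.
  intros Hloc [H1 H2]; pose proof (locally_singleton _ _ Hloc) as H0; simpl in H0.
  pose proof (Csqrt_fst_pos _ H0) as Ha; pose proof (Csqrt_snd _ H0) as Hb.
  pose proof (Csqrt_fst_sq (f t)) as Hc; pose proof (sqrt_sqrt _ (Cnorm2_pos (f t))) as Hr.
  assert (HN : 0 < Cnorm2 (f t)) by (unfold Cnorm2; nra).
  pose proof (sqrt_lt_R0 _ HN) as Hp.
  assert (HD : is_derive (fun s => Cnorm2 (f s)) t
      (fst l * fst (f t) + fst (f t) * fst l + (snd l * snd (f t) + snd (f t) * snd l))).
  { apply der_plus; now apply der_mult. }
  assert (HF : is_derive (fun s => fst (Csqrt (f s))) t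
     (((fst l * fst (f t) + snd l * snd (f t)) / sqrt (Cnorm2 (f t)) + fst l)
       / (4 * fst (Csqrt (f t))))).
  { assert (A : is_derive (fun s => (sqrt (Cnorm2 (f s)) + fst (f s)) * / 2) t
       (((fst l * fst (f t) + snd l * snd (f t)) / sqrt (Cnorm2 (f t)) + fst l) / 2)).
    { eapply der_eq; [apply der_mult; [apply der_plus; [apply is_derive_sqrt; [exact HD|exact HN]
        |exact H1]|apply der_const]|]; simpl; field; lra. }
    eapply der_eq; [simpl; apply is_derive_sqrt; [exact A|unfold Rdiv in *; lra]|].
    Req; change (sqrt ((sqrt (Cnorm2 (f t)) + fst (f t)) / 2)) with (fst (Csqrt (f t))).
    field; lra. }
  assert (HS : is_derive (fun s => snd (Csqrt (f s))) t
     ((snd l - 2 * (((fst l * fst (f t) + snd l * snd (f t)) / sqrt (Cnorm2 (f t)) + fst l)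
       / (4 * fst (Csqrt (f t)))) * snd (Csqrt (f t))) / (2 * fst (Csqrt (f t))))).
  { apply is_derive_ext_loc with (fun s => snd (f s) * / (2 * fst (Csqrt (f s)))).
    - revert Hloc; apply filter_imp; intros s Hs; now rewrite (Csqrt_snd _ Hs).
    - eapply der_eq; [apply der_mult; [exact H2|apply der_inv;
        [|apply der_mult; [apply der_const|exact HF]]]|]; [lra|].
      Req; rewrite Hb; field; lra. }
  set (r := sqrt (Cnorm2 (f t))) in *; unfold Cnorm2 in Hr.
  assert (Hs : Cnorm2 (Csqrt (f t)) = r).
  { unfold Cnorm2; rewrite Hb.
    replace (snd (f t) / (2 * fst (Csqrt (f t))) * (snd (f t) / (2 * fst (Csqrt (f t)))))
      with (snd (f t) * snd (f t) / (4 * (fst (Csqrt (f t)) * fst (Csqrt (f t))))) by (field; lra).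
    rewrite Hc; replace (snd (f t) * snd (f t)) with ((r - fst (f t)) * (r + fst (f t))) by lra.
    field; nra. }
  assert (Hi : Cdiv l (Cmul (RtoC 2) (Csqrt (f t))) =
    ((fst l * fst (Csqrt (f t)) + snd l * snd (Csqrt (f t))) / (2 * r),
     (snd l * fst (Csqrt (f t)) - fst l * snd (Csqrt (f t))) / (2 * r))).
  { assert (N : Cnorm2 (Cmul (RtoC 2) (Csqrt (f t))) = 4 * r)
      by (rewrite Cnorm2_mul, Hs; unfold Cnorm2; simpl; ring).
    unfold Cdiv, Cinv; rewrite N; apply Ceq; cunf; field; lra. }
  rewrite Hi; clear Hi.
  set (a := fst (Csqrt (f t))) in *; set (b := snd (Csqrt (f t))) in *.
  (* Writing [f t = (a + i b)^2] and [r = a^2 + b^2] removes every root and leaves rational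
     identities in [a] and [b]. *)
  assert (E2 : snd (f t) = 2 * a * b) by (rewrite Hb; field; lra).
  assert (Hs' : a * a + b * b = r) by exact Hs.
  assert (E1 : fst (f t) = a * a - b * b) by lra.
  split; [eapply der_eq; [exact HF|]|eapply der_eq; [exact HS|]]; cbn [fst snd]; Req;
    rewrite E1, E2, <- Hs'; field; nra.
Qed.

Lemma isHol_sqrt n U F : (forall z, U z -> 0 < fst (F z)) -> isHol n U F ->
  isHol n U (fun z => Csqrt (F z)).
Proof.
  intros E [P [H1 [H2 H3]]].
  assert (N : forall z, U z -> Cmul (RtoC 2) (Csqrt (F z)) <> C0).
  { intros z Hz h; pose proof (Csqrt_fst_pos _ (E z Hz)).
    assert (h' : fst (Cmul (RtoC 2) (Csqrt (F z))) = 0) by now rewrite h.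
    revert h'; unfold Cmul, RtoC; cbv [fst snd]; fold (fst (Csqrt (F z))); intros; simpl in *; lra. }
  assert (K : Ccont n U (fun z => Csqrt (F z))).
  { intros z Hz; apply clim_Csqrt; auto; exists 1; split; [lra|auto]. }
  exists (fun j z => Cmul (Cinv (Cmul (RtoC 2) (Csqrt (F z)))) (P j z)).
  split; [|split]; auto.
  - intros g l t Ht Hl; eapply cderiv_eq.
    + apply cderiv_Csqrt; [|exact (H1 g l t Ht Hl)].
      revert Ht; apply filter_imp; auto.
    + unfold Cdiv; rewrite (sumC_ext _ (fun j => Cmul (Cmul _ _) _)
        (fun j => Cmul (Cinv (Cmul (RtoC 2) (Csqrt (F (g t))))) (Cmul (P j (g t)) (l j))))
        by (intros; ring).
      rewrite sumC_scal; ring.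
  - intros j Hj z Hz; apply clim_mul; [|now apply H2]; apply clim_inv; auto.
    apply clim_mul; auto; apply clim_const.
Qed.

Lemma normsq_lim {T} {F : (T -> Prop) -> Prop} {FF : Filter F} m (f : T -> Vec) (a : Vec) :
  (forall j, (j < m)%nat -> clim F (fun x => f x j) (a j)) ->
  forall d, d > 0 -> F (fun x => normsq m (vsub (f x) a) < d).
Proof.
  intros H d Hd.
  assert (L : filterlim (fun x => normsq m (vsub (f x) a)) F (locally (normsq m (vsub a a)))).
  { apply lim_sumR; intros j Hj; apply lim_Cnorm2; apply clim_add; auto; apply clim_const. }
  apply (L (fun y => y < d)).
  assert (E : normsq m (vsub a a) = 0).
  { unfold normsq; rewrite (sumR_ext _ _ (fun _ => 0)); [rewrite sumR_const; ring|].
    intros; unfold vsub; cunf; ring. }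
  rewrite E; apply (open_lt d 0); lra.
Qed.

Lemma near_comp n m U V (F : Vec -> Vec) z : (forall w, U w -> V (F w)) ->
  (forall a, (a < m)%nat -> Ccont n U (fun w => F w a)) -> U z ->
  filterlim F (near n U z) (near m V (F z)).
Proof.
  intros HV HC Hz P [d [Hd HP]].
  assert (A : near n U z (fun w => U w)) by (exists 1; split; [lra|auto]).
  assert (B : near n U z (fun w => normsq m (vsub (F w) (F z)) < d)).
  { apply normsq_lim; auto; intros j Hj; now apply (HC j Hj z). }
  unfold filtermap; generalize (filter_and _ _ A B); apply filter_imp.
  intros w [h1 h2]; auto.
Qed.

Lemma Ccont_comp n m U V (F : Vec -> Vec) (G : Vec -> C) : (forall w, U w -> V (F w)) ->
  (forall a, (a < m)%nat -> Ccont n U (fun w => F w a)) -> Ccont m V G ->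
  Ccont n U (fun z => G (F z)).
Proof.
  intros HV HC HG z Hz; pose proof (near_comp n m U V F z HV HC Hz) as h.
  destruct (HG (F z) (HV z Hz)) as [h1 h2].
  split; [exact (filterlim_comp _ _ _ _ _ _ _ _ h h1)|exact (filterlim_comp _ _ _ _ _ _ _ _ h h2)].
Qed.

(** Choice over finitely many indices, by induction and hence without a choice axiom; it collects
    the differentials of the separate components of a map. *)
Lemma choice_lt {A} (m : nat) (Q : nat -> A -> Prop) (a0 : A) :
  (forall a, (a < m)%nat -> exists P, Q a P) ->
  exists P : nat -> A, forall a, (a < m)%nat -> Q a (P a).
Proof.
  induction m as [|m IH]; intros H; [exists (fun _ => a0); intros; lia|].
  destruct IH as [P HP]; [intros; apply H; lia|].
  destruct (H m) as [p Hp]; [lia|].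
  exists (fun a => if Nat.eqb a m then p else P a); intros a Ha.
  destruct (Nat.eqb_spec a m) as [->|]; auto; apply HP; lia.
Qed.

Lemma isHol_comp n m U V (F : Vec -> Vec) (G : Vec -> C) : (forall w, U w -> V (F w)) ->
  (forall a, (a < m)%nat -> isHol n U (fun w => F w a)) -> isHol m V G ->
  isHol n U (fun z => G (F z)).
Proof.
  intros HV HF [Q [K1 [K2 K3]]].
  destruct (choice_lt m (fun a P => Hol n U (fun w => F w a) P) (fun _ _ => C0) HF) as [P HP].
  assert (HC : forall a, (a < m)%nat -> Ccont n U (fun w => F w a)) by (intros a Ha; apply HP; auto).
  exists (fun j z => sumC m (fun a => Cmul (Q a (F z)) (P a j z))); split; [|split].
  - intros g l t Ht Hl; eapply cderiv_eq.
    + apply (K1 (fun s => F (g s)) (fun a => sumC n (fun j => Cmul (P a j (g t)) (l j)))).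
      * revert Ht; apply filter_imp; auto.
      * intros a Ha; destruct (HP a Ha) as [h _]; now apply h.
    + rewrite (sumC_ext m _ (fun a => sumC n (fun j => Cmul (Cmul (Q a (F (g t))) (P a j (g t))) (l j)))).
      * rewrite sumC_swap; apply sumC_ext; intros j Hj.
        rewrite (sumC_ext m _ (fun i => Cmul (l j) (Cmul (Q i (F (g t))) (P i j (g t)))))
          by (intros; ring).
        rewrite sumC_scal; ring.
      * intros a Ha; rewrite <- sumC_scal; apply sumC_ext; intros; ring.
  - intros j Hj z Hz; apply (clim_sumC m (fun a z => Cmul (Q a (F z)) (P a j z))).
    intros a Ha; apply clim_mul.
    + apply (Ccont_comp n m U V F (Q a) HV HC (K2 a Ha)); auto.
    + destruct (HP a Ha) as [_ [h _]]; now apply h.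
  - apply (Ccont_comp n m U V F G HV HC K3).
Qed.

(** * From continuous partial derivatives to differentiability *)

Lemma filter_forall_lt {T} {F : (T -> Prop) -> Prop} {FF : Filter F} m (P : nat -> T -> Prop) :
  (forall j, (j < m)%nat -> F (P j)) -> F (fun x => forall j, (j < m)%nat -> P j x).
Proof.
  induction m as [|m IH]; intros H.
  - apply filter_forall; intros; lia.
  - assert (A : F (fun x => forall j, (j < m)%nat -> P j x)) by (apply IH; intros; apply H; lia).
    assert (B : F (P m)) by (apply H; lia).
    generalize (filter_and _ _ A B); apply filter_imp; intros x [h1 h2] j Hj.
    destruct (Nat.eq_dec j m) as [->|]; auto; apply h1; lia.
Qed.

Lemma lim_abs_small {T} {F : (T -> Prop) -> Prop} {FF : Filter F} (f : T -> R) a e :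
  0 < e -> filterlim f F (locally a) -> F (fun x => Rabs (f x - a) < e).
Proof. intros He H; apply (H (fun y => Rabs (y - a) < e)); now exists (mkposreal e He). Qed.

Lemma lim_abs_intro {T} {F : (T -> Prop) -> Prop} {FF : Filter F} (f : T -> R) a :
  (forall e, 0 < e -> F (fun x => Rabs (f x - a) < e)) -> filterlim f F (locally a).
Proof.
  intros H P [e HP]; unfold filtermap.
  apply filter_imp with (2 := H e (cond_pos e)); intros x Hx; now apply HP.
Qed.

Lemma sumR_abs m f : Rabs (sumR m f) <= sumR m (fun j => Rabs (f j)).
Proof.
  induction m as [|m IH]; simpl; [rewrite Rabs_R0; lra|].
  eapply Rle_trans; [apply Rabs_triang|]; lra.
Qed.

Lemma shift_0 z j b : shift z j b 0 = z.
Proof.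
  apply functional_extensionality; intros k; unfold shift.
  destruct (Nat.eqb k j), b; auto; apply Ceq; cunf; ring.
Qed.

Lemma shift_shift z j b s t : shift (shift z j b s) j b t = shift z j b (s + t).
Proof.
  apply functional_extensionality; intros k; unfold shift.
  destruct (Nat.eqb k j), b; auto; apply Ceq; cunf; ring.
Qed.

Lemma shift_mvt (u D : Vec -> R) p j b c :
  (forall x, Rabs x <= Rabs c -> has_partial u j b (shift p j b x) (D (shift p j b x))) ->
  exists x, Rabs x <= Rabs c /\ u (shift p j b c) - u p = D (shift p j b x) * c.
Proof.
  intros H.
  destruct (MVT_cor4 (fun t => u (shift p j b t)) (fun t => D (shift p j b t)) 0 (Rabs c))
    with (b := c) as [x [Hx1 Hx2]].
  - intros x Hx; rewrite Rminus_0_r in Hx; specialize (H x Hx).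
    apply is_derive_Reals in H.
    (* [has_partial] is a derivative at parameter 0 of the curve based at the shifted point;
       translating the parameter makes it a derivative at [x] of the curve based at [p]. *)
    assert (K : is_derive (fun t => u (shift p j b (x + (t + - x)))) x (D (shift p j b x))).
    { pose proof (is_derive_comp (fun t => u (shift p j b (x + t))) (fun t => t + - x) x
        (D (shift p j b x)) 1) as C.
      eapply der_eq; [apply C|].
      - replace (x + - x) with 0 by ring.
        apply is_derive_ext with (2 := H); intros t; now rewrite shift_shift.
      - eapply der_eq; [apply der_plus; [apply is_derive_id|apply der_const]|]; simpl.
        unfold one; simpl; ring.
      - unfold scal; simpl; unfold mult; simpl; ring. }
    apply is_derive_ext with (2 := K); intros t; do 2 f_equal; simpl; ring.
  - rewrite Rminus_0_r; lra.
  - exists x; rewrite !Rminus_0_r in *; split; auto; rewrite shift_0 in Hx1; exact Hx1.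
Qed.

(** The points reached on the way from [z] to [w] by replacing one complex coordinate at a time. *)
Definition hyb (i : nat) (w z : Vec) : Vec := fun k => if Nat.ltb k i then w k else z k.

Lemma hyb_S i w z : hyb (S i) w z =
  shift (shift (hyb i w z) i true (fst (vsub w z i))) i false (snd (vsub w z i)).
Proof.
  apply functional_extensionality; intros k; unfold hyb, shift, vsub.
  destruct (Nat.eqb_spec k i) as [->|h].
  - replace (Nat.ltb i (S i)) with true by (symmetry; apply Nat.ltb_lt; lia).
    rewrite Nat.ltb_irrefl; apply Ceq; cunf; ring.
  - destruct (Nat.ltb_spec k i), (Nat.ltb_spec k (S i)); auto; lia.
Qed.

Lemma hyb_step_near n i w z x y : (i < n)%nat -> tail0 n z ->
  Rabs x <= Rabs (fst (vsub w z i)) -> Rabs y <= Rabs (snd (vsub w z i)) ->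
  let q := shift (shift (hyb i w z) i true x) i false y in
  tail0 n q /\ normsq n (vsub q z) <= normsq n (vsub w z).
Proof.
  intros Hi Tz Hx Hy q; split.
  - intros k Hk; unfold q, shift, hyb.
    replace (Nat.eqb k i) with false by (symmetry; apply Nat.eqb_neq; lia).
    replace (Nat.ltb k i) with false by (symmetry; apply Nat.ltb_ge; lia).
    now apply Tz.
  - apply sumR_le; intros k Hk; unfold q, vsub, shift, hyb.
    destruct (Nat.eqb_spec k i) as [->|h].
    + rewrite Nat.ltb_irrefl; apply Rsqr_le_abs_1 in Hx; apply Rsqr_le_abs_1 in Hy.
      unfold Rsqr, vsub in *; cunf; nra.
    + destruct (Nat.ltb k i); [lra|].
      replace (Cnorm2 (Csub (z k) (z k))) with 0 by (cunf; ring); apply Cnorm2_pos.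
Qed.

Definition dsum (n : nat) (px py : nat -> R) (d : Vec) : R :=
  sumR n (fun j => px j * fst (d j) + py j * snd (d j)).
Definition asum (n : nat) (d : Vec) : R :=
  sumR n (fun j => Rabs (fst (d j)) + Rabs (snd (d j))).

(** Telescope [u w - u z] over the hybrid points, apply the mean value theorem to each of the two
    real steps in a coordinate, and replace the intermediate partials by those at [z] using their
    continuity. The intermediate points are no farther from [z] than [w] is, so they stay in the
    neighbourhood. *)
Lemma frechet n U (u : Vec -> R) (px py : nat -> Vec -> R) : open_in n U ->
  (forall j, (j < n)%nat -> forall z, U z ->
     has_partial u j true z (px j z) /\ has_partial u j false z (py j z)) ->
  (forall j, (j < n)%nat -> cont_on n U (px j) /\ cont_on n U (py j)) ->
  forall z, U z -> forall e, 0 < e ->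
  near n U z (fun w => Rabs (u w - u z - dsum n (fun j => px j z) (fun j => py j z) (vsub w z))
     <= e * asum n (vsub w z)).
Proof.
  intros [UT UO] HP HC z Hz e He.
  destruct (UO z Hz) as [d0 [Hd0 HU]].
  assert (N : near n U z (fun q => forall j, (j < n)%nat ->
     Rabs (px j q - px j z) < e /\ Rabs (py j q - py j z) < e)).
  { apply filter_forall_lt; intros j Hj; destruct (HC j Hj) as [h1 h2].
    rewrite cont_on_lim in h1, h2.
    apply filter_and; apply lim_abs_small; auto. }
  destruct N as [d1 [Hd1 HN]].
  exists (Rmin d0 d1); split; [now apply Rmin_glb_lt|].
  intros w Uw Hw; pose proof (Rmin_l d0 d1); pose proof (Rmin_r d0 d1).
  assert (Q : forall i x y, (i < n)%nat ->
     Rabs x <= Rabs (fst (vsub w z i)) -> Rabs y <= Rabs (snd (vsub w z i)) ->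
     let q := shift (shift (hyb i w z) i true x) i false y in
     U q /\ Rabs (px i q - px i z) < e /\ Rabs (py i q - py i z) < e).
  { intros i x y Hi Hx Hy q; destruct (hyb_step_near n i w z x y Hi (UT z Hz) Hx Hy) as [h1 h2].
    fold q in h1, h2.
    assert (Uq : U q) by (apply HU; auto; lra).
    split; auto; apply HN; auto; lra. }
  assert (A : forall i, (i <= n)%nat ->
    Rabs (u (hyb i w z) - u z - dsum i (fun j => px j z) (fun j => py j z) (vsub w z))
     <= e * asum i (vsub w z)).
  { induction i as [|i IH]; intros Hi.
    - unfold dsum, asum; simpl; replace (hyb 0 w z) with z; [|now apply functional_extensionality].
      replace (u z - u z - 0) with 0 by ring; rewrite Rabs_R0; lra.
    - assert (Hi' : (i < n)%nat) by lia.
      specialize (IH ltac:(lia)).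
      destruct (shift_mvt u (px i) (hyb i w z) i true (fst (vsub w z i))) as [x [Hx Ex]].
      { intros x Hx; destruct (Q i x 0 Hi' Hx) as [h _].
        - rewrite Rabs_R0; apply Rabs_pos.
        - simpl in h; rewrite shift_0 in h; now apply HP. }
      destruct (shift_mvt u (py i) (shift (hyb i w z) i true (fst (vsub w z i))) i false
        (snd (vsub w z i))) as [y [Hy Ey]].
      { intros y Hy; destruct (Q i (fst (vsub w z i)) y Hi' ltac:(lra) Hy) as [h _].
        now apply HP. }
      destruct (Q i x 0 Hi' Hx) as [_ [Bx _]]; [rewrite Rabs_R0; apply Rabs_pos|].
      simpl in Bx; rewrite shift_0 in Bx.
      destruct (Q i (fst (vsub w z i)) y Hi' ltac:(lra) Hy) as [_ [_ By]].
      simpl in By; rewrite <- hyb_S in Ey.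
      unfold dsum, asum in *; cbn [sumR].
      set (qx := px i (shift (hyb i w z) i true x)) in *.
      set (qy := py i (shift _ i false y)) in *.
      set (dx := fst (vsub w z i)) in *; set (dy := snd (vsub w z i)) in *.
      match goal with |- Rabs ?a <= _ => replace a with
        ((u (hyb i w z) - u z - sumR i (fun j => px j z * fst (vsub w z j) + py j z * snd (vsub w z j)))
          + ((qx - px i z) * dx + (qy - py i z) * dy)) by lra end.
      eapply Rle_trans; [apply Rabs_triang|].
      rewrite Rmult_plus_distr_l; apply Rplus_le_compat; auto.
      eapply Rle_trans; [apply Rabs_triang|]; rewrite !Rabs_mult.
      pose proof (Rabs_pos dx); pose proof (Rabs_pos dy); nra. }
  specialize (A n ltac:(lia)); replace (hyb n w z) with w in A; auto.
  apply functional_extensionality; intros k; unfold hyb; destruct (Nat.ltb_spec k n); auto.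
  now rewrite (UT w Uw k), (UT z Hz k).
Qed.

Lemma is_derive_eps (f : R -> R) t l :
  is_derive f t l <-> forall e, 0 < e -> locally t (fun s => Rabs (f s - f t - (s - t) * l) <= e * Rabs (s - t)).
Proof.
  split.
  - intros [_ H] e He; specialize (H t (fun P h => h) (mkposreal e He)).
    revert H; apply filter_imp; intros s Hs.
    exact Hs.
  - intros H; split; [apply is_linear_scal_l|].
    intros x Hx.
    assert (E : t = x) by (apply (is_filter_lim_locally_unique (K := R_AbsRing) (V := R_NormedModule)); exact Hx).
    subst x; intros e; generalize (H e (cond_pos e)); apply filter_imp; intros s Hs; exact Hs.
Qed.

Lemma partials_curve n U (u : Vec -> R) (px py : nat -> Vec -> R) : open_in n U ->
  (forall j, (j < n)%nat -> forall z, U z ->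
     has_partial u j true z (px j z) /\ has_partial u j false z (py j z)) ->
  (forall j, (j < n)%nat -> cont_on n U (px j) /\ cont_on n U (py j)) ->
  forall (g : R -> Vec) (l : nat -> C) t, locally t (fun s => U (g s)) ->
     (forall j, (j < n)%nat -> cderiv (fun s => g s j) t (l j)) ->
  is_derive (fun s => u (g s)) t (dsum n (fun j => px j (g t)) (fun j => py j (g t)) l).
Proof.
  intros HU HP HC g l t Ht Hl; apply is_derive_eps; intros e He.
  pose proof (locally_singleton _ _ Ht) as Hz; simpl in Hz.
  set (a := fun j => px j (g t)); set (b := fun j => py j (g t)).
  set (M := sumR n (fun j => Rabs (a j) + Rabs (b j))).
  set (K := sumR n (fun j => Rabs (fst (l j)) + Rabs (snd (l j)) + 2)).
  assert (HM : 0 <= M) by (apply sumR_pos; intros j _; pose proof (Rabs_pos (a j));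
    pose proof (Rabs_pos (b j)); lra).
  assert (HK : 0 <= K) by (apply sumR_pos; intros j _; pose proof (Rabs_pos (fst (l j)));
    pose proof (Rabs_pos (snd (l j))); lra).
  (* [e1] controls the remainders of the coordinate curves and [e2] the remainder in [frechet]; the
     two contributions are at most [e1 * M] and [e2 * K] times the increment, half of [e] each. The
     cap 1 on [e1] is what the summand 2 in [K] absorbs. *)
  set (e1 := Rmin 1 (e / (2 * (M + 1)))); set (e2 := e / (2 * (K + 1))).
  assert (He1 : 0 < e1) by (apply Rmin_glb_lt; [lra|apply Rdiv_lt_0_compat; lra]).
  assert (He2 : 0 < e2) by (apply Rdiv_lt_0_compat; lra).
  assert (B1 : e1 * M <= e / 2).
  { apply Rle_trans with (e / (2 * (M + 1)) * M);
      [apply Rmult_le_compat_r; auto; apply Rmin_r|].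
    replace (e / (2 * (M + 1)) * M) with (e / 2 * (M / (M + 1))) by (field; lra).
    assert (M / (M + 1) <= 1) by (apply Rmult_le_reg_r with (M + 1); [lra|]; field_simplify; lra).
    nra. }
  assert (B2 : e2 * K <= e / 2).
  { unfold e2; replace (e / (2 * (K + 1)) * K) with (e / 2 * (K / (K + 1))) by (field; lra).
    assert (K / (K + 1) <= 1) by (apply Rmult_le_reg_r with (K + 1); [lra|]; field_simplify; lra).
    nra. }
  assert (B3 : e1 <= 1) by apply Rmin_l.
  assert (L1 : locally t (fun s => forall j, (j < n)%nat ->
     Rabs (fst (vsub (g s) (g t) j) - (s - t) * fst (l j)) <= e1 * Rabs (s - t) /\
     Rabs (snd (vsub (g s) (g t) j) - (s - t) * snd (l j)) <= e1 * Rabs (s - t))).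
  { apply filter_forall_lt; intros j Hj; destruct (Hl j Hj) as [h1 h2].
    apply is_derive_eps with (e := e1) in h1; auto.
    apply is_derive_eps with (e := e1) in h2; auto.
    generalize (filter_and _ _ h1 h2); apply filter_imp; intros s Hs; exact Hs. }
  assert (L2 : locally t (fun s => Rabs (u (g s) - u (g t) - dsum n a b (vsub (g s) (g t)))
     <= e2 * asum n (vsub (g s) (g t)))).
  { destruct (frechet n U u px py HU HP HC (g t) Hz e2 He2) as [d [Hd HF]].
    assert (L3 : locally t (fun s => normsq n (vsub (g s) (g t)) < d)).
    { apply normsq_lim; auto; intros j Hj; eapply cderiv_continuous; eauto. }
    generalize (filter_and _ _ Ht L3); apply filter_imp; intros s [h1 h2]; now apply HF. }
  generalize (filter_and _ _ L1 L2); apply filter_imp; intros s [h1 h2]; clear L1 L2.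
  set (D := vsub (g s) (g t)) in *; set (h := s - t) in *.
  assert (A1 : Rabs (dsum n a b D - h * dsum n a b l) <= e1 * M * Rabs h).
  { unfold dsum; rewrite <- sumR_scal.
    replace (sumR n (fun j => a j * fst (D j) + b j * snd (D j)) -
      sumR n (fun j => h * (a j * fst (l j) + b j * snd (l j))))
      with (sumR n (fun j => a j * (fst (D j) - h * fst (l j)) + b j * (snd (D j) - h * snd (l j)))).
    2:{ unfold Rminus at 3; rewrite Ropp_mult_distr_l_reverse || idtac.
        replace (- sumR n (fun j => h * (a j * fst (l j) + b j * snd (l j))))
          with ((-1) * sumR n (fun j => h * (a j * fst (l j) + b j * snd (l j)))) by ring.
        rewrite <- sumR_scal, <- sumR_plus; apply sumR_ext; intros; ring. }
    eapply Rle_trans; [apply sumR_abs|].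
    unfold M; rewrite (Rmult_comm e1), Rmult_assoc, (Rmult_comm (sumR _ _)), <- sumR_scal.
    apply sumR_le; intros j Hj; destruct (h1 j Hj) as [k1 k2].
    eapply Rle_trans; [apply Rabs_triang|]; rewrite !Rabs_mult.
    pose proof (Rabs_pos (a j)); pose proof (Rabs_pos (b j)); nra. }
  assert (A2 : asum n D <= K * Rabs h).
  { unfold asum, K; rewrite Rmult_comm, <- sumR_scal; apply sumR_le; intros j Hj.
    destruct (h1 j Hj) as [k1 k2]; pose proof (Rabs_pos h).
    assert (T : forall x y, Rabs (x - h * y) <= e1 * Rabs h -> Rabs x <= Rabs h * (Rabs y + 1)).
    { intros x y Hxy; replace x with ((x - h * y) + h * y) by ring.
      eapply Rle_trans; [apply Rabs_triang|]; rewrite Rabs_mult; nra. }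
    apply T in k1; apply T in k2; lra. }
  replace (u (g s) - u (g t) - h * dsum n a b l) with
    ((u (g s) - u (g t) - dsum n a b D) + (dsum n a b D - h * dsum n a b l)) by ring.
  eapply Rle_trans; [apply Rabs_triang|].
  pose proof (Rabs_pos h); nra.
Qed.

Lemma partials_cont n U (u : Vec -> R) (px py : nat -> Vec -> R) : open_in n U ->
  (forall j, (j < n)%nat -> forall z, U z ->
     has_partial u j true z (px j z) /\ has_partial u j false z (py j z)) ->
  (forall j, (j < n)%nat -> cont_on n U (px j) /\ cont_on n U (py j)) ->
  forall z, U z -> filterlim u (near n U z) (locally (u z)).
Proof.
  intros HU HP HC z Hz; apply lim_abs_intro; intros e He.
  assert (A : forall j, (j < n)%nat -> clim (near n U z) (fun w => vsub w z j) C0).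
  { intros j Hj; replace C0 with (vsub z z j) by (unfold vsub; ring).
    apply clim_add; [now apply clim_coord|apply clim_const]. }
  assert (B : filterlim (fun w => Rabs (dsum n (fun j => px j z) (fun j => py j z) (vsub w z)) +
      asum n (vsub w z)) (near n U z)
     (locally (Rabs (dsum n (fun j => px j z) (fun j => py j z) (fun _ => C0)) + asum n (fun _ => C0)))).
  { apply lim_plus.
    - apply (lim_comp Rabs); [apply continuous_Rabs|].
      apply (lim_sumR n (fun j w => px j z * fst (vsub w z j) + py j z * snd (vsub w z j))
        (fun j => px j z * fst C0 + py j z * snd C0)); intros j Hj; destruct (A j Hj).
      apply lim_plus; apply lim_mult; auto; apply lim_const.
    - apply (lim_sumR n (fun j w => Rabs (fst (vsub w z j)) + Rabs (snd (vsub w z j)))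
        (fun j => Rabs (fst C0) + Rabs (snd C0))); intros j Hj; destruct (A j Hj).
      apply lim_plus; apply (lim_comp Rabs); auto; apply continuous_Rabs. }
  assert (E : Rabs (dsum n (fun j => px j z) (fun j => py j z) (fun _ => C0)) + asum n (fun _ => C0) = 0).
  { unfold dsum, asum; rewrite (sumR_ext n _ (fun _ => 0)) by (intros; simpl; ring).
    rewrite (sumR_ext n (fun j => _ + _) (fun _ => 0)) by (intros; simpl; rewrite Rabs_R0; ring).
    rewrite sumR_const, Rmult_0_r, Rabs_R0; ring. }
  rewrite E in B; apply (lim_abs_small _ _ _ He) in B.
  generalize (filter_and _ _ B (frechet n U u px py HU HP HC z Hz 1 Rlt_0_1)).
  apply filter_imp; intros w [h1 h2].
  apply Rabs_lt_between in h1; apply Rabs_le_between in h2; apply Rabs_lt_between.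
  set (d := dsum n (fun j => px j z) (fun j => py j z) (vsub w z)) in *; pose proof (Rle_abs d); pose proof (Rle_abs (- d)) as h3.
  rewrite Rabs_Ropp in h3; split; lra.
Qed.

(** Continuous partials give the real chain rule for both components, and the Cauchy-Riemann
    equations assemble the two real differentials into multiplication by [Px + i Qx]. *)
Lemma holomorphic_on_isHol n m U F : open_in n U -> holomorphic_on n m U F ->
  forall a, (a < m)%nat -> isHol n U (fun z => F z a).
Proof.
  intros HU H a Ha; destruct (H a Ha) as [Px [Py [Qx [Qy Hj]]]].
  assert (A1 : forall j, (j < n)%nat -> forall z, U z ->
     has_partial (fun w => fst (F w a)) j true z (Px j z) /\
     has_partial (fun w => fst (F w a)) j false z (Py j z)).
  { intros j h z Hz; destruct (Hj j h) as [h1 _]; destruct (h1 z Hz) as [? [? _]]; auto. }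
  assert (A2 : forall j, (j < n)%nat -> forall z, U z ->
     has_partial (fun w => snd (F w a)) j true z (Qx j z) /\
     has_partial (fun w => snd (F w a)) j false z (Qy j z)).
  { intros j h z Hz; destruct (Hj j h) as [h1 _]; destruct (h1 z Hz) as [? [? [? [? _]]]]; auto. }
  assert (A3 : forall j, (j < n)%nat -> cont_on n U (Px j) /\ cont_on n U (Py j)).
  { intros j h; destruct (Hj j h) as [_ [? [? _]]]; auto. }
  assert (A4 : forall j, (j < n)%nat -> cont_on n U (Qx j) /\ cont_on n U (Qy j)).
  { intros j h; destruct (Hj j h) as [_ [_ [_ [? ?]]]]; auto. }
  exists (fun j z => (Px j z, Qx j z)); split; [|split].
  - intros g l t Ht Hl; pose proof (locally_singleton _ _ Ht) as Hz; simpl in Hz; split.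
    + eapply der_eq; [apply (partials_curve n U _ Px Py HU A1 A3 g l t Ht Hl)|].
      rewrite fst_sumC; apply sumR_ext; intros j h; destruct (Hj j h) as [h1 _].
      destruct (h1 _ Hz) as [_ [_ [_ [_ [_ E]]]]]; rewrite E; simpl; ring.
    + eapply der_eq; [apply (partials_curve n U _ Qx Qy HU A2 A4 g l t Ht Hl)|].
      rewrite snd_sumC; apply sumR_ext; intros j h; destruct (Hj j h) as [h1 _].
      destruct (h1 _ Hz) as [_ [_ [_ [_ [E _]]]]]; rewrite <- E; simpl; ring.
  - intros j h z Hz; split; simpl.
    + now apply cont_on_lim; [apply A3|].
    + now apply cont_on_lim; [apply A4|].
  - intros z Hz; split; [apply (partials_cont n U (fun w => fst (F w a)) Px Py)|apply (partials_cont n U (fun w => snd (F w a)) Qx Qy)]; auto.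
Qed.

Lemma curve_in n U (g : R -> Vec) t : open_in n U -> U (g t) -> locally t (fun s => tail0 n (g s)) ->
  (forall j, (j < n)%nat -> clim (locally t) (fun s => g s j) (g t j)) ->
  locally t (fun s => U (g s)).
Proof.
  intros [_ HO] Hz HT HC; destruct (HO _ Hz) as [d [Hd H]].
  pose proof (normsq_lim n g (g t) HC d Hd) as L.
  generalize (filter_and _ _ HT L); apply filter_imp; intros s [h1 h2]; auto.
Qed.

Definition cdir (b : bool) : C := if b then C1 else (0, 1).

Lemma der_id x : is_derive (fun s : R => s) x 1.
Proof. apply is_derive_Reals, derivable_pt_lim_id. Qed.

Lemma shift_cderiv z j b k t :
  cderiv (fun s => shift z j b s k) t (if Nat.eqb k j then cdir b else C0).
Proof.
  unfold shift; destruct (Nat.eqb k j); [|apply cderiv_const].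
  eapply cderiv_eq; [apply cderiv_add; [apply cderiv_const|]|].
  - instantiate (1 := cdir b); destruct b; split; simpl;
      apply der_const || apply der_id.
  - destruct b; unfold cdir; ring.
Qed.

Lemma shift_tail0 n z j b t : (j < n)%nat -> tail0 n z -> tail0 n (shift z j b t).
Proof.
  intros Hj H k Hk; unfold shift.
  replace (Nat.eqb k j) with false by (symmetry; apply Nat.eqb_neq; lia); auto.
Qed.

Lemma shift_in n U z j b : open_in n U -> U z -> (j < n)%nat ->
  locally 0 (fun s => U (shift z j b s)).
Proof.
  intros HU Hz Hj; apply curve_in with n; auto.
  - now rewrite shift_0.
  - apply filter_forall; intros s; apply shift_tail0; auto; now apply HU.
  - intros k Hk; exact (cderiv_continuous _ _ _ (shift_cderiv z j b k 0)).
Qed.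

Lemma isHol_holomorphic_on n m U F : open_in n U ->
  (forall a, (a < m)%nat -> isHol n U (fun z => F z a)) -> holomorphic_on n m U F.
Proof.
  intros HU H a Ha; destruct (H a Ha) as [P [H1 [H2 H3]]].
  exists (fun j z => fst (P j z)), (fun j z => - snd (P j z)),
    (fun j z => snd (P j z)), (fun j z => fst (P j z)).
  intros j Hj.
  assert (D : forall b z, U z -> cderiv (fun s => F (shift z j b s) a) 0 (Cmul (P j z) (cdir b))).
  { intros b z Hz; eapply cderiv_eq.
    - apply (H1 (fun s => shift z j b s) (fun k => if Nat.eqb k j then cdir b else C0)).
      + now apply shift_in with n.
      + intros k Hk; apply shift_cderiv.
    - rewrite shift_0, <- (sumC_pick n j (fun k => Cmul (P k z) (cdir b)) Hj).
      apply sumC_ext; intros k _; destruct (Nat.eqb k j); ring. }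
  assert (K1 : cont_on n U (fun z => fst (P j z))) by (apply cont_on_lim; intros; now apply H2).
  assert (K2 : cont_on n U (fun z => snd (P j z))) by (apply cont_on_lim; intros; now apply H2).
  assert (K3 : cont_on n U (fun z => - snd (P j z))).
  { apply cont_on_lim; intros; apply lim_opp; now apply H2. }
  split; [|auto].
  intros z Hz; destruct (D true z Hz) as [D1 D2]; destruct (D false z Hz) as [D3 D4].
  unfold has_partial; repeat split; try ring; apply is_derive_Reals.
  - eapply der_eq; [exact D1|]; simpl; ring.
  - eapply der_eq; [exact D3|]; simpl; ring.
  - eapply der_eq; [exact D2|]; simpl; ring.
  - eapply der_eq; [exact D4|]; simpl; ring.
Qed.

(** * Openness of the ball and of the type IV domain *)

Lemma open_lt_on n f c : cont_on n (tail0 n) f -> open_in n (fun z => tail0 n z /\ f z < c).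
Proof.
  intros Hf; split; [now intros z [h _]|]; intros z [Tz Hz].
  destruct (Hf z Tz (c - f z) ltac:(lra)) as [d [Hd H]]; exists d; split; auto.
  intros w Tw Hw; split; auto; specialize (H w Tw Hw); apply Rabs_lt_between in H; lra.
Qed.

Lemma open_and n U V : open_in n U -> open_in n V -> open_in n (fun z => U z /\ V z).
Proof.
  intros [T1 O1] [T2 O2]; split; [intros z [h _]; auto|]; intros z [h1 h2].
  destruct (O1 z h1) as [d [Hd H]]; destruct (O2 z h2) as [e [He K]].
  exists (Rmin d e); split; [now apply Rmin_glb_lt|]; intros w Tw Hw.
  pose proof (Rmin_l d e); pose proof (Rmin_r d e); split; [apply H|apply K]; auto; lra.
Qed.

Lemma open_ext n U V : (forall z, U z <-> V z) -> open_in n U -> open_in n V.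
Proof.
  intros E [T O]; split; [intros z h; apply T; now apply E|]; intros z h; apply E in h.
  destruct (O z h) as [d [Hd H]]; exists d; split; auto; intros; apply E; auto.
Qed.

Lemma normsq_cont n : cont_on n (tail0 n) (normsq n).
Proof.
  apply cont_on_lim; intros z _; apply (lim_sumR n (fun j w => Cnorm2 (w j)) (fun j => Cnorm2 (z j))).
  intros j Hj; apply lim_Cnorm2; now apply clim_coord.
Qed.

Lemma hIV_cont n : cont_on n (tail0 n) (hIV n).
Proof.
  apply cont_on_lim; intros z Tz; unfold hIV; apply lim_plus; [apply lim_plus; [apply lim_const|]|].
  - apply lim_opp; now apply cont_on_lim; [apply normsq_cont|].
  - apply lim_mult; [apply lim_const|]; apply lim_Cnorm2.
    apply (clim_sumC n (fun j w => Csq (w j)) (fun j => Csq (z j))); intros j Hj.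
    unfold Csq; apply clim_mul; now apply clim_coord.
Qed.

Lemma open_ball n : open_in n (inBall n).
Proof.
  apply open_ext with (2 := open_lt_on n (normsq n) 1 (normsq_cont n)).
  unfold inBall; tauto.
Qed.

Lemma open_DIV n : open_in n (inDIV n).
Proof.
  assert (H : cont_on n (tail0 n) (fun z => - hIV n z)).
  { apply cont_on_lim; intros z Tz; apply lim_opp; now apply cont_on_lim; [apply hIV_cont|]. }
  apply open_ext with (2 := open_and _ _ _ (open_lt_on n (normsq n) 2 (normsq_cont n))
    (open_lt_on n _ 0 H)).
  intros z; unfold inDIV; split; [intros [[? ?] [? ?]]|intros [? [? ?]]]; repeat split; auto; lra.
Qed.

(** * Cauchy's formula on circles *)

Definition Cabs (a : C) : R := Cmod a.

Lemma Cabs_pos a : 0 <= Cabs a.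
Proof. exact (Cmod_ge_0 a). Qed.

Lemma Cabs_0 : Cabs C0 = 0.
Proof. exact Cmod_0. Qed.

Lemma Cabs_1 : Cabs C1 = 1.
Proof. exact Cmod_1. Qed.

Lemma Cabs_sq a : Cabs a * Cabs a = Cnorm2 a.
Proof.
  unfold Cabs, Cmod; rewrite sqrt_sqrt; [unfold Cnorm2; simpl; ring|]; simpl; nra.
Qed.

Lemma Cabs_mul a b : Cabs (Cmul a b) = Cabs a * Cabs b.
Proof. exact (Cmod_mult a b). Qed.

Lemma Cabs_add a b : Cabs (Cadd a b) <= Cabs a + Cabs b.
Proof. exact (Cmod_triangle a b). Qed.

Lemma Cabs_real x : Cabs (RtoC x) = Rabs x.
Proof. exact (Cmod_R x). Qed.

Lemma Cabs_lt_sq a r : 0 <= r -> (Cabs a < r <-> Cnorm2 a < r * r).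
Proof. intros Hr; rewrite <- Cabs_sq; pose proof (Cabs_pos a); split; nra. Qed.

Lemma Cabs_sub_ge a b : Cabs a - Cabs b <= Cabs (Csub a b).
Proof.
  pose proof (Cabs_add (Csub a b) b) as H; replace (Cadd (Csub a b) b) with a in H by ring; lra.
Qed.

Lemma fst_le_Cabs a : Rabs (fst a) <= Cabs a.
Proof.
  apply Rle_trans with (sqrt (Cnorm2 a)); [apply Cnorm2_abs_bound|].
  apply sqrt_le_1_alt; unfold Cnorm2; simpl; lra.
Qed.

Lemma der_continuity_pt (f : R -> R) x l : is_derive f x l -> continuity_pt f x.
Proof.
  intros H; apply derivable_continuous_pt; exists l; now apply is_derive_Reals.
Qed.

(** Cauchy's theorem in the form needed: the [s]-derivative of the integrand is at the same time the
    [x]-derivative of the periodic function [B s], so its integral over a period is 0 and the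
    integral does not depend on [s]. The margin [d] allows differentiation under the integral at the
    endpoints, while [B] is asked for only on the open interval because it may blow up at
    [s = 0]. *)
Lemma homotopy (A A' B : R -> R -> C) d : 0 < d ->
  (forall s x, - d < s < 1 + d ->
     cderiv (fun s => A s x) s (A' s x) /\
     clim (locally (s, x)) (fun p : R * R => A' (fst p) (snd p)) (A' s x) /\
     clim (locally x) (A s) (A s x)) ->
  (forall s x, 0 < s < 1 -> cderiv (B s) x (A' s x)) ->
  (forall s, B s (2 * PI) = B s 0) ->
  RInt (fun x => fst (A 1 x)) 0 (2 * PI) = RInt (fun x => fst (A 0 x)) 0 (2 * PI).
Proof.
  intros Hd HA HB HP.
  assert (Loc : forall s, - d < s < 1 + d -> locally s (fun y => - d < y < 1 + d)).
  { intros s Hs; apply (filter_and (F := locally s)); [apply (open_gt (- d) s)|apply (open_lt (1 + d) s)]; lra. }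
  assert (EX : forall s, - d < s < 1 + d -> ex_RInt (fun x => fst (A s x)) 0 (2 * PI)).
  { intros s Hs; apply (ex_RInt_continuous (V := R_CompleteNormedModule)); intros x _.
    destruct (HA s x Hs) as [_ [_ [h _]]]; exact h. }
  assert (D : forall s, - d < s < 1 + d ->
    is_derive (fun s => RInt (fun x => fst (A s x)) 0 (2 * PI)) s
      (RInt (fun x => fst (A' s x)) 0 (2 * PI))).
  { intros s Hs.
    assert (DD : forall u x, - d < u < 1 + d -> Derive (fun u => fst (A u x)) u = fst (A' u x)).
    { intros u x Hu; apply is_derive_unique; now destruct (HA u x Hu) as [[h _] _]. }
    eapply der_eq; [apply is_derive_RInt_param|].
    - generalize (Loc s Hs); apply filter_imp; intros u Hu x _.
      exists (fst (A' u x)); now destruct (HA u x Hu) as [[h _] _].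
    - intros x _; apply continuity_2d_pt_ext_loc with (fun u x => fst (A' u x)).
      + destruct (Loc s Hs) as [e He]; exists e; intros u v Hu _; rewrite DD; auto.
      + apply continuity_2d_pt_filterlim; destruct (HA s x Hs) as [_ [[h _] _]]; exact h.
    - generalize (Loc s Hs); apply filter_imp; intros u Hu; now apply EX.
    - apply RInt_ext; intros x _; now apply DD. }
  assert (Z : forall s, 0 < s < 1 -> RInt (fun x => fst (A' s x)) 0 (2 * PI) = 0).
  { intros s Hs; apply is_RInt_unique.
    replace 0 with (minus (fst (B s (2 * PI))) (fst (B s 0))) at 2
      by (rewrite HP; exact (minus_eq_zero (G := R_AbelianGroup) _)).
    apply (is_RInt_derive (V := R_CompleteNormedModule) (fun x => fst (B s x))).
    - intros x _; now destruct (HB s x Hs).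
    - intros x _; destruct (HA s x ltac:(lra)) as [_ [[h _] _]].
      refine (filterlim_comp _ _ _ (fun x => (s, x)) (fun p => fst (A' (fst p) (snd p))) _ _ _ _ h).
      intros P [e He]; exists e; intros y Hy; apply He; split; simpl; auto; apply ball_center. }
  destruct (MVT_gen (fun s => RInt (fun x => fst (A s x)) 0 (2 * PI)) 0 1 (fun _ => 0)) as [c [_ E]].
  - rewrite Rmin_left, Rmax_right by lra; intros s Hs; eapply der_eq; [apply D; lra|now apply Z].
  - rewrite Rmin_left, Rmax_right by lra; intros s Hs.
    eapply der_continuity_pt; apply D; lra.
  - lra.
Qed.

Definition circ (r x : R) : C := (r * cos x, r * sin x).

Lemma circ_cderiv r x : cderiv (circ r) x (Cmul (0, 1) (circ r x)).
Proof. split; simpl; auto_derive; auto; ring. Qed.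

Lemma circ_per r : circ r (2 * PI) = circ r 0.
Proof. unfold circ; rewrite cos_2PI, sin_2PI, cos_0, sin_0; reflexivity. Qed.

Lemma circ_norm2 r x : Cnorm2 (circ r x) = r * r.
Proof.
  cunf; pose proof (sin2_cos2 x) as H; unfold Rsqr, circ in *; simpl.
  replace (r * r) with (r * r * (sin x * sin x + cos x * cos x)) by (rewrite H; ring); ring.
Qed.

Lemma circ_mod r x : 0 <= r -> Cabs (circ r x) = r.
Proof.
  intros Hr; pose proof (Cabs_sq (circ r x)) as H; rewrite circ_norm2 in H.
  pose proof (Cabs_pos (circ r x)); nra.
Qed.

Lemma clim_of_cderiv {T} {F : (T -> Prop) -> Prop} {FF : Filter F} (g : R -> C) (h : T -> R) a l :
  cderiv g a l -> filterlim h F (locally a) -> clim F (fun x => g (h x)) (g a).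
Proof.
  intros Hg Hh; destruct (cderiv_continuous _ _ _ Hg) as [h1 h2].
  split; [apply (lim_comp (fun x => fst (g x)))|apply (lim_comp (fun x => snd (g x)))]; auto.
Qed.

Lemma neq_of_mod_lt a b : Cabs a < Cabs b -> Csub b a <> C0.
Proof.
  intros H E; pose proof (Cabs_sub_ge b a) as H1; rewrite E in H1.
  assert (Cabs C0 = 0) by exact Cabs_0; lra.
Qed.

Lemma cderiv_RtoC s : cderiv RtoC s C1.
Proof. split; simpl; [apply der_id|apply der_const]. Qed.

Lemma fst_lim s x : filterlim (fun p : R * R => fst p) (locally (s, x)) (locally s).
Proof. exact (continuous_fst (U := R_UniformSpace) (V := R_UniformSpace) s x). Qed.
Lemma snd_lim s x : filterlim (fun p : R * R => snd p) (locally (s, x)) (locally x).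
Proof. exact (continuous_snd (U := R_UniformSpace) (V := R_UniformSpace) s x). Qed.

(** The pole is moved from [z0] to 0 through [s z0]; at [s = 0] the integrand is the constant [c].
    The [s]-derivative [w z0 / (w - s z0)^2] is the derivative along the circle of
    [i z0 / (w - s z0)]. *)
Lemma cauchy_kernel r z0 c : 0 < r -> Cabs z0 < r ->
  RInt (fun x => fst (Cmul c (Cdiv (circ r x) (Csub (circ r x) z0)))) 0 (2 * PI) = 2 * PI * fst c.
Proof.
  intros Hr Hz.
  (* Small enough for [(1 + d) |z0| < r], so the moving pole stays strictly inside the circle for
     all parameters. *)
  set (d := (r - Cabs z0) / (2 * r)).
  assert (Hd : 0 < d) by (apply Rdiv_lt_0_compat; lra).
  assert (Hd2 : (1 + d) * Cabs z0 < r).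
  { assert (d * r = (r - Cabs z0) / 2) by (unfold d; field; lra).
    pose proof (Cabs_pos z0); nra. }
  assert (NZ : forall s x, - d < s < 1 + d -> Csub (circ r x) (Cmul (RtoC s) z0) <> C0).
  { intros s x Hs; apply neq_of_mod_lt; rewrite Cabs_mul, Cabs_real, circ_mod by lra.
    assert (Rabs s < 1 + d) by (apply Rabs_def1; lra).
    pose proof (Cabs_pos z0); nra. }
  pose proof (homotopy (fun s x => Cmul c (Cmul (circ r x) (Cinv (Csub (circ r x) (Cmul (RtoC s) z0)))))
    (fun s x => Cmul c (Cmul (circ r x) (Cmul z0 (Csq (Cinv (Csub (circ r x) (Cmul (RtoC s) z0)))))))
    (fun s x => Cmul (Cmul c (Cmul (0, 1) z0)) (Cinv (Csub (circ r x) (Cmul (RtoC s) z0)))) d Hd) as H.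
  rewrite (RInt_ext _ (fun x => fst (Cmul c (Cmul (circ r x) (Cinv (Csub (circ r x) (Cmul (RtoC 1) z0))))))).
  2:{ intros x _; unfold Cdiv; replace (Cmul (RtoC 1) z0) with z0; auto; change (RtoC 1) with C1; ring. }
  rewrite H; clear H.
  - rewrite (RInt_ext _ (fun _ => fst c)).
    + rewrite RInt_const; unfold scal; simpl; unfold mult; simpl; ring.
    + intros x _; f_equal; change (RtoC 0) with C0.
      assert (circ r x <> C0).
      { intros E; pose proof (circ_norm2 r x) as h; rewrite E in h; revert h; cunf; nra. }
      field; intros E; apply H; rewrite <- E; ring.
  - intros s x Hs; pose proof (NZ s x Hs) as N.
    assert (D : cderiv (fun s => Csub (circ r x) (Cmul (RtoC s) z0)) s (Copp z0)).
    { eapply cderiv_eq; [apply cderiv_add; [apply cderiv_const|apply cderiv_opp, cderiv_mul;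
        [apply cderiv_RtoC|apply cderiv_const]]|]; cbv beta; ring. }
    split; [|split].
    + eapply cderiv_eq; [apply cderiv_mul; [apply cderiv_const|apply cderiv_mul;
        [apply cderiv_const|apply cderiv_inv; [exact N|exact D]]]|]; cbv beta; unfold Csq; ring.
    + assert (L : clim (locally (s, x)) (fun p : R * R => circ r (snd p)) (circ r x))
        by (eapply clim_of_cderiv; [apply circ_cderiv|apply snd_lim]).
      apply clim_mul; [apply clim_const|]; apply clim_mul; auto.
      apply clim_mul; [apply clim_const|]; unfold Csq.
      apply clim_mul; (apply clim_inv; [exact N|]); apply clim_add; auto; apply clim_opp, clim_mul;
        (apply clim_const || (eapply clim_of_cderiv; [apply cderiv_RtoC|apply fst_lim])).
    + assert (L : clim (locally x) (circ r) (circ r x))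
        by (eapply cderiv_continuous; apply circ_cderiv).
      apply clim_mul; [apply clim_const|]; apply clim_mul; auto.
      apply clim_inv; auto; apply clim_add; auto; apply clim_const.
  - intros s x Hs; assert (Hs' : - d < s < 1 + d) by lra; pose proof (NZ s x Hs') as N.
    eapply cderiv_eq; [apply cderiv_mul; [apply cderiv_const|apply cderiv_inv; [exact N|
      apply cderiv_add; [apply circ_cderiv|apply cderiv_const]]]|].
    assert (I : Cmul (0, 1) (0, 1) = Copp C1) by (apply Ceq; cunf; ring).
    cbv beta; transitivity (Copp (Cmul (Cmul (0, 1) (0, 1)) (Cmul c (Cmul (circ r x) (Cmul z0
      (Csq (Cinv (Csub (circ r x) (Cmul (RtoC s) z0)))))))));
      [unfold Csq; ring|rewrite I; ring].
  - intros s; now rewrite circ_per.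
Qed.

(** One-variable counterpart of [Hol] on the disc of radius [R0], with the derivative given
    explicitly and continuous. *)
Definition hol1 (R0 : R) (f f' : C -> C) : Prop :=
  (forall g l t, cderiv g t l -> Cabs (g t) < R0 -> cderiv (fun s => f (g s)) t (Cmul (f' (g t)) l)) /\
  (forall c : R * R, Cabs c < R0 -> clim (locally c) f' (f' c)).

Lemma clim_comp {T} {F : (T -> Prop) -> Prop} {FF : Filter F} (f : C -> C) (g : T -> C) (c : R * R) l :
  clim (locally c) f l -> clim F g c -> clim F (fun x => f (g x)) l.
Proof.
  intros [h1 h2] [g1 g2].
  assert (L : filterlim g F (locally c)).
  { intros P [e He]; unfold filtermap.
    assert (A1 : F (fun x => ball (fst c) e (fst (g x)))) by (apply g1; now exists e).
    assert (A2 : F (fun x => ball (snd c) e (snd (g x)))) by (apply g2; now exists e).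
    apply filter_imp with (2 := filter_and _ _ A1 A2); intros x Hx; now apply He. }
  split; [exact (filterlim_comp _ _ _ _ _ _ _ _ L h1)|exact (filterlim_comp _ _ _ _ _ _ _ _ L h2)].
Qed.

Section Cauchy.
Variables (R0 r : R) (f f' : C -> C) (z0 : C).
Hypotheses (Hf : hol1 R0 f f') (Hr : 0 < r) (HR : r < R0) (Hz : Cabs z0 < r).

Lemma circ_clim x : clim (locally x) (circ r) (circ r x).
Proof. eapply cderiv_continuous; apply circ_cderiv. Qed.

Lemma f_circ_clim x : clim (locally x) (fun x => f (circ r x)) (f (circ r x)).
Proof.
  destruct Hf as [H _].
  exact (cderiv_continuous _ _ _ (H (circ r) _ x (circ_cderiv r x) ltac:(rewrite circ_mod; lra))).
Qed.

Lemma circ_neq x : Csub (circ r x) z0 <> C0.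
Proof. apply neq_of_mod_lt; rewrite circ_mod; lra. Qed.

Lemma circ_neq0 x : circ r x <> C0.
Proof. intros E; pose proof (circ_norm2 r x) as h; rewrite E in h; revert h; cunf; nra. Qed.

Lemma ex_RInt_clim (g : R -> C) : (forall x, clim (locally x) g (g x)) ->
  ex_RInt (fun x => fst (g x)) 0 (2 * PI).
Proof.
  intros H; apply (ex_RInt_continuous (V := R_CompleteNormedModule)); intros x _; apply H.
Qed.

(** The circle is contracted to [z0] inside the argument of [f] only, the kernel being left alone;
    this reduces to [cauchy_kernel] with the constant [f z0]. The primitive along the circle is
    [f / (i s)], singular at [s = 0]. *)
Lemma cauchy : is_RInt (fun x => fst (Cmul (f (circ r x)) (Cdiv (circ r x) (Csub (circ r x) z0))))
  0 (2 * PI) (2 * PI * fst (f z0)).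
Proof.
  destruct Hf as [H1 H2].
  rewrite <- (cauchy_kernel r z0 (f z0) Hr Hz).
  (* Chosen so that [(1 + 2 d) r = R0]: for [s] in the enlarged interval [|1 - s| + |s| < 1 + 2 d],
     hence the contracted circle stays in the disc where [f] is holomorphic. *)
  set (d := (R0 - r) / (2 * r)).
  assert (Hd : 0 < d) by (apply Rdiv_lt_0_compat; lra).
  set (ga := fun s x => Cadd z0 (Cmul (RtoC s) (Csub (circ r x) z0))).
  assert (G : forall s x, - d < s < 1 + d -> Cabs (ga s x) < R0).
  { intros s x Hs; unfold ga.
    replace (Cadd z0 (Cmul (RtoC s) (Csub (circ r x) z0))) with
      (Cadd (Cmul (RtoC (1 - s)) z0) (Cmul (RtoC s) (circ r x))) by (apply Ceq; cunf; ring).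
    eapply Rle_lt_trans; [apply Cabs_add|]; rewrite !Cabs_mul, !Cabs_real, circ_mod by lra.
    assert (E : d * r = (R0 - r) / 2) by (unfold d; field; lra).
    assert (Rabs (1 - s) + Rabs s < 1 + 2 * d).
    { unfold Rabs; destruct (Rcase_abs (1 - s)), (Rcase_abs s); lra. }
    pose proof (Rabs_pos (1 - s)); pose proof (Rabs_pos s); pose proof (Cabs_pos z0); nra. }
  assert (K : forall x, clim (locally x) (fun x => Cmul (circ r x) (Cinv (Csub (circ r x) z0)))
     (Cmul (circ r x) (Cinv (Csub (circ r x) z0)))).
  { intros x; apply clim_mul; [apply circ_clim|]; apply clim_inv; [apply circ_neq|].
    apply clim_add; [apply circ_clim|apply clim_const]. }
  assert (E : RInt (fun x => fst (Cmul (f (circ r x)) (Cdiv (circ r x) (Csub (circ r x) z0)))) 0 (2 * PI)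
    = RInt (fun x => fst (Cmul (f z0) (Cdiv (circ r x) (Csub (circ r x) z0)))) 0 (2 * PI)).
  { pose proof (homotopy (fun s x => Cmul (f (ga s x)) (Cmul (circ r x) (Cinv (Csub (circ r x) z0))))
      (fun s x => Cmul (f' (ga s x)) (circ r x))
      (fun s x => Cmul (0, - / s) (f (ga s x))) d Hd) as H.
    rewrite (RInt_ext _ (fun x => fst (Cmul (f (ga 1 x)) (Cmul (circ r x) (Cinv (Csub (circ r x) z0)))))).
    2:{ intros x _; unfold Cdiv, ga; do 3 f_equal; change (RtoC 1) with C1; ring. }
    rewrite H; clear H.
    - apply RInt_ext; intros x _; unfold Cdiv, ga; do 3 f_equal; change (RtoC 0) with C0; ring.
    - intros s x Hs; specialize (G s x Hs).
      assert (D : cderiv (fun s => ga s x) s (Csub (circ r x) z0)).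
      { eapply cderiv_eq; [apply cderiv_add; [apply cderiv_const|apply cderiv_mul;
          [apply cderiv_RtoC|apply cderiv_const]]|]; cbv beta; ring. }
      split; [|split].
      + eapply cderiv_eq; [apply cderiv_mul; [apply (H1 (fun s => ga s x) _ s D G)|apply cderiv_const]|].
        cbv beta; field; apply circ_neq.
      + apply clim_mul; [|eapply clim_of_cderiv; [apply circ_cderiv|apply snd_lim]].
        apply (clim_comp f' (fun p : R * R => ga (fst p) (snd p)) (ga s x)); [now apply H2|].
        apply clim_add; [apply clim_const|]; apply clim_mul;
          [eapply clim_of_cderiv; [apply cderiv_RtoC|apply fst_lim]|].
        apply clim_add; [eapply clim_of_cderiv; [apply circ_cderiv|apply snd_lim]|apply clim_const].
      + apply clim_mul; auto.
        assert (D' : cderiv (ga s) x (Cmul (RtoC s) (Cmul (0, 1) (circ r x)))).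
        { eapply cderiv_eq; [apply cderiv_add; [apply cderiv_const|apply cderiv_mul;
            [apply cderiv_const|apply cderiv_add; [apply circ_cderiv|apply cderiv_const]]]|]; cbv beta; ring. }
        exact (cderiv_continuous _ _ _ (H1 (ga s) _ x D' G)).
    - intros s x Hs; assert (Hs' : - d < s < 1 + d) by lra.
      assert (D' : cderiv (ga s) x (Cmul (RtoC s) (Cmul (0, 1) (circ r x)))).
      { eapply cderiv_eq; [apply cderiv_add; [apply cderiv_const|apply cderiv_mul;
          [apply cderiv_const|apply cderiv_add; [apply circ_cderiv|apply cderiv_const]]]|]; cbv beta; ring. }
      eapply cderiv_eq; [apply cderiv_mul; [apply cderiv_const|exact (H1 (ga s) _ x D' (G s x Hs'))]|].
      cbv beta; transitivity (Cmul (Cmul (Cmul (0, - / s) (RtoC s)) (0, 1)) (Cmul (f' (ga s x)) (circ r x)));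
        [ring|].
      replace (Cmul (Cmul (0, - / s) (RtoC s)) (0, 1)) with C1; [ring|].
      apply Ceq; cunf; field; lra.
    - intros s; unfold ga; now rewrite circ_per. }
  rewrite <- E; apply (RInt_correct (V := R_CompleteNormedModule)).
  apply ex_RInt_clim; intros x; apply clim_mul; [apply f_circ_clim|apply K].
Qed.

Lemma kernel_bound x : Cnorm2 (Cdiv (circ r x) (Csub (circ r x) z0)) <= (r / (r - Cabs z0)) ^ 2.
Proof.
  assert (A : Cnorm2 (Cdiv (circ r x) (Csub (circ r x) z0)) * Cnorm2 (Csub (circ r x) z0) = r * r).
  { rewrite <- Cnorm2_mul, <- (circ_norm2 r x); f_equal; field; apply circ_neq. }
  assert (B : (r - Cabs z0) * (r - Cabs z0) <= Cnorm2 (Csub (circ r x) z0)).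
  { pose proof (Cabs_sub_ge (circ r x) z0) as h; rewrite circ_mod in h by lra.
    rewrite <- Cabs_sq; nra. }
  set (N := Cnorm2 (Cdiv _ _)) in *; assert (0 <= N) by apply Cnorm2_pos.
  apply Rmult_le_reg_r with ((r - Cabs z0) * (r - Cabs z0)); [nra|].
  replace ((r / (r - Cabs z0)) ^ 2 * ((r - Cabs z0) * (r - Cabs z0))) with (r * r) by (field; lra).
  nra.
Qed.

Lemma norm2_circ_ex : ex_RInt (fun x => Cnorm2 (f (circ r x))) 0 (2 * PI).
Proof.
  apply (ex_RInt_continuous (V := R_CompleteNormedModule)); intros x _.
  exact (lim_Cnorm2 _ _ (f_circ_clim x)).
Qed.
End Cauchy.

(** * Consequences of Cauchy's formula: L^2 estimate and derivative at the centre *)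

Lemma hol1_lin R0 f f' a b : hol1 R0 f f' ->
  hol1 R0 (fun z => Cadd (Cmul a (f z)) (Cmul b z)) (fun z => Cadd (Cmul a (f' z)) b).
Proof.
  intros [H1 H2]; split.
  - intros g l t Hg Hm; eapply cderiv_eq.
    + apply cderiv_add; (apply cderiv_mul; [apply cderiv_const|]); [exact (H1 g l t Hg Hm)|exact Hg].
    + cbv beta; ring.
  - intros c Hc; apply clim_add; [|apply clim_const]; apply clim_mul; [apply clim_const|auto].
Qed.

Lemma hol1_scal R0 f f' a : hol1 R0 f f' -> hol1 R0 (fun z => Cmul a (f z)) (fun z => Cmul a (f' z)).
Proof.
  intros [H1 H2]; split.
  - intros g l t Hg Hm; eapply cderiv_eq.
    + apply cderiv_mul; [apply cderiv_const|exact (H1 g l t Hg Hm)].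
    + cbv beta; ring.
  - intros c Hc; apply clim_mul; [apply clim_const|auto].
Qed.

Definition Cconj (a : C) : C := (fst a, - snd a).

(** With [q = f z0], Cauchy's formula for [conj q * f] has the real value [|q|^2]. Young's
    inequality, weighted by the upper bound [k] of the squared kernel, bounds the integrand by
    [(|q|^2 + k |f|^2) / 2], and half of [|q|^2] is absorbed on the left. *)
Lemma cauchy_l2 R0 r f f' z0 : hol1 R0 f f' -> 0 < r -> r < R0 -> Cabs z0 < r ->
  2 * PI * Cnorm2 (f z0) <= (r / (r - Cabs z0)) ^ 2 * RInt (fun x => Cnorm2 (f (circ r x))) 0 (2 * PI).
Proof.
  intros Hf Hr HR Hz; set (k := (r / (r - Cabs z0)) ^ 2).
  assert (Hk : 0 < k) by (apply pow_lt, Rdiv_lt_0_compat; lra).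
  set (q := f z0).
  pose proof (cauchy R0 r _ _ z0 (hol1_scal R0 f f' (Cconj q) Hf) Hr HR Hz) as H.
  pose proof (RInt_correct (V := R_CompleteNormedModule) _ _ _ (norm2_circ_ex R0 r f f' Hf Hr HR)) as H2.
  set (I := RInt (fun x => Cnorm2 (f (circ r x))) 0 (2 * PI)) in *.
  assert (H3 : is_RInt (fun x => k / 2 * Cnorm2 (f (circ r x)) + Cnorm2 q / 2) 0 (2 * PI)
     (k / 2 * I + (2 * PI - 0) * (Cnorm2 q / 2))).
  { apply (is_RInt_plus (V := R_NormedModule)).
    - apply (is_RInt_scal (V := R_NormedModule)); exact H2.
    - apply (is_RInt_const (V := R_NormedModule)). }
  pose proof PI_RGT_0.
  assert (L : 2 * PI * fst (Cmul (Cconj q) (f z0)) <= k / 2 * I + (2 * PI - 0) * (Cnorm2 q / 2)).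
  { apply (is_RInt_le _ _ 0 (2 * PI) _ _ ltac:(lra) H H3).
    intros x _; pose proof (kernel_bound r z0 Hr Hz x) as B; fold k in B.
    set (K := Cdiv _ _) in *; set (v := f (circ r x)).
    assert (Hp : forall a b : C, fst (Cmul a b) <= (Cnorm2 a * / k + k * Cnorm2 b) / 2).
    { intros a b; assert (kk : k * / k = 1) by (field; lra).
      assert (0 < / k) by (apply Rinv_0_lt_compat; lra).
      assert (E : forall x y, x * y <= (x * x * / k + k * (y * y)) / 2).
      { intros x0 y0; assert (0 <= / k * ((x0 - k * y0) * (x0 - k * y0))).
        { apply Rmult_le_pos; [lra|]; apply Rle_0_sqr. }
        assert (/ k * ((x0 - k * y0) * (x0 - k * y0)) = x0 * x0 * / k + k * (y0 * y0) - 2 * (x0 * y0))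
          by (field; lra); lra. }
      pose proof (E (fst a) (fst b)); pose proof (E (snd a) (- snd b)); cunf; lra. }
    specialize (Hp (Cmul (Cconj q) K) v).
    replace (Cmul (Cmul (Cconj q) v) K) with (Cmul (Cmul (Cconj q) K) v) by ring.
    eapply Rle_trans; [exact Hp|]; rewrite Cnorm2_mul.
    replace (Cnorm2 (Cconj q)) with (Cnorm2 q) by (unfold Cconj; cunf; ring).
    assert (Cnorm2 q * Cnorm2 K * / k <= Cnorm2 q); [|lra].
    apply Rmult_le_reg_r with k; auto; rewrite Rmult_assoc, Rinv_l, Rmult_1_r by lra.
    pose proof (Cnorm2_pos q); nra. }
  replace (fst (Cmul (Cconj q) (f z0))) with (Cnorm2 q) in L by (unfold Cconj, q; cunf; ring).
  lra.
Qed.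

(** Takes the place of the identity theorem when a formula for [tau] is carried from multiples of
    real vectors to all points near 0. *)
Lemma zero_on_circle R0 r f f' z0 : hol1 R0 f f' -> 0 < r -> r < R0 -> Cabs z0 < r ->
  (forall x, f (circ r x) = C0) -> f z0 = C0.
Proof.
  intros Hf Hr HR Hz H; pose proof (cauchy_l2 R0 r f f' z0 Hf Hr HR Hz) as L.
  rewrite (RInt_ext _ (fun _ => 0)) in L by (intros; Req; rewrite H; cunf; ring).
  rewrite RInt_const in L; unfold scal in L; simpl in L; unfold mult in L; simpl in L.
  rewrite !Rmult_0_r in L; pose proof PI_RGT_0; pose proof (Cnorm2_pos (f z0)).
  apply Cnorm2_eq0; nra.
Qed.

(** Cauchy's formula for the derivative, obtained by expanding Cauchy's formula at a small real [t]
    to first order and comparing with the definition of the derivative at 0. *)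
Lemma cauchy_coef R0 r f f' : hol1 R0 f f' -> 0 < r -> r < R0 -> f C0 = C0 ->
  is_RInt (fun x => fst (Cdiv (f (circ r x)) (circ r x))) 0 (2 * PI) (2 * PI * fst (f' C0)).
Proof.
  intros Hf Hr HR H0.
  assert (EX : ex_RInt (fun x => fst (Cdiv (f (circ r x)) (circ r x))) 0 (2 * PI)).
  { apply ex_RInt_clim; intros x; unfold Cdiv; apply clim_mul; [apply (f_circ_clim R0 r f f'); auto|].
    apply clim_inv; [now apply circ_neq0|apply circ_clim]. }
  pose proof (RInt_correct (V := R_CompleteNormedModule) _ _ _ EX) as HI.
  set (I := RInt (fun x => fst (Cdiv (f (circ r x)) (circ r x))) 0 (2 * PI)) in *.
  assert (EM : ex_RInt (fun x => Cnorm2 (f (circ r x)) + 1) 0 (2 * PI)).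
  { apply (ex_RInt_plus (V := R_NormedModule)); [now apply (norm2_circ_ex R0 r f f')|].
    apply ex_RInt_const. }
  pose proof (RInt_correct (V := R_CompleteNormedModule) _ _ _ EM) as HM.
  set (M := RInt (fun x => Cnorm2 (f (circ r x)) + 1) 0 (2 * PI)) in *.
  pose proof PI_RGT_0 as HPI.
  assert (H00 : Cabs C0 = 0) by exact Cabs_0.
  (* Uses [w / (w - t) = 1 + t / w + t^2 / (w (w - t))]. For [t <= r / 2] the last factor is at most
     [2 / r^2] in modulus, and [|v| <= |v|^2 + 1] bounds the remainder by a function already known
     to be integrable. *)
  assert (T : forall t, 0 < t <= r / 2 -> Rabs (2 * PI * fst (f (RtoC t)) - t * I) <= t * t * (2 / (r * r) * M)).
  { intros t Ht.
    assert (Hm : Cabs (RtoC t) = t) by (rewrite Cabs_real; apply Rabs_pos_eq; lra).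
    pose proof (cauchy R0 r f f' (RtoC t) Hf Hr HR ltac:(lra)) as K1.
    pose proof (cauchy R0 r f f' C0 Hf Hr HR ltac:(lra)) as K0.
    rewrite H0 in K0; simpl fst at 2 in K0; rewrite Rmult_0_r in K0.
    assert (K2 : is_RInt (fun x => fst (Cmul (f (circ r x)) (Cdiv (circ r x) (Csub (circ r x) (RtoC t))))
        - fst (Cmul (f (circ r x)) (Cdiv (circ r x) (Csub (circ r x) C0)))
        - t * fst (Cdiv (f (circ r x)) (circ r x))) 0 (2 * PI)
        (2 * PI * fst (f (RtoC t)) - 0 - t * I)).
    { apply (is_RInt_minus (V := R_NormedModule)); [apply (is_RInt_minus (V := R_NormedModule)); auto|].
      now apply (is_RInt_scal (V := R_NormedModule)). }
    rewrite Rminus_0_r in K2.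
    assert (K3 : is_RInt (fun x => t * t * (2 / (r * r)) * (Cnorm2 (f (circ r x)) + 1)) 0 (2 * PI)
       (t * t * (2 / (r * r)) * M)) by now apply (is_RInt_scal (V := R_NormedModule)).
    assert (B : forall x, Rabs (fst (Cmul (f (circ r x)) (Cdiv (circ r x) (Csub (circ r x) (RtoC t))))
        - fst (Cmul (f (circ r x)) (Cdiv (circ r x) (Csub (circ r x) C0)))
        - t * fst (Cdiv (f (circ r x)) (circ r x))) <= t * t * (2 / (r * r)) * (Cnorm2 (f (circ r x)) + 1)).
    { intros x; set (v := f (circ r x)).
      pose proof (circ_neq0 r Hr x) as N0.
      pose proof (circ_neq r (RtoC t) Hr ltac:(lra) x) as Nt.
      set (w := circ r x) in *.
      set (Q := Cinv (Cmul w (Csub w (RtoC t)))).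
      assert (E : fst (Cmul v (Cdiv w (Csub w (RtoC t)))) - fst (Cmul v (Cdiv w (Csub w C0)))
        - t * fst (Cdiv v w) = t * t * fst (Cmul v Q)).
      { transitivity (fst (Csub (Csub (Cmul v (Cdiv w (Csub w (RtoC t)))) (Cmul v (Cdiv w (Csub w C0))))
          (Cmul (RtoC t) (Cdiv v w)))); [unfold Csub; simpl; ring|].
        transitivity (fst (Cmul (Cmul (RtoC t) (RtoC t)) (Cmul v Q))); [|simpl; ring].
        f_equal; unfold Q; field; repeat split; auto. }
      rewrite E, Rabs_mult, (Rabs_pos_eq (t * t)) by nra.
      rewrite (Rmult_assoc (t * t)); apply Rmult_le_compat_l; [nra|].
      eapply Rle_trans; [apply fst_le_Cabs|]; rewrite Cabs_mul, Rmult_comm.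
      assert (Hv : Cabs v <= Cnorm2 v + 1) by (rewrite <- Cabs_sq; pose proof (Cabs_pos v); nra).
      assert (HQ : Cabs Q <= 2 / (r * r)).
      { assert (A : Cabs Q * (Cabs w * Cabs (Csub w (RtoC t))) = 1).
        { rewrite <- !Cabs_mul; transitivity (Cabs C1); [f_equal; unfold Q; field; auto|exact Cabs_1]. }
        pose proof (Cabs_sub_ge w (RtoC t)) as h.
        assert (Hw : Cabs w = r) by (apply circ_mod; lra); rewrite Hw in *.
        pose proof (Cabs_pos Q).
        apply Rmult_le_reg_r with (r * r); [nra|]; replace (2 / (r * r) * (r * r)) with 2 by (field; lra).
        nra. }
      apply Rmult_le_compat; auto; apply Cabs_pos. }
    rewrite <- Rmult_assoc.
    assert (U : 2 * PI * fst (f (RtoC t)) - t * I <= t * t * (2 / (r * r)) * M).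
    { apply (is_RInt_le _ _ 0 (2 * PI) _ _ ltac:(lra) K2 K3); intros x _.
      eapply Rle_trans; [apply Rle_abs|apply B]. }
    assert (L : - (t * t * (2 / (r * r)) * M) <= 2 * PI * fst (f (RtoC t)) - t * I).
    { pose proof (is_RInt_opp (V := R_NormedModule) _ _ _ _ K3) as K4.
      apply (is_RInt_le _ _ 0 (2 * PI) _ _ ltac:(lra) K4 K2); intros x _.
      specialize (B x); apply Rabs_le_between in B; exact (proj1 B). }
    apply Rabs_le; lra. }
  set (N := 2 / (r * r) * M) in *.
  replace (2 * PI * fst (f' C0)) with I; [exact HI|].
  destruct Hf as [Hf _]; destruct (Hf RtoC C1 0 (cderiv_RtoC 0)) as [D _].
  { change (RtoC 0) with C0; lra. }
  change (RtoC 0) with C0 in D.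
  replace (fst (Cmul (f' C0) C1)) with (fst (f' C0)) in D by (cunf; ring).
  set (p := fst (f' C0)) in *; set (df := Rabs (I - 2 * PI * p)).
  assert (EE : forall e, 0 < e -> df <= e).
  { intros e He.
    destruct (proj1 (is_derive_eps _ _ _) D (e / (4 * PI)) ltac:(apply Rdiv_lt_0_compat; lra)) as [d Hd].
    (* The three bounds on [t] serve [T], the differentiability estimate, and making the quadratic
       error [t^2 N] at most [t e / 2]. *)
    set (t := Rmin (Rmin (r / 2) (d / 2)) (e / (2 * (Rabs N + 1)))).
    pose proof (Rabs_pos N) as PN; destruct d as [d Pd]; simpl in *.
    assert (Ht : 0 < t).
    { repeat apply Rmin_glb_lt; try lra; apply Rdiv_lt_0_compat; lra. }
    assert (t1 : t <= r / 2) by (eapply Rle_trans; [apply Rmin_l|apply Rmin_l]).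
    assert (t2 : t <= d / 2) by (eapply Rle_trans; [apply Rmin_l|apply Rmin_r]).
    assert (t3 : t <= e / (2 * (Rabs N + 1))) by apply Rmin_r.
    assert (t4 : t * (Rabs N + 1) <= e / 2).
    { apply Rle_trans with (e / (2 * (Rabs N + 1)) * (Rabs N + 1)); [apply Rmult_le_compat_r; lra|].
      right; field; lra. }
    specialize (Hd t); assert (Bt : ball 0 d t).
    { unfold ball; simpl; unfold AbsRing_ball, abs, minus, plus, opp; simpl.
      apply Rabs_def1; lra. }
    specialize (Hd Bt); cbv beta in Hd; change (RtoC 0) with C0 in Hd; rewrite H0 in Hd; simpl fst in Hd; rewrite !Rminus_0_r, (Rabs_pos_eq t) in Hd by lra.
    specialize (T t ltac:(lra)).
    assert (Z : t * df <= t * e); [|apply Rmult_le_reg_l with t; auto].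
    assert (T' : Rabs (2 * PI * fst (f (RtoC t)) - t * I) <= t * (e / 2)).
    { eapply Rle_trans; [exact T|]; pose proof (Rle_abs N); nra. }
    assert (H5 : Rabs (2 * PI * fst (f (RtoC t)) - 2 * PI * (t * p)) <= t * (e / 2)).
    { replace (2 * PI * fst (f (RtoC t)) - 2 * PI * (t * p)) with (2 * PI * (fst (f (RtoC t)) - t * p)) by ring.
      rewrite Rabs_mult, (Rabs_pos_eq (2 * PI)) by lra.
      replace (t * (e / 2)) with (2 * PI * (e / (4 * PI) * t)) by (field; lra).
      apply Rmult_le_compat_l; lra. }
    replace (t * df) with (Rabs ((2 * PI * fst (f (RtoC t)) - 2 * PI * (t * p)) -
      (2 * PI * fst (f (RtoC t)) - t * I))).
    - apply Rabs_le_between in H5; apply Rabs_le_between in T'; apply Rabs_le; lra.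
    - transitivity (Rabs (t * (I - 2 * PI * p))); [f_equal; ring|].
      rewrite Rabs_mult, (Rabs_pos_eq t) by lra; reflexivity. }
  assert (Hdf : df = 0).
  { pose proof (Rabs_pos (I - 2 * PI * p)); fold df in H.
    destruct (Rle_lt_or_eq_dec _ _ H) as [h|h]; auto; specialize (EE (df / 2)); lra. }
  unfold df in Hdf; destruct (Req_dec (I - 2 * PI * p) 0) as [h|h]; [lra|].
  now apply Rabs_no_R0 in h.
Qed.

(** * Schwarz lemma *)

Definition vzero : Vec := fun _ => C0.
Definition aff (P V : Vec) (c : C) : Vec := fun k => Cadd (P k) (Cmul c (V k)).

Lemma lim_lt {T} {F : (T -> Prop) -> Prop} {FF : Filter F} (f : T -> R) a b :
  filterlim f F (locally a) -> a < b -> F (fun x => f x < b).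
Proof. intros H Hab; exact (H (fun y => y < b) (open_lt b a Hab)). Qed.

Lemma hol1_affine m U F Q P V R0 : Hol m U F Q -> (forall c, Cabs c < R0 -> U (aff P V c)) ->
  hol1 R0 (fun c => F (aff P V c)) (fun c => sumC m (fun j => Cmul (Q j (aff P V c)) (V j))).
Proof.
  intros [H1 [H2 H3]] HU.
  assert (L : forall c : R * R, Cabs c < R0 -> filterlim (aff P V) (locally c) (near m U (aff P V c))).
  { intros c Hc B [d [Hd HB]]; unfold filtermap.
    assert (I : clim (locally c) (fun x : R * R => x) c).
    { destruct c; split; [apply fst_lim|apply snd_lim]. }
    assert (L1 : locally c (fun x => normsq m (vsub (aff P V x) (aff P V c)) < d)).
    { apply normsq_lim; auto; intros j _; unfold aff; apply clim_add; [apply clim_const|].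
      apply clim_mul; [exact I|apply clim_const]. }
    assert (L2 : locally c (fun x : R * R => Cabs x < R0)).
    { assert (h : filterlim (fun x => Cnorm2 x) (locally c) (locally (Cnorm2 c))) by now apply lim_Cnorm2.
      assert (P0 : 0 < R0) by (pose proof (Cabs_pos c); lra).
      apply filter_imp with (2 := lim_lt _ _ _ h (proj1 (Cabs_lt_sq c R0 ltac:(lra)) Hc)).
      intros x Hx; apply Cabs_lt_sq; auto; lra. }
    apply filter_imp with (2 := filter_and _ _ L1 L2); intros x [h1 h2]; auto. }
  split.
  - intros g l t Hg Hm; eapply cderiv_eq.
    + apply (H1 (fun s => aff P V (g s)) (fun j => Cmul l (V j))).
      * assert (P0 : 0 < R0) by (pose proof (Cabs_pos (g t)); lra).
        pose proof (lim_Cnorm2 _ _ (cderiv_continuous _ _ _ Hg)) as h.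
        apply filter_imp with (2 := lim_lt _ _ _ h (proj1 (Cabs_lt_sq (g t) R0 ltac:(lra)) Hm)).
        intros s Hs; apply HU, Cabs_lt_sq; auto; lra.
      * intros j _; unfold aff; eapply cderiv_eq; [apply cderiv_add; [apply cderiv_const|
          apply cderiv_mul; [exact Hg|apply cderiv_const]]|]; cbv beta; ring.
    + cbv beta; rewrite (sumC_ext _ (fun j => Cmul _ (Cmul l (V j)))
        (fun j => Cmul l (Cmul (Q j (aff P V (g t))) (V j)))) by (intros; ring).
      rewrite sumC_scal; ring.
  - intros c Hc; apply (clim_sumC m (fun j x => Cmul (Q j (aff P V x)) (V j))); intros j Hj.
    apply clim_mul; [|apply clim_const].
    destruct (H2 j Hj (aff P V c) (HU c Hc)) as [h1 h2].
    split; [exact (filterlim_comp _ _ _ _ _ _ _ _ (L c Hc) h1)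
           |exact (filterlim_comp _ _ _ _ _ _ _ _ (L c Hc) h2)].
Qed.

Lemma is_RInt_sumR m (f : nat -> R -> R) (I : nat -> R) a b :
  (forall j, (j < m)%nat -> is_RInt (f j) a b (I j)) ->
  is_RInt (fun x => sumR m (fun j => f j x)) a b (sumR m I).
Proof.
  induction m as [|m IH]; intros H; simpl.
  - pose proof (is_RInt_const (V := R_NormedModule) a b 0) as K.
    unfold scal in K; simpl in K; unfold mult in K; simpl in K; now rewrite Rmult_0_r in K.
  - apply (is_RInt_plus (V := R_NormedModule)); [apply IH; intros; apply H; lia|apply H; lia].
Qed.

Section Schwarz.
Variables (m : nat) (f f' : nat -> C -> C).
Hypotheses (Hf : forall a, (a < m)%nat -> hol1 1 (f a) (f' a))
  (H0 : forall a, (a < m)%nat -> f a C0 = C0)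
  (HB : forall c, Cabs c < 1 -> sumR m (fun a => Cnorm2 (f a c)) <= 2).
Let w a := f' a C0.
(** The remainder after the linear term. The factor [C1] gives it the shape handled by
    [hol1_lin]. *)
Let k a := fun c => Cadd (Cmul C1 (f a c)) (Cmul (Copp (w a)) c).
Let W := sumR m (fun a => Cnorm2 (w a)).

(** Pythagoras on the circle: the remainder [k] is L^2-orthogonal to the linear term, the cross term
    being evaluated by [cauchy_coef]. Hence the mean of [|k|^2] is the mean of [|f|^2] minus
    [r^2 W]. *)
Lemma schwarz_l2 r : 0 < r < 1 ->
  sumR m (fun a => RInt (fun x => Cnorm2 (k a (circ r x))) 0 (2 * PI)) <= 2 * PI * (2 - r * r * W).
Proof.
  intros Hr; pose proof PI_RGT_0.
  assert (E1 : forall a, (a < m)%nat ->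
    is_RInt (fun x => Cnorm2 (f a (circ r x)) + - (2 * (r * r)) *
        fst (Cdiv (Cmul (Cconj (w a)) (f a (circ r x))) (circ r x)) + r * r * Cnorm2 (w a)) 0 (2 * PI)
      (RInt (fun x => Cnorm2 (k a (circ r x))) 0 (2 * PI))).
  { intros a Ha; apply is_RInt_ext with (fun x => Cnorm2 (k a (circ r x))).
    - intros x _; Req; pose proof (circ_norm2 r x) as N; unfold k, Cdiv, Cinv, Cconj; rewrite N.
      set (c := circ r x) in *; set (v := f a c); cunf; rewrite <- N; field; rewrite N; nra.
    - apply (RInt_correct (V := R_CompleteNormedModule)); eapply norm2_circ_ex; [|apply Hr|apply Hr].
      apply hol1_lin; now apply Hf. }
  assert (E2 : forall a, (a < m)%nat ->
    is_RInt (fun x => Cnorm2 (f a (circ r x))) 0 (2 * PI)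
      (RInt (fun x => Cnorm2 (k a (circ r x))) 0 (2 * PI) + 2 * PI * (r * r * Cnorm2 (w a)))).
  { intros a Ha.
    assert (K : is_RInt (fun x => fst (Cdiv (Cmul (Cconj (w a)) (f a (circ r x))) (circ r x))) 0 (2 * PI)
       (2 * PI * Cnorm2 (w a))).
    { replace (Cnorm2 (w a)) with (fst (Cmul (Cconj (w a)) (f' a C0)))
        by (unfold w, Cconj; cunf; ring).
      apply (cauchy_coef 1 r _ _ (hol1_scal 1 _ _ (Cconj (w a)) (Hf a Ha))); try lra.
      rewrite H0 by auto; ring. }
    apply (is_RInt_scal (V := R_NormedModule) _ _ _ (2 * (r * r))) in K.
    pose proof (is_RInt_const (V := R_NormedModule) 0 (2 * PI) (- (r * r * Cnorm2 (w a)))) as K2.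
    pose proof (is_RInt_plus (V := R_NormedModule) _ _ _ _ _ _
      (is_RInt_plus (V := R_NormedModule) _ _ _ _ _ _ (E1 a Ha) K) K2) as K3.
    apply is_RInt_ext with (g := fun x => Cnorm2 (f a (circ r x))) in K3.
    - replace (RInt (fun x => Cnorm2 (k a (circ r x))) 0 (2 * PI) + 2 * PI * (r * r * Cnorm2 (w a)))
        with (RInt (fun x => Cnorm2 (k a (circ r x))) 0 (2 * PI) + 2 * (r * r) * (2 * PI * Cnorm2 (w a))
          + (2 * PI - 0) * (- (r * r * Cnorm2 (w a)))) by ring.
      exact K3.
    - intros x _; unfold plus, scal; simpl; unfold mult; simpl; Req; ring. }
  pose proof (is_RInt_sumR m _ _ _ _ E2) as E3.
  rewrite sumR_plus, !sumR_scal in E3; fold W in E3.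
  pose proof (is_RInt_const (V := R_NormedModule) 0 (2 * PI) 2) as E4.
  unfold scal in E4; simpl in E4; unfold mult in E4; simpl in E4.
  assert (L := is_RInt_le _ _ 0 (2 * PI) _ _ ltac:(lra) E3 E4).
  assert (sumR m (fun a => RInt (fun x => Cnorm2 (k a (circ r x))) 0 (2 * PI)) +
    2 * PI * (r * r * W) <= (2 * PI - 0) * 2); [|lra].
  apply L; intros x _; apply HB; rewrite circ_mod; lra.
Qed.

Lemma k_int_pos r a : 0 < r < 1 -> (a < m)%nat ->
  0 <= RInt (fun x => Cnorm2 (k a (circ r x))) 0 (2 * PI).
Proof.
  intros Hr Ha; pose proof PI_RGT_0; apply RInt_ge_0; try lra.
  - eapply norm2_circ_ex; [|apply Hr|apply Hr]; apply hol1_lin; now apply Hf.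
  - intros; apply Cnorm2_pos.
Qed.

Lemma schwarz_deriv : W <= 2.
Proof.
  destruct (Rle_lt_dec W 2) as [h|h]; auto; exfalso.
  (* Then [(1 - e)^2 W >= W - 2 e W = (W + 2) / 2 > 2], so the right-hand side of [schwarz_l2] is
     negative at radius [1 - e]. *)
  set (e := (W - 2) / (4 * W)).
  assert (He : e * W = (W - 2) / 4) by (unfold e; field; lra).
  assert (He0 : 0 < e) by (apply Rdiv_lt_0_compat; lra).
  assert (He1 : e < 1) by nra.
  pose proof (schwarz_l2 (1 - e) ltac:(lra)) as L; pose proof PI_RGT_0.
  assert (0 <= sumR m (fun a => RInt (fun x => Cnorm2 (k a (circ (1 - e) x))) 0 (2 * PI)))
    by (apply sumR_pos; intros; apply k_int_pos; auto; lra).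
  assert (0 <= 2 - (1 - e) * (1 - e) * W) by nra.
  nra.
Qed.

(** In the extremal case the L^2 norm of the remainder on the circle of radius [r] tends to 0 as [r]
    tends to 1, and [cauchy_l2] passes this on to each interior point. *)
Lemma schwarz_rigid : 2 <= W -> forall a c, (a < m)%nat -> Cabs c < 1 -> f a c = Cmul c (w a).
Proof.
  intros HW a c Ha Hc; pose proof PI_RGT_0 as HPI.
  assert (K : k a c = C0).
  { apply Cnorm2_eq0; set (q := Cnorm2 (k a c)).
    assert (Hq : 0 <= q) by apply Cnorm2_pos.
    destruct (Rle_lt_or_eq_dec _ _ Hq) as [hq|hq]; auto; exfalso.
    set (rho := Cabs c) in *; assert (0 <= rho) by apply Cabs_pos.
    (* [B] bounds the kernel constant for every [r >= (1 + rho) / 2]. With [e <= q / (8 B)] the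
       estimates end in [q <= 4 B e <= q / 2], which is absurd. *)
    set (B := (2 / (1 - rho)) ^ 2).
    assert (HB0 : 0 < B) by (apply pow_lt, Rdiv_lt_0_compat; lra).
    set (e := Rmin ((1 - rho) / 2) (q / (8 * B))).
    assert (He0 : 0 < e) by (apply Rmin_glb_lt; [lra|apply Rdiv_lt_0_compat; lra]).
    assert (He1 : e <= (1 - rho) / 2) by apply Rmin_l.
    assert (He2 : e * (8 * B) <= q).
    { apply Rle_trans with (q / (8 * B) * (8 * B)); [apply Rmult_le_compat_r; [lra|apply Rmin_r]|].
      right; field; lra. }
    set (r := 1 - e) in *; assert (Hr : 0 < r < 1) by (unfold r; lra).
    pose proof (cauchy_l2 1 r (k a) _ c (hol1_lin 1 _ _ _ _ (Hf a Ha)) ltac:(lra) ltac:(lra)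
      ltac:(unfold r; fold rho; lra)) as L1.
    fold q rho in L1.
    pose proof (schwarz_l2 r Hr) as L2.
    pose proof (sumR_term m (fun a => RInt (fun x => Cnorm2 (k a (circ r x))) 0 (2 * PI)) a
      (fun i Hi => k_int_pos r i Hr Hi) Ha) as L3; cbv beta in L3.
    pose proof (k_int_pos r a Hr Ha) as L4.
    set (J := RInt (fun x => Cnorm2 (k a (circ r x))) 0 (2 * PI)) in *.
    assert (LJ : J <= 2 * PI * (4 * e)).
    { eapply Rle_trans; [exact L3|]; eapply Rle_trans; [exact L2|].
      apply Rmult_le_compat_l; [lra|]; unfold r; nra. }
    assert (LK : (r / (r - rho)) ^ 2 <= B).
    { apply pow_incr; split; [apply Rlt_le, Rdiv_lt_0_compat; unfold r in *; lra|].
      unfold Rdiv; replace (2 * / (1 - rho)) with (1 * (2 * / (1 - rho))) by ring.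
      apply Rmult_le_compat; [lra|apply Rlt_le, Rinv_0_lt_compat; unfold r; lra|lra|].
      apply Rle_trans with (/ ((1 - rho) / 2)).
      - apply Rinv_le_contravar; unfold r; lra.
      - right; field; lra. } 
    assert (2 * PI * q <= B * (2 * PI * (4 * e))).
    { eapply Rle_trans; [exact L1|]; apply Rmult_le_compat; auto; apply pow2_ge_0. }
    assert (q <= B * (4 * e)) by (apply Rmult_le_reg_l with (2 * PI); lra).
    lra. }
  replace (f a c) with (Cadd (k a c) (Cmul c (w a))) by (unfold k; ring).
  rewrite K; ring.
Qed.
End Schwarz.

(** * Reflections with real normal *)

Lemma normsq_zero_inv m u : normsq m u <= 0 -> forall j, (j < m)%nat -> u j = C0.
Proof.
  intros H j Hj; apply Cnorm2_eq0.
  apply (sumR_eq0 m (fun j => Cnorm2 (u j))); auto; intros; apply Cnorm2_pos.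
Qed.

Lemma normsq_gt0 m u j : (j < m)%nat -> u j <> C0 -> 0 < normsq m u.
Proof.
  intros Hj H; pose proof (coord_le_normsq m u j Hj); pose proof (Cnorm2_neq0 _ H); lra.
Qed.

Lemma exists_neq0 m (f : nat -> C) : sumC m f <> C0 -> exists j, (j < m)%nat /\ f j <> C0.
Proof.
  intros H; apply NNPP; intros N; apply H.
  rewrite (sumC_ext _ _ (fun _ => C0)); [apply sumC_0|].
  intros j Hj; apply NNPP; intros h; apply N; eauto.
Qed.

Definition delta (a j : nat) : C := if Nat.eqb a j then C1 else C0.

(* Each column of [I - 2 u l^T] has norm at most 1; summing over the columns forces
   equality in the Cauchy-Schwarz inequality for [l] and [conj u]. *)
Lemma contraction_reflection m (u l : nat -> C) :
  sumC m (fun a => Cmul (l a) (u a)) = C1 ->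
  (forall j, (j < m)%nat ->
     sumR m (fun a => Cnorm2 (Csub (delta a j) (Cmul (RtoC 2) (Cmul (l j) (u a))))) <= 1) ->
  0 < normsq m u /\ forall j, (j < m)%nat -> Cmul (RtoC (normsq m u)) (l j) = Cconj (u j).
Proof.
  intros H1 H2; set (s := normsq m u).
  assert (Hs : 0 < s).
  { destruct (exists_neq0 m (fun a => Cmul (l a) (u a))) as [j [Hj Hn]].
    - rewrite H1; intros E; injection E; lra.
    - apply (normsq_gt0 m u j Hj); intros E; apply Hn; rewrite E; ring. }
  split; auto.
  (* The squared norm of column [j] is [1 - 4 Re (l_j u_j) + 4 s |l_j|^2]. *)
  assert (A : forall j, (j < m)%nat -> s * Cnorm2 (l j) <= fst (Cmul (l j) (u j))).
  { intros j Hj; specialize (H2 j Hj).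
    rewrite (sumR_ext _ _ (fun a => (if Nat.eqb a j then 1 - 4 * fst (Cmul (l j) (u j)) else 0) +
       4 * Cnorm2 (l j) * Cnorm2 (u a))) in H2.
    - rewrite sumR_plus, sumR_scal, sumR_pick in H2 by auto.
      change (sumR m (fun j => Cnorm2 (u j))) with s in H2; lra.
    - intros a _; unfold delta; destruct (Nat.eqb_spec a j) as [->|]; cunf; ring. }
  (* The sum expands to [s + s^2 |l|^2 - 2 s], and adding up [A] over all columns gives
     [s |l|^2 <= 1]. *)
  assert (B : sumR m (fun j => Cnorm2 (Csub (Cconj (u j)) (Cmul (RtoC s) (l j)))) <= 0).
  { rewrite (sumR_ext _ _ (fun j => Cnorm2 (u j) + (s * (s * Cnorm2 (l j)) +
      - (2 * s) * fst (Cmul (l j) (u j))))).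
    - rewrite !sumR_plus, !sumR_scal, <- fst_sumC, H1.
      change (sumR m (fun j => Cnorm2 (u j))) with s; simpl fst.
      assert (C : sumR m (fun j => s * Cnorm2 (l j)) <= 1).
      { eapply Rle_trans; [apply sumR_le; exact A|].
        rewrite <- fst_sumC, H1; simpl; lra. }
      rewrite sumR_scal in C; nra.
    - intros j _; unfold Cconj; cunf; ring. }
  intros j Hj.
  assert (E : Csub (Cconj (u j)) (Cmul (RtoC s) (l j)) = C0)
    by (apply (normsq_zero_inv m (fun j => Csub (Cconj (u j)) (Cmul (RtoC s) (l j)))); auto).
  transitivity (Csub (Cconj (u j)) (Csub (Cconj (u j)) (Cmul (RtoC s) (l j)))); [ring|].
  rewrite E; ring.
Qed.

Definition cinner m (x : nat -> R) (u : nat -> C) : C :=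
  sumC m (fun j => Cmul (RtoC (x j)) (Cconj (u j))).

(** The unitary reflection in the hyperplane orthogonal to [u], defined on real vectors only, since
    these are the directions of the extremal discs. *)
Definition refl m (u : nat -> C) (x : nat -> R) : nat -> C :=
  fun a => Csub (RtoC (x a)) (Cmul (RtoC (2 / normsq m u)) (Cmul (cinner m x u) (u a))).

Lemma Cconj_cinner m x u : Cconj (cinner m x u) = sumC m (fun j => Cmul (RtoC (x j)) (u j)).
Proof.
  unfold cinner; induction m as [|m IH]; simpl; [apply Ceq; simpl; ring|].
  rewrite <- IH; apply Ceq; simpl; ring.
Qed.

Lemma sumC_RtoC m f : sumC m (fun j => RtoC (f j)) = RtoC (sumR m f).
Proof. induction m; simpl; [reflexivity|]; rewrite IHm; apply Ceq; simpl; ring. Qed.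

Lemma refl_sq m u x : 0 < normsq m u ->
  sumC m (fun a => Csq (refl m u x a)) =
  Cadd (RtoC (sumR m (fun j => x j * x j) - 4 / normsq m u * Cnorm2 (cinner m x u)))
    (Cmul (RtoC (4 / (normsq m u * normsq m u)))
      (Cmul (Csq (cinner m x u)) (sumC m (fun j => Csq (u j))))).
Proof.
  intros Hs; set (s := normsq m u) in *; set (c := cinner m x u).
  rewrite (sumC_ext _ _ (fun a => Cadd (RtoC (x a * x a)) (Cadd
     (Cmul (Cmul (RtoC (- (4 / s))) c) (Cmul (RtoC (x a)) (u a)))
     (Cmul (Cmul (RtoC (4 / (s * s))) (Csq c)) (Csq (u a)))))).
  - rewrite !sumC_plus, !sumC_scal, sumC_RtoC, <- Cconj_cinner; fold c.
    unfold Cconj; apply Ceq; cunf; ring.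
  - intros a _; unfold refl; fold s c; apply Ceq; cunf; field; lra.
Qed.

Lemma refl_norm m u x : 0 < normsq m u -> normsq m (refl m u x) = sumR m (fun j => x j * x j).
Proof.
  intros Hs; set (s := normsq m u) in *; set (c := cinner m x u).
  unfold normsq at 1; rewrite (sumR_ext _ _ (fun a => x a * x a + (- (4 / s) *
     fst (Cmul c (Cmul (RtoC (x a)) (u a))) + 4 / (s * s) * Cnorm2 c * Cnorm2 (u a)))).
  - rewrite !sumR_plus, !sumR_scal, <- fst_sumC, sumC_scal, <- Cconj_cinner; fold c.
    change (sumR m (fun j => Cnorm2 (u j))) with s.
    unfold Cconj; cunf; field; lra.
  - intros a _; unfold refl; fold s c; cunf; field; lra.
Qed.

Lemma sumR_lt m f g : (0 < m)%nat -> (forall j, (j < m)%nat -> f j < g j) -> sumR m f < sumR m g.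
Proof.
  intros Hm H; destruct m as [|m]; [lia|]; simpl.
  assert (sumR m f <= sumR m g) by (apply sumR_le; intros; left; apply H; lia).
  pose proof (H m ltac:(lia)); lra.
Qed.

(* The unit vectors are not enough when [u] has fewer than four nonzero entries; then a large
   multiple of a basis vector orthogonal to [u] is added. *)
Lemma isotropy_defect m (u : nat -> C) : (4 <= m)%nat -> 0 < normsq m u ->
  (forall x : nat -> R, (sumR m (fun j => x j * x j)) ^ 2 <= Cnorm2 (sumC m (fun a => Csq (refl m u x a)))) ->
  (normsq m u) ^ 2 <= Cnorm2 (sumC m (fun j => Csq (u j))).
Proof.
  intros Hm Hs H; set (s := normsq m u) in *; set (b := sumC m (fun j => Csq (u j))) in *.
  destruct (Rle_lt_dec (s ^ 2) (Cnorm2 b)) as [h|h]; auto; exfalso.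
  (* By [refl_sq] the hypothesis reads [X <= |X - k (s p - g)|] with [|g| < s p]; expanding the
     square forces [X < k s p]. So every [x] not orthogonal to [u] would be nearly parallel to it,
     which the vectors tested below are not. *)
  assert (K : forall x, cinner m x u <> C0 -> s * sumR m (fun j => x j * x j) < 4 * Cnorm2 (cinner m x u)).
  { intros x Hx; specialize (H x); rewrite refl_sq in H by auto; fold s b in H.
    set (c := cinner m x u) in *; set (X := sumR m (fun j => x j * x j)) in *.
    pose proof (Cnorm2_neq0 _ Hx) as Hp; set (p := Cnorm2 c) in *.
    set (g := Cmul (Csq c) b) in *.
    assert (G : Cnorm2 g < p * p * s ^ 2).
    { unfold g, Csq; rewrite !Cnorm2_mul; fold p; apply Rmult_lt_compat_l; [nra|exact h]. }
    set (k := 4 / (s * s)) in *.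
    assert (Hk : 0 < k) by (apply Rdiv_lt_0_compat; nra).
    assert (E : Cnorm2 (Cadd (RtoC (X - 4 / s * p)) (Cmul (RtoC k) g)) =
      X ^ 2 + 2 * X * k * (fst g - s * p) + k * k * (Cnorm2 g - 2 * s * p * fst g + s * s * (p * p))).
    { replace (4 / s * p) with (k * (s * p)) by (unfold k; field; lra).
      clearbody k g p; cunf; ring. }
    rewrite E in H.
    assert (Hsp : 0 < s * p) by now apply Rmult_lt_0_compat.
    assert (F : fst g < s * p).
    { destruct (Rlt_le_dec (fst g) (s * p)) as [e|e]; auto; exfalso.
      assert (s * p * (s * p) <= fst g * fst g) by (apply Rmult_le_compat; lra).
      unfold Cnorm2 in G; nra. }
    assert (X * (s * p - fst g) <= k * (s * p) * (s * p - fst g)).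
    { apply Rmult_le_reg_l with (2 * k); [lra|].
      assert (k * k * (Cnorm2 g - 2 * s * p * fst g + s * s * (p * p)) <=
        k * k * (2 * (s * p) * (s * p - fst g))) by (apply Rmult_le_compat_l; nra).
      nra. }
    assert (X < k * (s * p)).
    { destruct (Rle_lt_dec (k * (s * p)) X) as [e|e]; auto; exfalso.
      assert (X = k * (s * p)) as EX by nra.
      assert (k * k * (Cnorm2 g - 2 * s * p * fst g + s * s * (p * p)) <
        k * k * (2 * (s * p) * (s * p - fst g))) by (apply Rmult_lt_compat_l; nra).
      nra. }
    replace (4 * p) with (s * (k * (s * p))) by (unfold k; field; lra).
    now apply Rmult_lt_compat_l. }
  assert (CI : forall j T l, (j < m)%nat -> (l < m)%nat -> u l = C0 \/ T = 0 -> j <> l ->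
    cinner m (fun i => (if Nat.eqb i j then 1 else 0) + (if Nat.eqb i l then T else 0)) u = Cconj (u j) /\
    sumR m (fun i => ((if Nat.eqb i j then 1 else 0) + (if Nat.eqb i l then T else 0)) *
      ((if Nat.eqb i j then 1 else 0) + (if Nat.eqb i l then T else 0))) = 1 + T * T).
  { intros j T l Hj Hl HT Hjl; split.
    - unfold cinner; rewrite <- (sumC_pick m j (fun i => Cconj (u i)) Hj).
      apply sumC_ext; intros i _.
      destruct (Nat.eqb_spec i j), (Nat.eqb_spec i l); try lia.
      + apply Ceq; simpl; ring.
      + subst i; destruct HT as [E|E]; rewrite E; apply Ceq; simpl; ring.
      + apply Ceq; simpl; ring.
    - rewrite (sumR_ext _ _ (fun i => (if Nat.eqb i j then 1 else 0) + (if Nat.eqb i l then T * T else 0))).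
      + rewrite sumR_plus, !sumR_pick by auto; ring.
      + intros i _; destruct (Nat.eqb_spec i j), (Nat.eqb_spec i l); try lia; ring. }
  assert (NC : forall j, Cnorm2 (Cconj (u j)) = Cnorm2 (u j)) by (intros; unfold Cconj; cunf; ring).
  assert (ND : forall j, u j <> C0 -> Cconj (u j) <> C0).
  { intros j Hj E; pose proof (Cnorm2_neq0 _ Hj) as h1; rewrite <- NC, E in h1; revert h1; cunf; lra. }
  destruct (classic (exists l, (l < m)%nat /\ u l = C0)) as [[l [Hl El]]|N].
  - assert (exists j, (j < m)%nat /\ u j <> C0) as [j [Hj Ej]].
    { apply NNPP; intros N; assert (s = 0); [|lra].
      unfold s, normsq; rewrite (sumR_ext _ _ (fun _ => 0)); [rewrite sumR_const; ring|].
      intros i Hi; assert (u i = C0) as -> by (apply NNPP; intros h'; apply N; eauto); cunf; ring. }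
    (* The vector [e_j + T e_l] with [u l = 0] turns [K] into [1 + T^2 < T], which no real [T]
       satisfies. *)
    set (T := 4 * Cnorm2 (u j) / s).
    destruct (CI j T l Hj Hl (or_introl El) ltac:(congruence)) as [c1 c2].
    pose proof (K _ ltac:(rewrite c1; now apply ND)) as L; rewrite c1, c2, NC in L.
    assert (s * T = 4 * Cnorm2 (u j)) by (unfold T; field; lra).
    assert (s * (1 + T * T) < s * T) by lra.
    assert (1 + T * T < T) by (apply Rmult_lt_reg_l with s; auto); nra.
  (* If no entry vanishes, the unit vectors suffice: summing gives [m s < 4 s], impossible for
     [m >= 4]. *)
  - assert (A : forall j, (j < m)%nat -> s < 4 * Cnorm2 (u j)).
    { intros j Hj.
      assert (exists l, (l < m)%nat /\ j <> l) as [l [Hl Hjl]].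
      { destruct j; [exists 1%nat|exists 0%nat]; lia. }
      destruct (CI j 0 l Hj Hl (or_intror eq_refl) Hjl) as [c1 c2].
      assert (Ej : u j <> C0) by (intros E; apply N; eauto).
      pose proof (K _ ltac:(rewrite c1; now apply ND)) as L; rewrite c1, c2, NC in L; lra. }
    pose proof (sumR_lt m (fun _ => s) (fun j => 4 * Cnorm2 (u j)) ltac:(lia) A) as L.
    rewrite sumR_const, sumR_scal in L; change (sumR m (fun j => Cnorm2 (u j))) with s in L.
    assert (4 <= INR m) by (apply le_INR in Hm; simpl in Hm; lra).
    nra.
Qed.

(** The equality case of [|sum u_j^2| <= |u|^2]. With [g] the sum and [q = |g|], the squared
    distance between [q u] and [g conj u] is [2 q^2 (s - q) <= 0]. Hence all entries of [u] have the
    same phase up to sign. *)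
Lemma real_multiple m (u : nat -> C) : 0 < normsq m u ->
  (normsq m u) ^ 2 <= Cnorm2 (sumC m (fun j => Csq (u j))) ->
  exists j0, (j0 < m)%nat /\ u j0 <> C0 /\
    forall j, (j < m)%nat -> snd (Cmul (u j0) (Cconj (u j))) = 0.
Proof.
  intros Hs H; set (s := normsq m u) in *; set (g := sumC m (fun j => Csq (u j))) in *.
  set (q := Cabs g).
  assert (Hq : s <= q).
  { pose proof (Cabs_sq g) as E; fold q in E; pose proof (Cabs_pos g) as P; fold q in P; nra. }
  assert (B : sumR m (fun j => Cnorm2 (Csub (Cmul (RtoC q) (u j)) (Cmul g (Cconj (u j))))) <= 0).
  { rewrite (sumR_ext _ _ (fun j => (q * q + Cnorm2 g) * Cnorm2 (u j) +
      - (2 * q) * fst (Cmul (Cconj g) (Csq (u j))))).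
    - rewrite sumR_plus, !sumR_scal, <- fst_sumC, sumC_scal; fold g.
      change (sumR m (fun j => Cnorm2 (u j))) with s.
      replace (fst (Cmul (Cconj g) g)) with (q * q)
        by (unfold q; rewrite Cabs_sq; unfold Cconj; cunf; ring).
      unfold q at 2; rewrite <- Cabs_sq; fold q; nra.
    - intros j _; unfold Cconj; cunf; ring. }
  assert (E : forall j, (j < m)%nat -> Cmul (RtoC q) (u j) = Cmul g (Cconj (u j))).
  { intros j Hj.
    assert (E : Csub (Cmul (RtoC q) (u j)) (Cmul g (Cconj (u j))) = C0)
      by (apply (normsq_zero_inv m (fun j => Csub (Cmul (RtoC q) (u j)) (Cmul g (Cconj (u j))))); auto).
    transitivity (Cadd (Csub (Cmul (RtoC q) (u j)) (Cmul g (Cconj (u j)))) (Cmul g (Cconj (u j)))); [ring|].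
    rewrite E; ring. }
  assert (exists j0, (j0 < m)%nat /\ u j0 <> C0) as [j0 [Hj0 Ej0]].
  { apply NNPP; intros N; assert (s = 0); [|lra].
    unfold s, normsq; rewrite (sumR_ext _ _ (fun _ => 0)); [rewrite sumR_const; ring|].
    intros i Hi; assert (u i = C0) as -> by (apply NNPP; intros h'; apply N; eauto); cunf; ring. }
  exists j0; repeat split; auto; intros j Hj.
  assert (X : Cmul (RtoC q) (Cmul (u j0) (Cconj (u j))) = Cmul (RtoC q) (Cmul (Cconj (u j0)) (u j))).
  { transitivity (Cmul (Cmul (RtoC q) (u j0)) (Cconj (u j))); [ring|]; rewrite E by auto.
    transitivity (Cmul (Cconj (u j0)) (Cmul (RtoC q) (u j))); [rewrite E by auto|]; ring. }
  assert (Y : snd (Cmul (RtoC q) (Cmul (u j0) (Cconj (u j)))) =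
    snd (Cmul (RtoC q) (Cmul (Cconj (u j0)) (u j)))) by now rewrite X.
  unfold Cconj in *; revert Y; cunf; intros Y; nra.
Qed.

(** * Involutions of the type IV domain *)

Lemma isHol_sumC n U m (F : nat -> Vec -> C) : (forall j, (j < m)%nat -> isHol n U (F j)) ->
  isHol n U (fun z => sumC m (fun j => F j z)).
Proof.
  induction m as [|m IH]; intros H; simpl; [apply isHol_const|].
  apply isHol_add; [apply IH; intros; apply H; lia|apply H; lia].
Qed.

Lemma normsq_scal m c v : normsq m (fun k => Cmul c (v k)) = Cnorm2 c * normsq m v.
Proof. unfold normsq; rewrite <- sumR_scal; apply sumR_ext; intros; apply Cnorm2_mul. Qed.

Lemma sumCsq_scal m c (v : Vec) :
  sumC m (fun k => Csq (Cmul c (v k))) = Cmul (Csq c) (sumC m (fun k => Csq (v k))).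
Proof. rewrite <- sumC_scal; apply sumC_ext; intros; unfold Csq; ring. Qed.

Lemma inDIV_of_lt1 m z : tail0 m z -> normsq m z < 1 -> inDIV m z.
Proof.
  intros T H; unfold inDIV, hIV; pose proof (Cnorm2_pos (sumC m (fun j => Csq (z j)))).
  repeat split; auto; lra.
Qed.

Definition rvec (x : nat -> R) : Vec := fun k => RtoC (x k).

Lemma normsq_rvec m x : normsq m (rvec x) = sumR m (fun j => x j * x j).
Proof. apply sumR_ext; intros; unfold rvec; cunf; ring. Qed.

Lemma sumCsq_rvec m x : sumC m (fun j => Csq (rvec x j)) = RtoC (sumR m (fun j => x j * x j)).
Proof.
  rewrite <- sumC_RtoC; apply sumC_ext; intros; unfold rvec; apply Ceq; cunf; ring.
Qed.

(** On such a disc the defining polynomial equals [(1 - |c|^2)^2], so the disc lies in the domain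
    and reaches the sphere of radius sqrt 2 at its rim. *)
Lemma inDIV_real_disc m x c : (forall k, (m <= k)%nat -> x k = 0) ->
  sumR m (fun j => x j * x j) = 2 -> Cabs c < 1 -> inDIV m (fun k => Cmul c (rvec x k)).
Proof.
  intros T X H; apply Cabs_lt_sq in H; [|lra]; pose proof (Cnorm2_pos c) as P.
  unfold inDIV, hIV; rewrite normsq_scal, sumCsq_scal, normsq_rvec, sumCsq_rvec, X.
  rewrite Cnorm2_mul; replace (Cnorm2 (Csq c)) with (Cnorm2 c * Cnorm2 c)
    by (unfold Csq; now rewrite Cnorm2_mul).
  replace (Cnorm2 (RtoC 2)) with 4 by (cunf; ring).
  repeat split; [lra|nra|].
  intros k Hk; unfold rvec; rewrite T by auto; apply Ceq; cunf; ring.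
Qed.

Definition flip (m : nat) (z : Vec) : Vec := fun k => if Nat.eqb k (m - 1) then Copp (z k) else z k.

Lemma flip_inDIV m z : inDIV m z -> inDIV m (flip m z).
Proof.
  intros [H1 [H2 H3]]; unfold inDIV, hIV.
  replace (normsq m (flip m z)) with (normsq m z).
  2:{ apply sumR_ext; intros; unfold flip; destruct (Nat.eqb _ _); auto; cunf; ring. }
  replace (sumC m (fun j => Csq (flip m z j))) with (sumC m (fun j => Csq (z j))).
  2:{ apply sumC_ext; intros; unfold flip; destruct (Nat.eqb _ _); auto; unfold Csq; ring. }
  repeat split; auto.
  intros k Hk; unfold flip; rewrite H3 by auto; destruct (Nat.eqb _ _); auto; ring.
Qed.

Lemma flip_fix m z : z (m - 1)%nat = C0 -> flip m z = z.
Proof.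
  intros H; apply functional_extensionality; intros k; unfold flip.
  destruct (Nat.eqb_spec k (m - 1)) as [->|]; auto; rewrite H; ring.
Qed.

Lemma inDIV_zero m : inDIV m vzero.
Proof.
  apply inDIV_of_lt1; [intros k _; reflexivity|].
  unfold normsq; rewrite (sumR_ext _ _ (fun _ => 0)); [rewrite sumR_const; lra|].
  intros; unfold vzero; cunf; ring.
Qed.

Section Reflection.
Variables (m : nat) (phi chi : Vec -> Vec).
Hypotheses (Hm : (4 <= m)%nat)
  (Hphi : holo_map m m (inDIV m) (inDIV m) phi)
  (Hchi : holo_map m m (inDIV m) (inDIV m) chi)
  (PC : forall w, inDIV m w -> phi (chi w) = w)
  (CP : forall w, inDIV m w -> chi (phi w) = w)
  (H0 : chi vzero (m - 1)%nat = C0).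
Let U := inDIV m.
Let p := chi vzero.
Let tau z := phi (flip m (chi z)).

Lemma p_in : U p. Proof. apply Hchi, inDIV_zero. Qed.
Lemma flip_p : flip m p = p. Proof. now apply flip_fix. Qed.
Lemma phi_p : phi p = vzero. Proof. apply PC, inDIV_zero. Qed.
Lemma tau_zero : tau vzero = vzero. Proof. unfold tau; fold p; rewrite flip_p; apply phi_p. Qed.
Lemma tau_in z : U z -> U (tau z).
Proof. intros Hz; apply Hphi, flip_inDIV, Hchi, Hz. Qed.

Lemma tau_hol a : (a < m)%nat -> isHol m U (fun z => tau z a).
Proof.
  intros Ha; unfold tau.
  apply (isHol_comp m m U U (fun z => flip m (chi z)) (fun z => phi z a)).
  - intros w Hw; apply flip_inDIV, Hchi, Hw.
  - intros b Hb; unfold flip; destruct (Nat.eqb b (m - 1)); [apply isHol_opp|];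
      apply (holomorphic_on_isHol m m U chi (open_DIV m)); auto; apply Hchi.
  - apply (holomorphic_on_isHol m m U phi (open_DIV m)); auto; apply Hphi.
Qed.

(* [u] is the last column of the differential of [phi] at [p], and [l] the last row of that of
   [chi] at 0. *)
Lemma tau_deriv : exists u l : nat -> C,
  sumC m (fun a => Cmul (l a) (u a)) = C1 /\
  forall (x : nat -> R) a, (a < m)%nat -> (forall k, (m <= k)%nat -> x k = 0) ->
    cderiv (fun s => tau (fun k => Cmul (RtoC s) (rvec x k)) a) 0
      (Csub (RtoC (x a)) (Cmul (RtoC 2) (Cmul (sumC m (fun j => Cmul (l j) (RtoC (x j)))) (u a)))).
Proof.
  destruct (choice_lt m (fun a P => Hol m U (fun w => phi w a) P) (fun _ _ => C0)) as [P HP].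
  { intros a Ha; apply (holomorphic_on_isHol m m U phi (open_DIV m)); auto; apply Hphi. }
  destruct (choice_lt m (fun a P => Hol m U (fun w => chi w a) P) (fun _ _ => C0)) as [Q HQ].
  { intros a Ha; apply (holomorphic_on_isHol m m U chi (open_DIV m)); auto; apply Hchi. }
  exists (fun a => P a (m - 1)%nat p), (fun j => Q (m - 1)%nat j vzero).
  assert (M1 : (m - 1 < m)%nat) by lia.
  split.
  (* Differentiating [chi o phi = id] at [p] in the last coordinate direction, and reading off the
     last component, gives [l u = 1]. *)
  - set (g := fun s => shift p (m - 1) true s).
    assert (Lg : locally 0 (fun s => U (g s))) by (apply shift_in with m; [apply open_DIV|apply p_in|auto]).
    assert (Dg : forall a, (a < m)%nat -> cderiv (fun s => phi (g s) a) 0 (P a (m - 1)%nat p)).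
    { intros a Ha; destruct (HP a Ha) as [h _]; eapply cderiv_eq.
      - apply (h g (fun k => if Nat.eqb k (m - 1) then cdir true else C0)); auto.
        intros k Hk; apply shift_cderiv.
      - unfold g; rewrite shift_0.
        rewrite <- (sumC_pick m (m - 1) (fun j => P a j p) M1); apply sumC_ext; intros k _.
        destruct (Nat.eqb k (m - 1)); unfold cdir; ring. }
    destruct (HQ (m - 1)%nat M1) as [h _].
    pose proof (h (fun s => phi (g s)) (fun a => P a (m - 1)%nat p) 0) as D.
    assert (Lp : locally 0 (fun s => U (phi (g s)))).
    { revert Lg; apply filter_imp; intros s Hs; now apply Hphi. }
    specialize (D Lp Dg); cbv beta in D.
    assert (E0 : phi (g 0) = vzero) by (unfold g; rewrite shift_0; apply phi_p).
    rewrite E0 in D.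
    assert (D2 : cderiv (fun s => chi (phi (g s)) (m - 1)%nat) 0 C1).
    { apply cderiv_ext_loc with (fun s => g s (m - 1)%nat).
      - revert Lg; apply filter_imp; intros s Hs; now rewrite CP.
      - eapply cderiv_eq; [apply shift_cderiv|]; rewrite Nat.eqb_refl; reflexivity. }
    exact (cderiv_unique _ _ _ _ D D2).
  - intros x a Ha Hx; set (l := sumC m (fun j => Cmul (Q (m - 1)%nat j vzero) (RtoC (x j)))).
    set (g := fun s => (fun k => Cmul (RtoC s) (rvec x k)) : Vec).
    assert (Dg : forall k, cderiv (fun s => g s k) 0 (RtoC (x k))).
    { intros k; unfold g; eapply cderiv_eq; [apply cderiv_mul; [apply cderiv_RtoC|apply cderiv_const]|].
      cbv beta; unfold rvec; ring. }
    assert (g0 : g 0 = vzero).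
    { apply functional_extensionality; intros k; unfold g, vzero; apply Ceq; cunf; ring. }
    assert (Lg : locally 0 (fun s => U (g s))).
    { apply curve_in with m.
      - apply open_DIV.
      - rewrite g0; apply inDIV_zero.
      - apply filter_forall; intros s k Hk; unfold g, rvec; rewrite Hx by auto; apply Ceq; cunf; ring.
      - intros k _; exact (cderiv_continuous _ _ _ (Dg k)). }
    (* [v] is the image of [x] under the differential of [chi]. The differential of [phi] takes it
       back to [x], and the flip changes [v] by [-2 v_(m-1)] in the last entry, which contributes
       [-2 l(x) u]. *)
    set (v := fun b => sumC m (fun j => Cmul (Q b j vzero) (RtoC (x j)))).
    assert (Dc : forall b, (b < m)%nat -> cderiv (fun s => chi (g s) b) 0 (v b)).
    { intros b Hb; destruct (HQ b Hb) as [h _]; eapply cderiv_eq.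
      - apply (h g (fun k => RtoC (x k))); auto.
      - now rewrite g0. }
    assert (Lc : locally 0 (fun s => U (chi (g s)))).
    { revert Lg; apply filter_imp; intros s Hs; now apply Hchi. }
    destruct (HP a Ha) as [h _].
    pose proof (h (fun s => chi (g s)) v 0 Lc Dc) as D1; cbv beta in D1; rewrite g0 in D1; fold p in D1.
    assert (D1' : cderiv (fun s => phi (chi (g s)) a) 0 (RtoC (x a))).
    { apply cderiv_ext_loc with (fun s => g s a); auto.
      revert Lg; apply filter_imp; intros s Hs; now rewrite PC. }
    pose proof (cderiv_unique _ _ _ _ D1 D1') as E1.
    assert (Lf : locally 0 (fun s => U (flip m (chi (g s))))).
    { revert Lc; apply filter_imp; intros s Hs; now apply flip_inDIV. }
    pose proof (h (fun s => flip m (chi (g s))) (fun b => if Nat.eqb b (m - 1) then Copp (v b) else v b) 0 Lf)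
      as D2.
    eapply cderiv_eq; [apply D2|].
    + intros b Hb; unfold flip; destruct (Nat.eqb b (m - 1)); [apply cderiv_opp|]; auto.
    + rewrite g0; fold p; rewrite flip_p, <- E1; fold (v (m - 1)%nat) in l; unfold l.
      rewrite (sumC_ext _ _ (fun b => Cadd (Cmul (P a b p) (v b))
        (Cmul (Copp (RtoC 2)) (if Nat.eqb b (m - 1) then Cmul (v b) (P a b p) else C0)))).
      * rewrite sumC_plus, sumC_scal, (sumC_pick m (m - 1) (fun b => Cmul (v b) (P a b p)) M1).
        fold (v (m - 1)%nat); ring.
      * intros b _; destruct (Nat.eqb b (m - 1)); apply Ceq; cunf; ring.
Qed.

(** Here [u] is the derivative of [tau] in the direction [x], not the normal of the reflection. If
    that derivative keeps the full length sqrt 2, equality in the Schwarz lemma makes [tau] linear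
    along the whole disc. *)
Lemma tau_disc (u l : nat -> C) (x : nat -> R) :
  (forall k, (m <= k)%nat -> x k = 0) -> sumR m (fun j => x j * x j) = 2 ->
  (forall a, (a < m)%nat -> cderiv (fun s => tau (fun k => Cmul (RtoC s) (rvec x k)) a) 0 (u a)) ->
  normsq m u <= 2 /\
  (2 <= normsq m u -> forall a c, (a < m)%nat -> Cabs c < 1 ->
     tau (fun k => Cmul c (rvec x k)) a = Cmul c (u a)).
Proof.
  intros Hx X D.
  set (f := fun a c => tau (aff vzero (rvec x) c) a).
  assert (AE : forall c, aff vzero (rvec x) c = fun k => Cmul c (rvec x k)).
  { intros c; apply functional_extensionality; intros k; unfold aff, vzero; ring. }
  assert (HU : forall c, Cabs c < 1 -> U (aff vzero (rvec x) c)).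
  { intros c Hc; rewrite AE; now apply inDIV_real_disc. }
  destruct (choice_lt m (fun a P => Hol m U (fun w => tau w a) P) (fun _ _ => C0)
    (fun a Ha => tau_hol a Ha)) as [Q HQ].
  set (f' := fun a c => sumC m (fun j => Cmul (Q a j (aff vzero (rvec x) c)) (rvec x j))).
  assert (Hf : forall a, (a < m)%nat -> hol1 1 (f a) (f' a)).
  { intros a Ha; exact (hol1_affine m U _ (Q a) vzero (rvec x) 1 (HQ a Ha) HU). }
  assert (A0 : aff vzero (rvec x) C0 = vzero).
  { apply functional_extensionality; intros k; unfold aff, vzero; ring. }
  assert (F0 : forall a, (a < m)%nat -> f a C0 = C0).
  { intros a _; unfold f; rewrite A0, tau_zero; reflexivity. }
  assert (FB : forall c, Cabs c < 1 -> sumR m (fun a => Cnorm2 (f a c)) <= 2).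
  { intros c Hc; left; exact (proj1 (tau_in _ (HU c Hc))). }
  assert (W : forall a, (a < m)%nat -> f' a C0 = u a).
  { intros a Ha; destruct (Hf a Ha) as [h _].
    pose proof (h RtoC C1 0 (cderiv_RtoC 0) ltac:(change (RtoC 0) with C0; rewrite Cabs_0; lra)) as D2.
    apply (cderiv_unique (fun s => f a (RtoC s)) 0).
    - eapply cderiv_eq; [exact D2|]; change (RtoC 0) with C0; ring.
    - apply cderiv_ext_loc with (2 := D a Ha); apply filter_forall; intros s; unfold f; now rewrite AE. }
  assert (WN : sumR m (fun a => Cnorm2 (f' a C0)) = normsq m u).
  { apply sumR_ext; intros a Ha; now rewrite W. }
  rewrite <- WN; split.
  - exact (schwarz_deriv m f f' Hf F0 FB).
  - intros H2 a c Ha Hc; rewrite <- AE, <- W by auto.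
    exact (schwarz_rigid m f f' Hf F0 FB H2 a c Ha Hc).
Qed.

Lemma sumR_restrict (x : nat -> R) :
  exists y, (forall k, (m <= k)%nat -> y k = 0) /\ forall k, (k < m)%nat -> y k = x k.
Proof.
  exists (fun k => if Nat.ltb k m then x k else 0); split; intros k Hk.
  - destruct (Nat.ltb_spec k m); auto; lia.
  - destruct (Nat.ltb_spec k m); auto; lia.
Qed.

(** A fixed point [Z] of [tau] where [tau] is the reflection satisfies [l(Z) = 0], and [l] is
    proportional to the real vector [a]. The radius comes from the auxiliary disc [Z + c conj Z],
    [|c| < 2]: its points have norm at most [3 |Z| < 1] and so stay in the domain. *)
Lemma reflection_relation : exists (a : nat -> R), (exists j, (j < m)%nat /\ a j <> 0) /\
  forall Z, tail0 m Z -> normsq m Z < / 9 -> chi Z (m - 1)%nat = C0 ->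
    sumC m (fun j => Cmul (RtoC (a j)) (Z j)) = C0.
Proof.
  destruct tau_deriv as [u [l [Hlu D]]].
  set (A := fun (x : nat -> R) a => Csub (RtoC (x a))
    (Cmul (RtoC 2) (Cmul (sumC m (fun j => Cmul (l j) (RtoC (x j)))) (u a)))).
  assert (S2 : sqrt 2 * sqrt 2 = 2) by (apply sqrt_sqrt; lra).
  assert (Col : forall j, (j < m)%nat ->
     sumR m (fun a => Cnorm2 (Csub (delta a j) (Cmul (RtoC 2) (Cmul (l j) (u a))))) <= 1).
  (* The basis vector is scaled to the length of the extremal discs; dividing the Schwarz bound 2 by
     the factor 2 leaves the column bound 1. *)
  { intros j Hj; set (x := fun k => if Nat.eqb k j then sqrt 2 else 0).
    assert (Hx : forall k, (m <= k)%nat -> x k = 0).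
    { intros k Hk; unfold x; destruct (Nat.eqb_spec k j); auto; lia. }
    assert (X : sumR m (fun k => x k * x k) = 2).
    { rewrite (sumR_ext _ _ (fun k => if Nat.eqb k j then 2 else 0)); [now apply sumR_pick|].
      intros k _; unfold x; destruct (Nat.eqb k j); lra. }
    destruct (tau_disc (A x) l x Hx X (fun a Ha => D x a Ha Hx)) as [N _].
    assert (L : sumC m (fun k => Cmul (l k) (RtoC (x k))) = Cmul (RtoC (sqrt 2)) (l j)).
    { rewrite <- (sumC_pick m j (fun k => Cmul (RtoC (sqrt 2)) (l k)) Hj); apply sumC_ext; intros k _.
      unfold x; destruct (Nat.eqb k j); apply Ceq; cunf; ring. }
    unfold normsq in N; rewrite (sumR_ext _ _ (fun a => 2 *
      Cnorm2 (Csub (delta a j) (Cmul (RtoC 2) (Cmul (l j) (u a)))))) in N.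
    - rewrite sumR_scal in N; lra.
    - intros a _; unfold A; rewrite L.
      replace (Csub (RtoC (x a)) (Cmul (RtoC 2) (Cmul (Cmul (RtoC (sqrt 2)) (l j)) (u a))))
        with (Cmul (RtoC (sqrt 2)) (Csub (delta a j) (Cmul (RtoC 2) (Cmul (l j) (u a))))).
      + rewrite Cnorm2_mul; f_equal; unfold Cnorm2; simpl; lra.
      + unfold x, delta; destruct (Nat.eqb a j); apply Ceq; cunf; ring. }
  destruct (contraction_reflection m u l Hlu Col) as [Hs Hl].
  set (s := normsq m u) in *.
  assert (Hl' : forall x, sumC m (fun j => Cmul (l j) (RtoC (x j))) = Cmul (RtoC (/ s)) (cinner m x u)).
  { intros x; unfold cinner; rewrite <- sumC_scal; apply sumC_ext; intros j Hj; rewrite <- Hl by auto.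
    apply Ceq; cunf; field; lra. }
  assert (HA : forall x, A x = refl m u x).
  { intros x; apply functional_extensionality; intros a; unfold A, refl; rewrite Hl'; fold s.
    apply Ceq; cunf; field; lra. }
  assert (Disc : forall x, (forall k, (m <= k)%nat -> x k = 0) -> sumR m (fun j => x j * x j) = 2 ->
    forall a c, (a < m)%nat -> Cabs c < 1 -> tau (fun k => Cmul c (rvec x k)) a = Cmul c (refl m u x a)).
  { intros x Hx X a c Ha Hc; destruct (tau_disc (A x) l x Hx X (fun a Ha => D x a Ha Hx)) as [_ R].
    rewrite <- HA; apply R; auto.
    rewrite HA, refl_norm, X by auto; lra. }
  assert (AL : forall t x, refl m u (fun k => t * x k) = fun a => Cmul (RtoC t) (refl m u x a)).
  { intros t x; apply functional_extensionality; intros a; unfold refl, cinner.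
    rewrite (sumC_ext _ _ (fun j => Cmul (RtoC t) (Cmul (RtoC (x j)) (Cconj (u j))))).
    - rewrite sumC_scal; apply Ceq; cunf; ring.
    - intros j _; apply Ceq; cunf; ring. }
  (* For a real vector of length sqrt 2, the images of [r y] with [r < 1] lie in the domain; letting
     [r] tend to 1 in the defining inequality gives [-1 + |B|^2 / 4 >= 0], where [B] is the sum of
     squares of the reflected vector. General [x] follow by scaling. *)
  assert (Iso : forall x, (sumR m (fun j => x j * x j)) ^ 2 <= Cnorm2 (sumC m (fun a => Csq (refl m u x a)))).
  { intros x0; destruct (sumR_restrict x0) as [x [Hx Ex]].
    replace (sumR m (fun j => x0 j * x0 j)) with (sumR m (fun j => x j * x j))
      by (apply sumR_ext; intros; now rewrite Ex).
    replace (sumC m (fun a => Csq (refl m u x0 a))) with (sumC m (fun a => Csq (refl m u x a))).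
    2:{ apply sumC_ext; intros a Ha; unfold refl; rewrite (Ex a Ha).
        replace (cinner m x u) with (cinner m x0 u); auto.
        apply sumC_ext; intros j Hj; now rewrite Ex. }
    set (X := sumR m (fun j => x j * x j)).
    assert (HX : 0 <= X) by (apply sumR_pos; intros; nra).
    destruct (Rle_lt_or_eq_dec _ _ HX) as [hX|hX].
    2:{ rewrite <- hX; replace (0 ^ 2) with 0 by ring; apply Cnorm2_pos. }
    set (t := sqrt (2 / X)).
    assert (Ht : t * t = 2 / X) by (apply sqrt_sqrt; apply Rlt_le, Rdiv_lt_0_compat; lra).
    set (y := fun k => t * x k).
    assert (Hy : forall k, (m <= k)%nat -> y k = 0) by (intros k Hk; unfold y; rewrite Hx; auto; ring).
    assert (Y : sumR m (fun j => y j * y j) = 2).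
    { rewrite (sumR_ext _ _ (fun j => t * t * (x j * x j))) by (intros; unfold y; ring).
      rewrite sumR_scal; fold X; rewrite Ht; field; lra. }
    set (B := sumC m (fun a => Csq (refl m u x a))).
    assert (EB : sumC m (fun a => Csq (refl m u y a)) = Cmul (RtoC (2 / X)) B).
    { unfold y; rewrite AL; rewrite (sumCsq_scal m (RtoC t) (refl m u x)); fold B; f_equal.
      rewrite <- Ht; apply Ceq; cunf; ring. }
    assert (K : 4 <= Cnorm2 (sumC m (fun a => Csq (refl m u y a)))).
    { set (q := Cnorm2 (sumC m (fun a => Csq (refl m u y a)))).
      assert (Q0 : 0 <= q) by apply Cnorm2_pos.
      destruct (Rle_lt_dec 4 q) as [h|h]; auto; exfalso.
      (* With [q = 4 - 32 e] the defining polynomial at the image point is [(1 - r^2)^2 - 8 e r^4],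
         which is not positive for [0 < e <= 1/8]. *)
      set (e := (4 - q) / 32); set (r := 1 - e).
      assert (Hr : Cabs (RtoC r) < 1) by (rewrite Cabs_real; unfold r, e; apply Rabs_def1; lra).
      pose proof (tau_in _ (inDIV_real_disc m y (RtoC r) Hy Y Hr)) as [_ [I _]].
      assert (E : forall a, (a < m)%nat -> tau (fun k => Cmul (RtoC r) (rvec y k)) a
        = Cmul (RtoC r) (refl m u y a)) by (intros; now apply Disc).
      unfold hIV in I.
      assert (E1 : normsq m (tau (fun k => Cmul (RtoC r) (rvec y k))) = 2 * (r * r)).
      { unfold normsq; rewrite (sumR_ext _ _ (fun a => Cnorm2 (Cmul (RtoC r) (refl m u y a))))
          by (intros; now rewrite E).
        change (normsq m (fun a => Cmul (RtoC r) (refl m u y a)) = 2 * (r * r)).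
        rewrite normsq_scal, refl_norm, Y by auto; cunf; ring. }
      rewrite E1, (sumC_ext _ _ (fun a => Csq (Cmul (RtoC r) (refl m u y a)))) in I
        by (intros; now rewrite E).
      rewrite sumCsq_scal, Cnorm2_mul in I; fold q in I.
      replace (Cnorm2 (Csq (RtoC r))) with (r * r * (r * r)) in I by (cunf; ring).
      assert (1 - 2 * (r * r) + / 4 * (r * r * (r * r) * q) <= 0); [|lra].
      assert (q = 4 - 32 * e) by (unfold e; lra).
      assert (0 < e <= / 8) by (unfold e; lra).
      unfold r in *; clear I Hr E E1; subst q; rewrite H; clear -H1.
      assert (0 <= e * e) by nra; assert (0 <= e * e * e) by nra.
      nra. }
    rewrite EB, Cnorm2_mul in K.
    replace (Cnorm2 (RtoC (2 / X))) with (4 / (X ^ 2)) in K by (cunf; field; lra).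
    apply Rmult_le_reg_l with (4 / X ^ 2); [apply Rdiv_lt_0_compat; [lra|apply pow_lt; lra]|].
    replace (4 / X ^ 2 * X ^ 2) with 4 by (field; lra); exact K. }
  pose proof (isotropy_defect m u Hm Hs Iso) as Def.
  destruct (real_multiple m u Hs Def) as [j0 [Hj0 [Ej0 Hreal]]].
  (* Multiplying [conj u] by the nonzero entry [u j0] makes it real, by [real_multiple], with the
     nonzero entry [|u j0|^2] at [j0]. *)
  set (a := fun j => fst (Cmul (u j0) (Cconj (u j)))).
  assert (Ha : forall j, (j < m)%nat -> RtoC (a j) = Cmul (u j0) (Cconj (u j))).
  { intros j Hj; apply Ceq; [reflexivity|]; now rewrite Hreal. }
  exists a; split.
  { exists j0; split; auto; unfold a, Cconj; pose proof (Cnorm2_neq0 _ Ej0); cunf; lra. }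
  intros Z TZ NZ HZ.
  assert (UZ : U Z) by (apply inDIV_of_lt1; auto; lra).
  assert (tZ : tau Z = Z) by (unfold tau; rewrite flip_fix by auto; now apply PC).
  set (lin := fun (W : Vec) => sumC m (fun j => Cmul (l j) (W j))).
  set (Zb := fun k => Cconj (Z k)).
  (* On [|c| = 1] the curve [Z + c conj Z] runs through the vectors [e^(ix/2) y] with [y] real,
     where [tau] is already known to be linear; its value at the centre is [Z]. *)
  assert (Key : forall b, (b < m)%nat ->
    Csub (tau Z b) (Csub (Z b) (Cmul (RtoC 2) (Cmul (lin Z) (u b)))) = C0).
  { intros b Hb.
    set (Phi := fun W => Csub (tau W b) (Csub (W b) (Cmul (RtoC 2) (Cmul (lin W) (u b))))).
    assert (HPhi : isHol m U Phi).
    { unfold Phi; apply isHol_sub; [now apply tau_hol|]; apply isHol_sub; [now apply isHol_coord|].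
      apply isHol_mul; [apply isHol_const|]; apply isHol_mul; [|apply isHol_const].
      unfold lin; apply (isHol_sumC m U m (fun j W => Cmul (l j) (W j))); intros j Hj.
      apply isHol_mul; [apply isHol_const|now apply isHol_coord]. }
    destruct HPhi as [Q HQ].
    assert (HU : forall c, Cabs c < 2 -> U (aff Z Zb c)).
    { intros c Hc; apply inDIV_of_lt1.
      - intros k Hk; unfold aff, Zb; rewrite TZ by auto; unfold Cconj; apply Ceq; cunf; ring.
      - apply Rle_lt_trans with (9 * normsq m Z); [|lra].
        unfold normsq; rewrite <- sumR_scal; apply sumR_le; intros k Hk; unfold aff, Zb.
        pose proof (Cabs_add (Z k) (Cmul c (Cconj (Z k)))) as T; rewrite Cabs_mul in T.
        assert (Ec : Cabs (Cconj (Z k)) = Cabs (Z k)).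
        { assert (Cabs (Cconj (Z k)) * Cabs (Cconj (Z k)) = Cabs (Z k) * Cabs (Z k))
            by (rewrite !Cabs_sq; unfold Cconj; cunf; ring).
          pose proof (Cabs_pos (Cconj (Z k))); pose proof (Cabs_pos (Z k)); nra. }
        rewrite Ec in T; rewrite <- !Cabs_sq.
        set (v := Cadd (Z k) (Cmul c (Cconj (Z k)))) in *.
        pose proof (Cabs_pos (Z k)); pose proof (Cabs_pos v); pose proof (Cabs_pos c).
        assert (Cabs v <= 3 * Cabs (Z k)) by nra; nra. }
    pose proof (hol1_affine m U Phi Q Z Zb 2 HQ HU) as Hh.
    assert (A0 : aff Z Zb C0 = Z).
    { apply functional_extensionality; intros k; unfold aff; ring. }
    rewrite <- A0; change (Phi (aff Z Zb C0) = C0).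
    apply (zero_on_circle 2 1 _ _ C0 Hh); try lra; [rewrite Cabs_0; lra|].
    intros x.
    (* Twice the real part of [e^(-ix/2) Z], because [Z + e^(ix) conj Z = e^(ix/2) (e^(-ix/2) Z +
       e^(ix/2) conj Z)]. *)
    set (y := fun k => 2 * (cos (x / 2) * fst (Z k) + sin (x / 2) * snd (Z k))).
    set (eta := circ 1 (x / 2)).
    assert (Heta : Cabs eta = 1) by (apply circ_mod; lra).
    assert (EW : aff Z Zb (circ 1 x) = fun k => Cmul eta (rvec y k)).
    { apply functional_extensionality; intros k; unfold aff, Zb, eta, rvec, y, circ, Cconj.
      assert (c2 : cos x = cos (x / 2) * cos (x / 2) - sin (x / 2) * sin (x / 2))
        by (rewrite <- cos_plus; f_equal; field).
      assert (s2 : sin x = 2 * (sin (x / 2) * cos (x / 2)))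
        by (replace x with (2 * (x / 2)) at 1 by field; rewrite sin_2a; ring).
      pose proof (sin2_cos2 (x / 2)) as h; unfold Rsqr in h.
      rewrite c2, s2; set (cc := cos (x / 2)) in *; set (ss := sin (x / 2)) in *.
      apply Ceq; cunf.
      - transitivity (fst (Z k) * (ss * ss + cc * cc) + (1 * (cc * cc - ss * ss) * fst (Z k) -
          1 * (2 * (ss * cc)) * - snd (Z k))); [rewrite h; ring|ring].
      - transitivity (snd (Z k) * (ss * ss + cc * cc) + (1 * (cc * cc - ss * ss) * - snd (Z k) +
          1 * (2 * (ss * cc)) * fst (Z k))); [rewrite h; ring|ring]. }
    rewrite EW.
    assert (Hy : forall k, (m <= k)%nat -> y k = 0).
    { intros k Hk; unfold y; rewrite TZ by auto; simpl; ring. }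
    set (Y := sumR m (fun j => y j * y j)).
    assert (HY0 : 0 <= Y) by (apply sumR_pos; intros; nra).
    assert (HY : Y < 2).
    { apply Rle_lt_trans with (4 * normsq m Z); [|lra].
      unfold Y, normsq; rewrite <- sumR_scal; apply sumR_le; intros k _; unfold y.
      pose proof (sin2_cos2 (x / 2)) as h; unfold Rsqr in h.
      set (cc := cos (x / 2)) in *; set (ss := sin (x / 2)) in *.
      assert (0 <= (cc * snd (Z k) - ss * fst (Z k)) * (cc * snd (Z k) - ss * fst (Z k)))
        by apply Rle_0_sqr.
      assert (Cnorm2 (Z k) = (ss * ss + cc * cc) * Cnorm2 (Z k)) by (rewrite h; ring).
      unfold Cnorm2 in *; nra. }
    assert (EL : lin (fun k => Cmul eta (rvec y k)) = Cmul eta (Cmul (RtoC (/ s)) (cinner m y u))).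
    { rewrite <- Hl', <- sumC_scal; unfold lin; apply sumC_ext; intros; unfold rvec; ring. }
    unfold Phi; rewrite EL.
    (* [Disc] wants length sqrt 2 and a multiplier of modulus less than 1. Stretching [y] by [t]
       gives the length, and [|y|^2 < 2] gives [t > 1], so the multiplier becomes [eta / t]. For
       [y = 0] both sides vanish. *)
    assert (ET : tau (fun k => Cmul eta (rvec y k)) b = Cmul eta (refl m u y b)).
    { destruct (Rle_lt_or_eq_dec _ _ HY0) as [hY|hY].
      - set (t := sqrt (2 / Y)).
        assert (Ht : t * t = 2 / Y) by (apply sqrt_sqrt; apply Rlt_le, Rdiv_lt_0_compat; lra).
        assert (Ht1 : 1 < t).
        { assert (1 < t * t) by (rewrite Ht; apply Rmult_lt_reg_r with Y; auto; field_simplify; lra).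
          assert (0 <= t) by apply sqrt_pos; nra. }
        set (y' := fun k => t * y k).
        assert (Ey' : (fun k => Cmul eta (rvec y k)) = (fun k => Cmul (Cmul eta (RtoC (/ t))) (rvec y' k))).
        { apply functional_extensionality; intros k; unfold y', rvec; apply Ceq; cunf; field; lra. }
        rewrite Ey', Disc; auto.
        + unfold y'; rewrite AL; apply Ceq; cunf; field; fold s; split; lra.
        + intros k Hk; unfold y'; rewrite Hy by auto; ring.
        + rewrite (sumR_ext _ _ (fun j => t * t * (y j * y j))) by (intros; unfold y'; ring).
          rewrite sumR_scal; fold Y; rewrite Ht; field; lra.
        + rewrite Cabs_mul, Heta, Cabs_real, Rmult_1_l, Rabs_pos_eq.
          * rewrite <- Rinv_1; apply Rinv_lt_contravar; lra.
          * left; apply Rinv_0_lt_compat; lra.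
      - assert (Ey : forall k, y k = 0).
        { intros k; destruct (le_lt_dec m k) as [h|h]; auto.
          assert (E0 : y k * y k = 0).
          { apply (sumR_eq0 m (fun j => y j * y j)); auto; [intros; nra|fold Y; lra]. }
          nra. }
        replace (fun k => Cmul eta (rvec y k)) with vzero.
        + rewrite tau_zero; unfold refl, cinner.
          rewrite (sumC_ext _ _ (fun _ => C0)), sumC_0, Ey.
          * unfold vzero; apply Ceq; cunf; ring.
          * intros j _; rewrite Ey; apply Ceq; cunf; ring.
        + apply functional_extensionality; intros k; unfold rvec; rewrite Ey; unfold vzero.
          apply Ceq; cunf; ring. }
    rewrite ET; unfold refl, rvec; fold s; apply Ceq; cunf; field; lra. }
  (* [tau Z = Z] and [tau Z = Z - 2 l(Z) u]; compare the entries at [j0], where [u] does not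
     vanish. *)
  assert (L0 : lin Z = C0).
  { specialize (Key j0 Hj0); rewrite tZ in Key.
    assert (E : Cmul (Cmul (RtoC 2) (u j0)) (lin Z) = C0) by (rewrite <- Key; ring).
    apply Cmul_eq0 in E; auto; apply Cmul_neq0; auto.
    intros h; injection h; lra. }
  rewrite (sumC_ext _ _ (fun j => Cmul (Cmul (u j0) (RtoC s)) (Cmul (l j) (Z j)))).
  - rewrite sumC_scal; fold (lin Z); rewrite L0; ring.
  - intros j Hj; rewrite Ha, <- Hl by auto; ring.
Qed.
End Reflection.

(** * Criteria for isometry and minimality *)

Lemma vsub_zero w : vsub w vzero = w.
Proof. apply functional_extensionality; intros k; unfold vsub, vzero; ring. Qed.

Lemma inDIV_pred m v : (1 <= m)%nat -> inDIV (m - 1) v -> inDIV m v /\ append0 m v = v.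
Proof.
  intros Hm [H1 [H2 H3]]; split.
  - assert (Z : v (m - 1)%nat = C0) by (apply H3; lia).
    destruct m as [|m]; [lia|]; replace (S m - 1)%nat with m in * by lia.
    unfold inDIV, hIV, normsq in *; simpl; rewrite Z.
    replace (Cnorm2 C0) with 0 by (cunf; ring).
    replace (Cadd (sumC m (fun j => Csq (v j))) (Csq C0)) with (sumC m (fun j => Csq (v j)))
      by (unfold Csq; ring).
    rewrite Rplus_0_r; repeat split; auto; intros k Hk; apply H3; lia.
  - apply functional_extensionality; intros k; unfold append0.
    destruct (Nat.ltb_spec k (m - 1)); auto; symmetry; apply H3; lia.
Qed.

Lemma zero_in_ball n : inBall n vzero.
Proof.
  split; [|intros k _; reflexivity].
  unfold normsq; rewrite (sumR_ext _ _ (fun _ => 0)); [rewrite sumR_const; lra|].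
  intros; unfold vzero; cunf; ring.
Qed.

(** [F 0 = 0] makes 0 a fixed point of the conjugated flip. The independence hypothesis concerns
    small balls because the relation holds only where [F z] is small; continuity of [F] at 0
    supplies such a ball. Of [psi] only the fact that it preserves the ball matters. *)
Lemma minimum_criterion n m F : (4 <= m)%nat -> (forall z, inBall n z -> inDIV m (F z)) ->
  F vzero = vzero -> (forall a, (a < m)%nat -> isHol n (inBall n) (fun z => F z a)) ->
  (forall (a : nat -> R) d, 0 < d ->
     (forall z, inBall n z -> normsq n z < d -> sumC m (fun j => Cmul (RtoC (a j)) (F z j)) = C0) ->
     forall j, (j < m)%nat -> a j = 0) ->
  is_minimum n m F.
Proof.
  intros Hm HF F0 HH HR [G [[_ HG] [psi [phi [[[_ Hpsi] _] [[Hphi [chi [Hchi Hinv]]] E]]]]]].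
  assert (X : forall z, inBall n z -> exists v, inDIV m v /\ v (m - 1)%nat = C0 /\ F z = phi v).
  { intros z Hz; destruct (inDIV_pred m (G (psi z)) ltac:(lia)) as [h1 h2].
    - apply HG, Hpsi, Hz.
    - exists (G (psi z)); split; [exact h1|split].
      + rewrite <- h2; unfold append0; now rewrite Nat.ltb_irrefl.
      + rewrite <- h2; apply functional_extensionality; intros k; now apply E. }
  assert (PC : forall w, inDIV m w -> phi (chi w) = w)
    by (intros w Hw; apply functional_extensionality; apply (Hinv w Hw)).
  assert (CP : forall w, inDIV m w -> chi (phi w) = w)
    by (intros w Hw; apply functional_extensionality; apply (Hinv w Hw)).
  assert (CF : forall z, inBall n z -> chi (F z) (m - 1)%nat = C0).
  { intros z Hz; destruct (X z Hz) as [v [h1 [h2 ->]]]; now rewrite CP. }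
  assert (C00 : chi vzero (m - 1)%nat = C0) by (rewrite <- F0; apply CF, zero_in_ball).
  destruct (reflection_relation m phi chi Hm Hphi Hchi PC CP C00) as [a [[j [Hj Ej]] Ha]].
  assert (N : near n (inBall n) vzero (fun z => normsq m (vsub (F z) (F vzero)) < / 9)).
  { apply normsq_lim; [|lra]; intros b Hb; destruct (HH b Hb) as [P [_ [_ h]]]; apply h, zero_in_ball. }
  destruct N as [d [Hd Hw]].
  apply Ej, (HR a d Hd); auto; intros z Hz Hn.
  apply Ha; [apply HF; auto| |now apply CF].
  specialize (Hw z Hz); rewrite F0, !vsub_zero in Hw; auto.
Qed.

(** * The Levi form of the logarithm of 1 - |z|^2 *)

Definition rcoord (z : Vec) (j : nat) (b : bool) : R := if b then fst (z j) else snd (z j).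
Definition kron (j : nat) (b : bool) (i : nat) (c : bool) : R :=
  if andb (Nat.eqb j i) (Bool.eqb b c) then 1 else 0.

Lemma rcoord_shift z i c t j b : rcoord (shift z i c t) j b = rcoord z j b + t * kron j b i c.
Proof.
  unfold rcoord, shift, kron; destruct (Nat.eqb j i), b, c; cunf; simpl; ring.
Qed.

Lemma normsq_shift n z j b t : (j < n)%nat ->
  normsq n (shift z j b t) = normsq n z + 2 * t * rcoord z j b + t * t.
Proof.
  intros Hj; unfold normsq.
  rewrite (sumR_ext _ _ (fun k => Cnorm2 (z k) + (if Nat.eqb k j then 2 * t * rcoord z j b + t * t else 0))).
  - rewrite sumR_plus, sumR_pick by auto; ring.
  - intros k _; unfold shift, rcoord; destruct (Nat.eqb_spec k j) as [->|], b; cunf; ring.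
Qed.

(** Together with [log_d2], the real partials of [- c log (1 - |z|^2)]. Everything is linear in [c],
    and this alone makes the two Levi forms proportional. *)
Definition log_d1 n (c : R) (j : nat) (b : bool) (z : Vec) : R :=
  c * (2 * rcoord z j b / (1 - normsq n z)).
Definition log_d2 n (c : R) (j : nat) (b : bool) (i : nat) (e : bool) (z : Vec) : R :=
  c * (2 * kron j b i e / (1 - normsq n z) +
       4 * rcoord z j b * rcoord z i e / (1 - normsq n z) ^ 2).
Definition log_levi n c (i j : nat) (z : Vec) : C :=
  (/ 4 * (log_d2 n c j true i true z + log_d2 n c j false i false z),
   / 4 * (log_d2 n c j false i true z - log_d2 n c j true i false z)).

Lemma levi_log n c f : (forall z, inBall n z -> f z = - c * ln (1 - normsq n z)) ->
  levi_form n (inBall n) f (log_levi n c).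
Proof.
  intros Hf; exists (log_d1 n c), (log_d2 n c); split; [|reflexivity].
  intros z Hz j b Hj; pose proof (proj1 Hz) as Hn; split.
  - apply is_derive_Reals.
    apply is_derive_ext_loc with (fun t => - c * ln (1 - (normsq n z + 2 * t * rcoord z j b + t * t))).
    + pose proof (shift_in n _ z j b (open_ball n) Hz Hj) as L; revert L; apply filter_imp.
      intros t Ht; rewrite Hf by exact Ht; now rewrite normsq_shift.
    + auto_derive; [lra|]; unfold log_d1; field; lra.
  - intros i e Hi; apply is_derive_Reals.
    apply is_derive_ext with (fun t => c * (2 * (rcoord z j b + t * kron j b i e) /
      (1 - (normsq n z + 2 * t * rcoord z i e + t * t)))).
    + intros t; unfold log_d1; now rewrite rcoord_shift, normsq_shift.
    + auto_derive; [lra|]; unfold log_d2; field; lra.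
Qed.

(** The excess [e] of [|Z|^2] over [|z|^2] cancels against the quartic term in [hIV], leaving
    [1 - |z|^2]. The bound [e < 1] is what yields the other condition [|Z|^2 < 2] of the domain. *)
Definition sphere_like n m (Z : Vec) (z : Vec) : Prop :=
  tail0 m Z /\ exists e, e < 1 /\ normsq m Z = normsq n z + e /\
    / 4 * Cnorm2 (sumC m (fun j => Csq (Z j))) = e.

Lemma sphere_like_hIV n m Z z : sphere_like n m Z z -> hIV m Z = 1 - normsq n z.
Proof. intros [_ [e [_ [E1 E2]]]]; unfold hIV; lra. Qed.

Lemma sphere_like_inDIV n m Z z : inBall n z -> sphere_like n m Z z -> inDIV m Z.
Proof.
  intros [Hz _] H; pose proof (sphere_like_hIV _ _ _ _ H); destruct H as [T [e [H1 [H2 H3]]]].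
  unfold inDIV; repeat split; auto; lra.
Qed.

Lemma isometry_criterion n m F : (1 <= m)%nat ->
  (forall a, (a < m)%nat -> isHol n (inBall n) (fun z => F z a)) ->
  (forall z, inBall n z -> sphere_like n m (F z) z) -> is_holo_isometry n m F.
Proof.
  intros Hm HH HS; split.
  - split; [apply isHol_holomorphic_on; auto; apply open_ball|].
    intros z Hz; now apply sphere_like_inDIV with n z; auto.
  - assert (P1 : 0 < INR m) by (apply lt_0_INR; lia).
    assert (P2 : 0 < INR (n + 1)) by (apply lt_0_INR; lia).
    (* The quotient of the exponents of the two Bergman kernels. *)
    exists (INR m / INR (n + 1)); split; [now apply Rdiv_lt_0_compat|].
    exists (log_levi n (INR m)), (log_levi n (INR (n + 1))); repeat split.
    + apply levi_log; intros z Hz; unfold logK_IV; now rewrite (sphere_like_hIV n m (F z) z); auto.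
    + now apply levi_log.
    + intros z [Hz _] i j _ _; unfold log_levi, log_d2; apply Ceq; cbn [fst snd]; field; lra.
Qed.

(** * Norms, sums of squares and real linear forms on coordinate lists *)

Lemma sumR_first m f : sumR (S m) f = f O + sumR m (fun j => f (S j)).
Proof. induction m as [|m IH]; [simpl; ring|]; cbn [sumR sumC] in *; rewrite IH; ring. Qed.

Lemma sumC_first m f : sumC (S m) f = Cadd (f O) (sumC m (fun j => f (S j))).
Proof. induction m as [|m IH]; [simpl; ring|]; cbn [sumR sumC] in *; rewrite IH; ring. Qed.

Definition lnorm (l : list C) : R := fold_right (fun c s => Cnorm2 c + s) 0 l.
Definition lsq (l : list C) : C := sumL (map Csq l).
Definition ldot (a : nat -> R) (l : list C) : C :=
  sumC (length l) (fun j => Cmul (RtoC (a j)) (nth j l C0)).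

Lemma normsq_list l : normsq (length l) (vecOfList l) = lnorm l.
Proof.
  unfold normsq, vecOfList; induction l as [|c l IH]; [reflexivity|].
  cbn [length]; rewrite sumR_first; simpl; now rewrite IH.
Qed.

Lemma sumCsq_list l : sumC (length l) (fun j => Csq (vecOfList l j)) = lsq l.
Proof.
  unfold vecOfList; induction l as [|c l IH]; [reflexivity|].
  cbn [length]; rewrite sumC_first; simpl; now rewrite IH.
Qed.

Lemma lnorm_app l1 l2 : lnorm (l1 ++ l2) = lnorm l1 + lnorm l2.
Proof. unfold lnorm; induction l1 as [|c l1 IH]; simpl; [ring|]; rewrite IH; ring. Qed.

Lemma sumL_app l1 l2 : sumL (l1 ++ l2) = Cadd (sumL l1) (sumL l2).
Proof. unfold sumL; induction l1; simpl; [ring|]; rewrite IHl1; ring. Qed.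

Lemma lsq_app l1 l2 : lsq (l1 ++ l2) = Cadd (lsq l1) (lsq l2).
Proof. unfold lsq; rewrite map_app; apply sumL_app. Qed.

Lemma ldot_cons a c l : ldot a (c :: l) = Cadd (Cmul (RtoC (a O)) c) (ldot (fun j => a (S j)) l).
Proof. unfold ldot; cbn [length]; rewrite sumC_first; reflexivity. Qed.

Lemma ldot_nil a : ldot a [] = C0.
Proof. reflexivity. Qed.

Lemma ldot_app l1 : forall a l2,
  ldot a (l1 ++ l2) = Cadd (ldot a l1) (ldot (fun j => a (length l1 + j)%nat) l2).
Proof.
  induction l1 as [|c l1 IH]; intros a l2; cbn [app].
  - rewrite ldot_nil; change (fun j => a (length [] + j)%nat) with a; ring.
  - rewrite !ldot_cons, IH; cbn [length Nat.add]; ring.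
Qed.

Lemma pairs_S a theta z : pairs (S a) theta z = pairs a theta z ++
  [Cmul (RtoC (cos (theta (S a)))) (z a); Cmul (0, sin (theta (S a))) (z a)].
Proof.
  unfold pairs; rewrite seq_S, flat_map_app; simpl; unfold zc.
  now replace (S a - 1)%nat with a by lia.
Qed.

Lemma pairs_length a theta z : length (pairs a theta z) = (2 * a)%nat.
Proof. induction a; [reflexivity|]; rewrite pairs_S, length_app, IHa; simpl; lia. Qed.

Lemma cos2sum_sumC a theta z :
  cos2sum a theta z = sumC a (fun b => Cmul (RtoC (cos (2 * theta (S b)))) (Csq (z b))).
Proof.
  unfold cos2sum; induction a as [|a IH]; [reflexivity|].
  rewrite seq_S, map_app, sumL_app, IH; cbn [sumC map Nat.add]; unfold sumL; cbn [fold_right].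
  unfold zc; replace (S a - 1)%nat with a by lia; ring.
Qed.

Lemma pairs_lnorm a theta z : lnorm (pairs a theta z) = sumR a (fun j => Cnorm2 (z j)).
Proof.
  induction a as [|a IH]; [reflexivity|]; rewrite pairs_S, lnorm_app, IH; simpl.
  f_equal; pose proof (sin2_cos2 (theta (S a))) as h; unfold Rsqr in h.
  transitivity ((sin (theta (S a)) * sin (theta (S a)) + cos (theta (S a)) * cos (theta (S a))) * Cnorm2 (z a));
    [cunf; ring|rewrite h; ring].
Qed.

Lemma pairs_lsq a theta z : lsq (pairs a theta z) = cos2sum a theta z.
Proof.
  rewrite cos2sum_sumC; induction a as [|a IH]; [reflexivity|]; rewrite pairs_S, lsq_app, IH.
  simpl; f_equal; rewrite cos_2a; unfold lsq; simpl; apply Ceq; cunf; ring.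
Qed.

Lemma pairs_ldot d a theta z : ldot d (pairs a theta z) =
  sumC a (fun b => Cmul (d (2 * b)%nat * cos (theta (S b)), d (2 * b + 1)%nat * sin (theta (S b))) (z b)).
Proof.
  induction a as [|a IH]; [reflexivity|]; rewrite pairs_S, ldot_app, IH, pairs_length; cbn [sumC].
  f_equal; rewrite !ldot_cons, ldot_nil.
  replace (2 * a + 0)%nat with (2 * a)%nat by lia; apply Ceq; cunf; ring.
Qed.

Lemma plain_length p q z : length (plain (S p) q z) = (q - p)%nat.
Proof. unfold plain; rewrite length_map, length_seq; lia. Qed.

Lemma plain_seq p q z : plain (S p) q z = map (fun b => z (p + b)%nat) (seq 0 (q - p)).
Proof.
  unfold plain; replace (S q - S p)%nat with (q - p)%nat by lia.
  replace (S p) with (S p + 0)%nat by lia.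
  generalize (q - p)%nat as len, 0%nat as s; induction len; intros s; simpl; auto; f_equal.
  - unfold zc; f_equal; lia.
  - rewrite <- IHlen; do 2 f_equal; lia.
Qed.

Lemma list_lnorm len (f : nat -> C) : lnorm (map f (seq 0 len)) = sumR len (fun b => Cnorm2 (f b)).
Proof. induction len; [reflexivity|]; rewrite seq_S, map_app, lnorm_app, IHlen; unfold lnorm; simpl; ring. Qed.

Lemma list_sumL len (f : nat -> C) : sumL (map f (seq 0 len)) = sumC len f.
Proof. induction len; [reflexivity|]; rewrite seq_S, map_app, sumL_app, IHlen; cbn [sumC map Nat.add]; unfold sumL; cbn [fold_right]; ring. Qed.

Lemma list_ldot len d (f : nat -> C) :
  ldot d (map f (seq 0 len)) = sumC len (fun b => Cmul (RtoC (d b)) (f b)).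
Proof.
  induction len; [reflexivity|]; rewrite seq_S, map_app, ldot_app, IHlen, length_map, length_seq; cbn [sumC map Nat.add].
  rewrite ldot_cons, ldot_nil; replace (len + 0)%nat with len by lia; ring.
Qed.

Lemma sqsum_sumC p q z : sqsum (S p) q z = sumC (q - p) (fun b => Csq (z (p + b)%nat)).
Proof.
  rewrite <- list_sumL; unfold sqsum; f_equal.
  pose proof (plain_seq p q z) as h; unfold plain in h.
  rewrite <- (map_map (zc z) Csq), h, map_map; reflexivity.
Qed.

Lemma plain_lsq p q z : lsq (plain (S p) q z) = sqsum (S p) q z.
Proof. unfold lsq, plain, sqsum; now rewrite map_map. Qed.

Lemma sumR_split p r f : sumR (p + r) f = sumR p f + sumR r (fun b => f (p + b)%nat).
Proof.
  induction r; simpl; [rewrite Nat.add_0_r; ring|].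
  replace (p + S r)%nat with (S (p + r)) by lia; simpl; rewrite IHr; ring.
Qed.

(** The sum of squares of the [pairs] and [plain] coordinates. For suitable [p] and [q] it is the
    [A], [S] or [T] of the maps, or the sum under the root. *)
Definition quad p q theta z : C := Cadd (cos2sum p theta z) (sqsum (S p) q z).

Lemma Cabs_Csq a : Cabs (Csq a) = Cnorm2 a.
Proof. unfold Csq; rewrite Cabs_mul; apply Cabs_sq. Qed.

Lemma Cabs_sumC m f : Cabs (sumC m f) <= sumR m (fun j => Cabs (f j)).
Proof.
  induction m; simpl; [rewrite Cabs_0; lra|].
  eapply Rle_trans; [apply Cabs_add|]; lra.
Qed.

Lemma quad_bound p q theta z : (p <= q)%nat -> Cabs (quad p q theta z) <= normsq q z.
Proof.
  intros Hpq; unfold quad, normsq; replace q with (p + (q - p))%nat at 2 by lia; rewrite sumR_split.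
  rewrite cos2sum_sumC, sqsum_sumC; eapply Rle_trans; [apply Cabs_add|].
  apply Rplus_le_compat; (eapply Rle_trans; [apply Cabs_sumC|]); apply sumR_le; intros j _.
  - rewrite Cabs_mul, Cabs_Csq, Cabs_real; pose proof (COS_bound (2 * theta (S j))).
    assert (Rabs (cos (2 * theta (S j))) <= 1) by (apply Rabs_le; lra).
    pose proof (Cnorm2_pos (z j)); nra.
  - rewrite Cabs_Csq; lra.
Qed.

(** * Holomorphy of coordinate lists and test points on the axes *)

Definition hol_list n U (l : Vec -> list C) : Prop :=
  exists gs, List.Forall (isHol n U) gs /\ forall z, l z = map (fun g => g z) gs.

Lemma hol_list_nil n U : hol_list n U (fun _ => []).
Proof. exists []; split; auto. Qed.

Lemma hol_list_cons n U f l : isHol n U f -> hol_list n U l -> hol_list n U (fun z => f z :: l z).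
Proof.
  intros Hf [gs [H E]]; exists (f :: gs); split; [now constructor|]; intros z; simpl; now rewrite E.
Qed.

Lemma hol_list_app n U l1 l2 : hol_list n U l1 -> hol_list n U l2 ->
  hol_list n U (fun z => l1 z ++ l2 z).
Proof.
  intros [g1 [H1 E1]] [g2 [H2 E2]]; exists (g1 ++ g2); split; [now apply List.Forall_app|].
  intros z; now rewrite map_app, E1, E2.
Qed.

Lemma hol_list_vec n U l a : hol_list n U l -> isHol n U (fun z => vecOfList (l z) a).
Proof.
  intros [gs [H E]]; unfold vecOfList.
  apply isHol_ext with (fun z => nth a (map (fun g => g z) gs) C0); [intros; now rewrite E|].
  clear E l; revert a; induction H as [|g gs Hg H IH]; intros a; simpl.
  - destruct a; apply isHol_const.
  - destruct a; auto.
Qed.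

Lemma hol_list_ext n U l1 l2 : (forall z, l1 z = l2 z) -> hol_list n U l1 -> hol_list n U l2.
Proof. intros E [gs [H K]]; exists gs; split; auto; intros; now rewrite <- E. Qed.

Lemma hol_list_pairs n U a theta : (a <= n)%nat -> hol_list n U (pairs a theta).
Proof.
  induction a as [|a IH]; intros Ha; [apply hol_list_nil|].
  apply hol_list_ext with (1 := fun z => eq_sym (pairs_S a theta z)).
  apply hol_list_app; [apply IH; lia|].
  do 2 (apply hol_list_cons; [apply isHol_mul; [apply isHol_const|apply isHol_coord; lia]|]).
  apply hol_list_nil.
Qed.

Lemma hol_list_plain n U p q : (q <= n)%nat -> hol_list n U (plain (S p) q).
Proof.
  intros Hq; apply hol_list_ext with (1 := fun z => eq_sym (plain_seq p q z)).
  assert (H : forall len, (p + len <= n \/ len = 0)%nat ->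
    hol_list n U (fun z => map (fun b => z (p + b)%nat) (seq 0 len))).
  { induction len as [|len IH]; intros Hl; [apply hol_list_nil|].
    apply hol_list_ext with (fun z => map (fun b => z (p + b)%nat) (seq 0 len) ++ [z (p + len)%nat]).
    - intros z; now rewrite seq_S, map_app.
    - apply hol_list_app; [apply IH; lia|]; apply hol_list_cons; [apply isHol_coord; lia|apply hol_list_nil]. }
  apply H; lia.
Qed.

Lemma isHol_quad n U p q theta : (p <= q)%nat -> (q <= n)%nat -> isHol n U (quad p q theta).
Proof.
  intros Hp Hq; unfold quad; apply isHol_add.
  - apply isHol_ext with (1 := fun z _ => eq_sym (cos2sum_sumC p theta z)).
    apply (isHol_sumC n U p (fun b z => Cmul (RtoC (cos (2 * theta (S b)))) (Csq (z b)))); intros j Hj.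
    apply isHol_mul; [apply isHol_const|]; unfold Csq; apply isHol_mul; apply isHol_coord; lia.
  - apply isHol_ext with (1 := fun z _ => eq_sym (sqsum_sumC p q z)).
    apply (isHol_sumC n U (q - p) (fun b z => Csq (z (p + b)%nat))); intros j Hj.
    unfold Csq; apply isHol_mul; apply isHol_coord; lia.
Qed.

Definition evec (t : R) (i : nat) : Vec := fun k => if Nat.eqb k i then RtoC t else C0.

Lemma evec_normsq n t i : (i < n)%nat -> normsq n (evec t i) = t * t.
Proof.
  intros Hi; rewrite <- (sumR_pick n i (t * t) Hi); apply sumR_ext; intros k _.
  unfold evec; destruct (Nat.eqb k i); cunf; ring.
Qed.

Lemma evec_in_ball n t i : (i < n)%nat -> t * t < 1 -> inBall n (evec t i).
Proof.
  intros Hi Ht; split; [now rewrite evec_normsq|]; intros k Hk; unfold evec.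
  destruct (Nat.eqb_spec k i); auto; lia.
Qed.

Lemma quad_evec_pair p q theta t i : (i < p)%nat ->
  quad p q theta (evec t i) = RtoC (cos (2 * theta (S i)) * (t * t)).
Proof.
  intros Hi; unfold quad; rewrite cos2sum_sumC, sqsum_sumC.
  rewrite (sumC_ext (q - p) _ (fun _ => C0)), sumC_0.
  - rewrite (sumC_ext _ _ (fun b => if Nat.eqb b i then RtoC (cos (2 * theta (S b)) * (t * t)) else C0)).
    + rewrite (sumC_pick p i (fun b => RtoC (cos (2 * theta (S b)) * (t * t))) Hi); ring.
    + intros b _; unfold evec; destruct (Nat.eqb b i); apply Ceq; cunf; ring.
  - intros b _; unfold evec; destruct (Nat.eqb_spec (p + b) i); [lia|]; apply Ceq; cunf; ring.
Qed.

Lemma quad_evec_plain p q theta t i : (p <= i < q)%nat ->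
  quad p q theta (evec t i) = RtoC (t * t).
Proof.
  intros Hi; unfold quad; rewrite cos2sum_sumC, sqsum_sumC.
  rewrite (sumC_ext p _ (fun _ => C0)), sumC_0.
  - rewrite (sumC_ext _ _ (fun b => if Nat.eqb b (i - p) then RtoC (t * t) else C0)).
    + rewrite (sumC_pick (q - p) (i - p) (fun b => RtoC (t * t))) by lia; ring.
    + intros b _; unfold evec; destruct (Nat.eqb_spec (p + b) i), (Nat.eqb_spec b (i - p)); try lia;
        apply Ceq; cunf; ring.
  - intros b Hb; unfold evec; destruct (Nat.eqb_spec b i); [lia|]; apply Ceq; cunf; ring.
Qed.

Lemma quad_evec_out p q theta t i : (p <= q)%nat -> (q <= i)%nat -> quad p q theta (evec t i) = C0.
Proof.
  intros Hp Hi; unfold quad; rewrite cos2sum_sumC, sqsum_sumC.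
  rewrite (sumC_ext p _ (fun _ => C0)), (sumC_ext (q - p) _ (fun _ => C0)), !sumC_0; [ring| |].
  - intros b Hb; unfold evec; destruct (Nat.eqb_spec (p + b) i); [lia|]; apply Ceq; cunf; ring.
  - intros b Hb; unfold evec; destruct (Nat.eqb_spec b i); [lia|]; apply Ceq; cunf; ring.
Qed.

Lemma quad_evec_even p q theta t i : (p <= q)%nat ->
  quad p q theta (evec (- t) i) = quad p q theta (evec t i).
Proof.
  intros Hp; destruct (le_lt_dec q i); [now rewrite !quad_evec_out|].
  destruct (le_lt_dec p i).
  - rewrite !quad_evec_plain by lia; f_equal; ring.
  - rewrite !quad_evec_pair by lia; f_equal; ring.
Qed.

Lemma small_radius d : 0 < d -> exists t, 0 < t /\ t * t < 1 /\ t * t < d.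
Proof.
  intros Hd; exists (Rmin (/ 2) (d / 2)).
  assert (0 < Rmin (/ 2) (d / 2)) by (apply Rmin_glb_lt; lra).
  pose proof (Rmin_l (/ 2) (d / 2)); pose proof (Rmin_r (/ 2) (d / 2)).
  repeat split; auto; nra.
Qed.

(** * Maps made of pairs, plain coordinates and a tail *)

Section Standard.
Variables (n p q r m : nat) (theta : nat -> R) (tl : Vec -> list C).
Hypotheses (Hpq : (p <= q)%nat) (Hqn : (q <= n)%nat) (Hm : m = (2 * p + (q - p) + r)%nat)
  (Hm4 : (4 <= m)%nat) (Htheta : theta_ok p theta)
  (Hlen : forall z, length (tl z) = r)
  (Hhol : hol_list n (inBall n) tl)
  (Hsph : forall z, inBall n z -> exists e, e < 1 /\ normsq q z + lnorm (tl z) = normsq n z + e /\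
     / 4 * Cnorm2 (Cadd (quad p q theta z) (lsq (tl z))) = e)
  (Hzero : tl vzero = repeat C0 r)
  (Heven : forall t i, (i < q)%nat -> t * t < 1 -> tl (evec (- t) i) = tl (evec t i))
  (Hindep : forall (b : nat -> R) d, 0 < d ->
     (forall z, inBall n z -> normsq n z < d -> ldot b (tl z) = C0) -> forall j, (j < r)%nat -> b j = 0).
Let F z := vecOfList (pairs p theta z ++ plain (S p) q z ++ tl z).

Lemma std_length z : length (pairs p theta z ++ plain (S p) q z ++ tl z) = m.
Proof. rewrite !length_app, pairs_length, plain_length, Hlen, Hm; lia. Qed.

Lemma std_hol a : isHol n (inBall n) (fun z => F z a).
Proof.
  unfold F; apply hol_list_vec; apply hol_list_app; [apply hol_list_pairs; lia|].
  apply hol_list_app; auto; now apply hol_list_plain.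
Qed.

Lemma std_sphere z : inBall n z -> sphere_like n m (F z) z.
Proof.
  intros Hz; split.
  - intros k Hk; unfold F, vecOfList; apply nth_overflow; rewrite std_length; lia.
  - destruct (Hsph z Hz) as [e [H1 [H2 H3]]]; exists e; unfold F.
    rewrite <- (std_length z), normsq_list, sumCsq_list, !lnorm_app, !lsq_app.
    rewrite pairs_lnorm, pairs_lsq, plain_lsq, plain_seq, list_lnorm.
    split; [auto|split].
    + rewrite <- Rplus_assoc, <- sumR_split; replace (p + (q - p))%nat with q by lia; exact H2.
    + rewrite <- H3; do 2 f_equal; unfold quad; ring.
Qed.

Lemma sin_cos_theta j : (j < p)%nat -> cos (theta (S j)) <> 0 /\ sin (theta (S j)) <> 0.
Proof.
  intros Hj; destruct (Htheta (S j) ltac:(lia)) as [h1 h2]; pose proof PI_RGT_0.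
  split; apply Rgt_not_eq; [apply cos_gt_0|apply sin_gt_0]; lra.
Qed.

Lemma std_zero : F vzero = vzero.
Proof.
  apply functional_extensionality; intros k; unfold F, vecOfList, vzero at 4.
  assert (A : forall c, In c (pairs p theta vzero ++ plain (S p) q vzero ++ tl vzero) -> c = C0).
  { intros c Hc; rewrite !in_app_iff in Hc; destruct Hc as [Hc|[Hc|Hc]].
    - unfold pairs in Hc; apply in_flat_map in Hc; destruct Hc as [j [_ Hc]].
      simpl in Hc; unfold zc, vzero in Hc; destruct Hc as [<-|[<-|[]]]; apply Ceq; cunf; ring.
    - unfold plain in Hc; apply in_map_iff in Hc; destruct Hc as [j [<- _]]; reflexivity.
    - rewrite Hzero in Hc; now apply repeat_spec in Hc. }
  destruct (nth_in_or_default k (pairs p theta vzero ++ plain (S p) q vzero ++ tl vzero) C0) as [h|h];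
    auto.
Qed.

(** On the axes of the first [q] coordinates the tail is even while the other blocks are odd, so the
    difference of the relation at [t e_i] and [- t e_i] isolates one coefficient. Once these vanish,
    only the relation among the tail entries is left. *)
Lemma std_relation (a : nat -> R) d : 0 < d ->
  (forall z, inBall n z -> normsq n z < d -> sumC m (fun j => Cmul (RtoC (a j)) (F z j)) = C0) ->
  forall j, (j < m)%nat -> a j = 0.
Proof.
  intros Hd H.
  (* The complex coefficient of [z b]: because [a] is real, the two coordinates of the pair
     contribute its real and imaginary parts separately, so [K b = 0] kills both. *)
  set (K := fun b => (a (2 * b)%nat * cos (theta (S b)), a (2 * b + 1)%nat * sin (theta (S b))) : C).
  set (a1 := fun j => a (2 * p + j)%nat); set (a2 := fun j => a1 (q - p + j)%nat).
  assert (E : forall z, inBall n z -> normsq n z < d ->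
    Cadd (sumC p (fun b => Cmul (K b) (z b))) (Cadd (sumC (q - p) (fun b => Cmul (RtoC (a1 b)) (z (p + b)%nat)))
      (ldot a2 (tl z))) = C0).
  { intros z Hz Hn; rewrite <- (H z Hz Hn); unfold F, vecOfList; rewrite <- (std_length z).
    change (sumC (length ?l) (fun j => Cmul (RtoC (a j)) (nth j ?l C0))) with (ldot a l).
    rewrite !ldot_app, pairs_ldot, pairs_length, plain_length, plain_seq, list_ldot; reflexivity. }
  destruct (small_radius d Hd) as [t [Ht [Ht1 Htd]]].
  assert (P : forall i, (i < p)%nat -> K i = C0).
  { intros i Hi.
    assert (X : forall s, s * s = t * t -> Cadd (Cmul (RtoC s) (K i)) (ldot a2 (tl (evec s i))) = C0).
    { intros s Hs; rewrite <- (E (evec s i)); [|apply evec_in_ball; [lia|lra]|rewrite evec_normsq; [lra|lia]].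
      rewrite (sumC_ext p _ (fun b => if Nat.eqb b i then Cmul (RtoC s) (K b) else C0)).
      - rewrite (sumC_pick p i (fun b => Cmul (RtoC s) (K b)) Hi), (sumC_ext (q - p) _ (fun _ => C0)), sumC_0;
          [ring|].
        intros b _; unfold evec; destruct (Nat.eqb_spec (p + b) i); [lia|ring].
      - intros b _; unfold evec; destruct (Nat.eqb b i); ring. }
    pose proof (X t eq_refl) as X1; pose proof (X (- t) ltac:(ring)) as X2.
    rewrite Heven in X2 by (lia || lra).
    assert (Y : Cmul (RtoC (2 * t)) (K i) = C0).
    { transitivity (Csub (Cadd (Cmul (RtoC t) (K i)) (ldot a2 (tl (evec t i))))
        (Cadd (Cmul (RtoC (- t)) (K i)) (ldot a2 (tl (evec t i))))).
      - apply Ceq; cunf; ring.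
      - rewrite X1, X2; ring. }
    apply Cmul_eq0 in Y; auto; intros h; injection h; lra. }
  assert (Q : forall i, (i < q - p)%nat -> a1 i = 0).
  { intros i Hi.
    assert (X : forall s, s * s = t * t ->
      Cadd (RtoC (s * a1 i)) (ldot a2 (tl (evec s (p + i)))) = C0).
    { intros s Hs; rewrite <- (E (evec s (p + i))); [|apply evec_in_ball; [lia|lra]|rewrite evec_normsq; [lra|lia]].
      rewrite (sumC_ext p _ (fun _ => C0)), sumC_0.
      - rewrite (sumC_ext (q - p) _ (fun b => if Nat.eqb b i then RtoC (s * a1 b) else C0)).
        + rewrite (sumC_pick (q - p) i (fun b => RtoC (s * a1 b)) Hi); ring.
        + intros b _; unfold evec; destruct (Nat.eqb_spec (p + b) (p + i)), (Nat.eqb_spec b i); try lia;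
            apply Ceq; cunf; ring.
      - intros b Hb; unfold evec; destruct (Nat.eqb_spec b (p + i)); [lia|ring]. }
    pose proof (X t eq_refl) as X1; pose proof (X (- t) ltac:(ring)) as X2.
    rewrite Heven in X2 by (lia || lra).
    assert (Y : RtoC (2 * t * a1 i) = C0).
    { transitivity (Csub (Cadd (RtoC (t * a1 i)) (ldot a2 (tl (evec t (p + i)))))
        (Cadd (RtoC (- t * a1 i)) (ldot a2 (tl (evec t (p + i)))))).
      - apply Ceq; cunf; ring.
      - rewrite X1, X2; ring. }
    injection Y; intros h; nra. }
  assert (T : forall j, (j < r)%nat -> a2 j = 0).
  { apply (Hindep a2 d Hd); intros z Hz Hn; rewrite <- (E z Hz Hn).
    rewrite (sumC_ext p _ (fun _ => C0)), (sumC_ext (q - p) _ (fun _ => C0)), !sumC_0; [ring| |].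
    - intros b Hb; rewrite Q by auto; change (RtoC 0) with C0; ring.
    - intros b Hb; rewrite P by auto; ring. }
  intros j Hj.
  destruct (le_lt_dec (2 * p + (q - p)) j) as [h|h].
  { specialize (T (j - (2 * p + (q - p)))%nat ltac:(lia)); unfold a2, a1 in T; rewrite <- T; f_equal; lia. }
  destruct (le_lt_dec (2 * p) j) as [h'|h'].
  { specialize (Q (j - 2 * p)%nat ltac:(lia)); unfold a1 in Q; rewrite <- Q; f_equal; lia. }
  (* An index in the first block is [2 b] (cosine entry) or [2 b + 1] (sine entry) with
     [b = j / 2]. *)
  assert (Hb : (j / 2 < p)%nat) by (apply Nat.Div0.div_lt_upper_bound; lia).
  destruct (sin_cos_theta (j / 2) Hb) as [c1 c2].
  specialize (P (j / 2)%nat Hb); injection P; intros e2 e1.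
  pose proof (Nat.div_mod_eq j 2) as Ej; pose proof (Nat.mod_upper_bound j 2 ltac:(lia)) as Mj.
  destruct (Nat.eq_dec (j mod 2) 0) as [z|z].
  - replace j with (2 * (j / 2))%nat by lia; apply Rmult_integral in e1; tauto.
  - replace j with (2 * (j / 2) + 1)%nat by lia; apply Rmult_integral in e2; tauto.
Qed.

Lemma std_min_isometry : is_min_holo_isometry n m F.
Proof.
  split.
  - apply isometry_criterion; [lia|intros; apply std_hol|apply std_sphere].
  - apply minimum_criterion; auto.
    + intros z Hz; apply sphere_like_inDIV with n z; auto; now apply std_sphere.
    + apply std_zero.
    + intros; apply std_hol.
    + intros a d Hd H j Hj; exact (std_relation a d Hd H j Hj).
Qed.
End Standard.

(** * The maps *)

(** Keeps [quad] from vanishing identically, in which case the tail would vanish too and the map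
    would not be minimum. It comes from a plain coordinate or from an angle different from
    [PI / 4]. *)
Definition nondegenerate n p theta : Prop :=
  exists i c, (i < n)%nat /\ 0 < c /\ forall t, quad p n theta (evec t i) = RtoC (c * (t * t)).

Lemma nondegenerate_plain n p theta : (p < n)%nat -> nondegenerate n p theta.
Proof.
  intros H; exists p, 1; repeat split; [lia|lra|]; intros t; rewrite quad_evec_plain by lia; f_equal; ring.
Qed.

Lemma nondegenerate_pairs n theta : theta_ok n theta -> not_all_pi4 n theta -> nondegenerate n n theta.
Proof.
  intros H [j [Hj E]]; destruct j as [|i]; [lia|].
  destruct (H (S i) Hj) as [h1 h2]; pose proof PI_RGT_0.
  exists i, (cos (2 * theta (S i))); repeat split; [lia|apply cos_gt_0; lra|].
  intros t; rewrite quad_evec_pair by lia; reflexivity.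
Qed.

Lemma quad_zero p q theta : (p <= q)%nat -> quad p q theta vzero = C0.
Proof.
  intros H; replace vzero with (evec 0 q); [now apply quad_evec_out|].
  apply functional_extensionality; intros k; unfold evec; destruct (Nat.eqb k q); reflexivity.
Qed.

Lemma quad_lt1 n p theta z : (p <= n)%nat -> inBall n z -> Cabs (quad p n theta z) < 1.
Proof. intros H [Hz _]; pose proof (quad_bound p n theta z H); lra. Qed.

(** The root of [W^2 - 2 W + c S = 0] that vanishes at [S = 0]. *)
Definition rad (c : R) (S : C) : C := Csub C1 (Csqrt (Csub C1 (Cmul (RtoC c) S))).

Lemma rad_radicand c S : 0 < c <= 1 -> Cabs S < 1 -> 0 < fst (Csub C1 (Cmul (RtoC c) S)).
Proof.
  intros Hc H; pose proof (fst_le_Cabs S) as h; apply Rabs_le_between in h; simpl; nra.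
Qed.

Lemma rad_sq c S : 0 < c <= 1 -> Cabs S < 1 ->
  Csq (rad c S) = Csub (Cmul (RtoC 2) (rad c S)) (Cmul (RtoC c) S).
Proof.
  intros Hc H; pose proof (Csqrt_sq _ (rad_radicand c S Hc H)) as E; unfold rad.
  set (s := Csqrt _) in *.
  transitivity (Csub (Cmul (RtoC 2) (Csub C1 s)) (Csub C1 (Csq s)));
    [apply Ceq; cunf; ring|rewrite E; ring].
Qed.

Lemma rad_prod c S : 0 < c <= 1 -> Cabs S < 1 ->
  Cmul (rad c S) (Cadd C1 (Csqrt (Csub C1 (Cmul (RtoC c) S)))) = Cmul (RtoC c) S.
Proof.
  intros Hc H; pose proof (Csqrt_sq _ (rad_radicand c S Hc H)) as E; unfold rad.
  set (s := Csqrt _) in *; transitivity (Csub C1 (Csq s)); [unfold Csq; ring|rewrite E; ring].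
Qed.

(** The product of [rad c S] and [1 + sqrt (1 - c S)] is [c S], and the second factor has real part,
    hence modulus, at least 1. *)
Lemma rad_bound c S : 0 < c <= 1 -> Cabs S < 1 -> Cabs (rad c S) < c.
Proof.
  intros Hc H; pose proof (rad_prod c S Hc H) as E.
  pose proof (Csqrt_fst_pos _ (rad_radicand c S Hc H)) as P.
  set (s := Csqrt _) in *.
  assert (B : 1 <= Cabs (Cadd C1 s)).
  { pose proof (fst_le_Cabs (Cadd C1 s)) as h; apply Rabs_le_between in h.
    change (fst (Cadd C1 s)) with (1 + fst s) in h; lra. }
  assert (F : Cabs (rad c S) * Cabs (Cadd C1 s) = c * Cabs S)
    by (rewrite <- Cabs_mul, E, Cabs_mul, Cabs_real, Rabs_pos_eq by lra; reflexivity).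
  pose proof (Cabs_pos (rad c S)); pose proof (Cabs_pos S); nra.
Qed.

Lemma rad_0 c : rad c C0 = C0.
Proof.
  unfold rad; replace (Csub C1 (Cmul (RtoC c) C0)) with C1 by ring.
  assert (E : sqrt (Cnorm2 C1) = 1).
  { replace (Cnorm2 C1) with 1 by (cunf; ring); apply sqrt_1. }
  unfold Csqrt; rewrite E; apply Ceq; cunf.
  - replace ((1 + 1) / 2) with 1 by field; rewrite sqrt_1; ring.
  - replace ((1 - 1) / 2) with 0 by field; rewrite sqrt_0; ring.
Qed.

Lemma rad_neq0 c S : 0 < c <= 1 -> Cabs S < 1 -> S <> C0 -> rad c S <> C0.
Proof.
  intros Hc H HS E; pose proof (rad_prod c S Hc H) as F; rewrite E in F.
  apply HS; apply (Cmul_eq0 (RtoC c)); [rewrite <- F; ring|].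
  intros h; injection h; lra.
Qed.

Lemma isHol_rad n U c S : 0 < c <= 1 -> (forall z, U z -> Cabs (S z) < 1) -> isHol n U S ->
  isHol n U (fun z => rad c (S z)).
Proof.
  intros Hc HU HS; unfold rad; apply isHol_sub; [apply isHol_const|]; apply isHol_sqrt.
  - intros z Hz; apply rad_radicand; auto.
  - apply isHol_sub; [apply isHol_const|]; apply isHol_mul; auto; apply isHol_const.
Qed.

Definition quad_map p n (theta : nat -> R) (T : C -> list C) (z : Vec) : Vec :=
  vecOfList (pairs p theta z ++ plain (S p) n z ++ T (quad p n theta z)).

(** When the tail depends on [z] only through [S = quad], the isometry condition becomes a single
    identity in the one variable [S], namely [|S + T . T|^2 / 4 = |T|^2] with [T . T] the sum of
    squares of the tail; independence need only be tested at one nonzero [S]. *)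
Lemma quad_map_min_isometry n p r m theta (T : C -> list C) : (p <= n)%nat ->
  m = (p + n + r)%nat -> (4 <= m)%nat -> theta_ok p theta -> nondegenerate n p theta ->
  (forall S, length (T S) = r) -> hol_list n (inBall n) (fun z => T (quad p n theta z)) ->
  T C0 = repeat C0 r ->
  (forall S, Cabs S < 1 -> lnorm (T S) < 1 /\ / 4 * Cnorm2 (Cadd S (lsq (T S))) = lnorm (T S)) ->
  (forall (b : nat -> R) S, Cabs S < 1 -> S <> C0 -> ldot b (T S) = C0 ->
     forall j, (j < r)%nat -> b j = 0) ->
  is_min_holo_isometry n m (quad_map p n theta T).
Proof.
  intros Hp Em Hm Hth [i [c [Hi [Hc Hq]]]] Hlen Hhol H0 Hn Hd.
  apply (std_min_isometry n p n r m theta (fun z => T (quad p n theta z))); auto; try lia.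
  - intros z Hz; destruct (Hn _ (quad_lt1 n p theta z Hp Hz)) as [h1 h2].
    exists (lnorm (T (quad p n theta z))); repeat split; auto.
  - rewrite quad_zero; auto.
  - intros t j _ _; now rewrite quad_evec_even.
  - intros b d Hd0 H j Hj; destruct (small_radius d Hd0) as [t [Ht [Ht1 Htd]]].
    assert (B : inBall n (evec t i)) by now apply evec_in_ball.
    apply (Hd b (quad p n theta (evec t i))); auto.
    + now apply quad_lt1.
    + rewrite Hq; intros h; injection h; intros h'.
      assert (0 < c * (t * t)) by (apply Rmult_lt_0_compat; nra); lra.
    + apply H; auto; now rewrite evec_normsq.
Qed.

Lemma two_sqrt2_inv : / two_sqrt2 * / two_sqrt2 = / 8 /\ 0 < / two_sqrt2.
Proof.
  unfold two_sqrt2; pose proof (sqrt_lt_R0 2 ltac:(lra)); pose proof (sqrt_sqrt 2 ltac:(lra)) as h.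
  split; [|apply Rinv_0_lt_compat; lra].
  rewrite <- Rinv_mult; f_equal.
  replace (2 * sqrt 2 * (2 * sqrt 2)) with (4 * (sqrt 2 * sqrt 2)) by ring; lra.
Qed.

(** An isotropic vector: its squares cancel, and its squared norm is [|S|^2 / 4]. *)
Definition rational_tail (S : C) : list C :=
  [Cmul (RtoC (/ two_sqrt2)) S; Cmul (0, - / two_sqrt2) S].

Lemma rational_tail_min_isometry n p m theta : (p <= n)%nat -> m = (p + n + 2)%nat -> (4 <= m)%nat ->
  theta_ok p theta -> nondegenerate n p theta ->
  is_min_holo_isometry n m (quad_map p n theta rational_tail).
Proof.
  intros Hp Em Hm Hth Hnd; destruct two_sqrt2_inv as [E P].
  apply quad_map_min_isometry with 2%nat; auto.
  - do 2 (apply hol_list_cons; [apply isHol_mul; [apply isHol_const|now apply isHol_quad]|]).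
    apply hol_list_nil.
  - unfold rational_tail; simpl; repeat f_equal; apply Ceq; cunf; ring.
  - intros S HS.
    assert (N : lnorm (rational_tail S) = / 4 * Cnorm2 S).
    { unfold lnorm, rational_tail; cbn [fold_right]; rewrite !Cnorm2_mul.
      replace (Cnorm2 (RtoC (/ two_sqrt2))) with (/ 8) by (rewrite <- E; cunf; ring).
      replace (Cnorm2 (0, - / two_sqrt2)) with (/ 8) by (rewrite <- E; cunf; ring); field. }
    rewrite N; split.
    + assert (Cnorm2 S < 1) by (rewrite <- Cabs_sq; pose proof (Cabs_pos S); nra); lra.
    + do 2 f_equal; unfold lsq, rational_tail, sumL; cbn [map fold_right]; apply Ceq; cunf; ring.
  - intros b S HS S0 H; unfold rational_tail in H; rewrite !ldot_cons, ldot_nil in H.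
    assert (K : Cmul S (/ two_sqrt2 * b 0%nat, - / two_sqrt2 * b 1%nat) = C0)
      by (rewrite <- H; apply Ceq; cunf; ring).
    apply Cmul_eq0 in K; auto; injection K; intros h1 h0.
    intros j Hj; destruct j as [|[|j]]; [nra|nra|lia].
Qed.

Lemma irrational_tail_min_isometry n p m theta : (p <= n)%nat -> m = (p + n + 1)%nat -> (4 <= m)%nat ->
  theta_ok p theta -> nondegenerate n p theta ->
  is_min_holo_isometry n m (quad_map p n theta (fun S => [rad 1 S])).
Proof.
  intros Hp Em Hm Hth Hnd.
  assert (H1 : 0 < 1 <= 1) by lra.
  apply quad_map_min_isometry with 1%nat; auto.
  - apply hol_list_cons; [|apply hol_list_nil].
    apply isHol_rad; auto; [intros z Hz; now apply quad_lt1|now apply isHol_quad].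
  - rewrite rad_0; reflexivity.
  - intros S HS; pose proof (rad_bound 1 S H1 HS) as B; pose proof (rad_sq 1 S H1 HS) as Q.
    set (W := rad 1 S) in *.
    assert (N : lnorm [W] = Cnorm2 W) by (unfold lnorm; cbn [fold_right]; ring).
    rewrite N; split.
    + rewrite <- Cabs_sq; pose proof (Cabs_pos W); nra.
    (* The quadratic equation for [W] says [S + W^2 = 2 W]. *)
    + replace (Cadd S (lsq [W])) with (Cmul (RtoC 2) W).
      * rewrite Cnorm2_mul; replace (Cnorm2 (RtoC 2)) with 4 by (cunf; ring); lra.
      * unfold lsq, sumL; cbn [map fold_right]; rewrite Q; change (RtoC 1) with C1; ring.
  - intros b S HS S0 H; rewrite ldot_cons, ldot_nil in H.
    assert (K : Cmul (rad 1 S) (RtoC (b 0%nat)) = C0) by (rewrite <- H; ring).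
    apply Cmul_eq0 in K; [|now apply rad_neq0].
    injection K; intros h j Hj; destruct j; [auto|lia].
Qed.

Lemma rotated_tail_min_isometry n p m theta th : (p <= n)%nat -> m = (p + n + 2)%nat -> (4 <= m)%nat ->
  theta_ok p theta -> nondegenerate n p theta -> 0 < th < PI / 4 ->
  is_min_holo_isometry n m (quad_map p n theta (fun S =>
    [Cmul (RtoC (cos th / cos (2 * th))) (rad (cos (2 * th)) S);
     Cmul (0, sin th / cos (2 * th)) (rad (cos (2 * th)) S)])).
Proof.
  intros Hp Em Hm Hth Hnd Ht; pose proof PI_RGT_0.
  set (c := cos (2 * th)).
  assert (Hc0 : 0 < c) by (apply cos_gt_0; lra).
  assert (Hc : 0 < c <= 1) by (split; auto; apply COS_bound).
  assert (Ec : c = cos th * cos th - sin th * sin th) by apply cos_2a.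
  pose proof (sin2_cos2 th) as E1; unfold Rsqr in E1.
  assert (Hs : 0 < sin th) by (apply sin_gt_0; lra).
  assert (Hco : 0 < cos th) by (apply cos_gt_0; lra).
  apply quad_map_min_isometry with 2%nat; auto.
  - do 2 (apply hol_list_cons; [apply isHol_mul; [apply isHol_const|]; apply isHol_rad; auto;
      [intros z Hz; now apply quad_lt1|now apply isHol_quad]|]).
    apply hol_list_nil.
  - rewrite rad_0; simpl; repeat f_equal; apply Ceq; cunf; ring.
  - intros S HS; pose proof (rad_bound c S Hc HS) as B; pose proof (rad_sq c S Hc HS) as Q.
    set (W := rad c S) in *.
    match goal with |- context [lnorm ?l] => assert (N : lnorm l = Cnorm2 W / (c * c)) end.
    { unfold lnorm; cbn [fold_right]; rewrite !Cnorm2_mul.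
      replace (Cnorm2 W / (c * c)) with (Cnorm2 W * (sin th * sin th + cos th * cos th) / (c * c))
        by (rewrite E1; field; lra).
      replace (Cnorm2 (RtoC (cos th / c))) with (cos th * cos th / (c * c)) by (cunf; field; lra).
      replace (Cnorm2 (0, sin th / c)) with (sin th * sin th / (c * c)) by (cunf; field; lra).
      field; lra. }
    rewrite N; split.
    + apply Rmult_lt_reg_r with (c * c); [nra|].
      replace (Cnorm2 W / (c * c) * (c * c)) with (Cnorm2 W) by (field; lra).
      rewrite <- Cabs_sq; pose proof (Cabs_pos W); nra.
    (* The squares of the two entries add up to [W^2 / c] since [cos^2 - sin^2 = c], and
       [W^2 = 2 W - c S] turns [S + W^2 / c] into [2 W / c]. *)
    + match goal with |- / 4 * Cnorm2 ?X = _ => replace X with (Cmul (RtoC (2 / c)) W) end.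
      * rewrite Cnorm2_mul; cunf; field; lra.
      * unfold lsq, sumL; cbn [map fold_right].
        transitivity (Cadd S (Cmul (RtoC (/ c)) (Csub (Cmul (RtoC 2) W) (Cmul (RtoC c) S)))).
        -- apply Ceq; cunf; field; lra.
        -- rewrite <- Q; f_equal.
           transitivity (Cmul (RtoC ((cos th * cos th - sin th * sin th) / (c * c))) (Csq W)).
           ++ rewrite <- Ec; f_equal; unfold RtoC; f_equal; field; lra.
           ++ apply Ceq; cunf; field; lra.
  - intros b S HS S0 H1; rewrite !ldot_cons, ldot_nil in H1.
    assert (K : Cmul (rad c S) (b 0%nat * (cos th / c), b 1%nat * (sin th / c)) = C0)
      by (rewrite <- H1; apply Ceq; cunf; ring).
    apply Cmul_eq0 in K; [|now apply rad_neq0].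
    injection K; intros h1 h0.
    assert (0 < cos th / c) by now apply Rdiv_lt_0_compat.
    assert (0 < sin th / c) by now apply Rdiv_lt_0_compat.
    intros j Hj; destruct j as [|[|j]]; [nra|nra|lia].
Qed.

Definition pole_tail (A zn : C) : list C :=
  [Cdiv (Cadd (Csub A (Cmul (RtoC 2) (Csq zn))) (Cmul (RtoC 2) zn))
        (Cmul (RtoC two_sqrt2) (Csub C1 zn));
   Cdiv (Csub (Cadd A (Cmul (RtoC 2) (Csq zn))) (Cmul (RtoC 2) zn))
        (Cmul (0, two_sqrt2) (Csub C1 zn))].

(** In terms of [B = A / (1 - zn)] the tail is [(B + 2 zn, -i (B - 2 zn)) / (2 sqrt 2)]. Its squared
    norm is [|B|^2 / 4 + |zn|^2] and its sum of squares is [B zn]; adding [A = B (1 - zn)] leaves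
    [B]. *)
Lemma pole_tail_eq A zn : Csub C1 zn <> C0 ->
  pole_tail A zn =
  [Cmul (RtoC (/ two_sqrt2)) (Cadd (Cdiv A (Csub C1 zn)) (Cmul (RtoC 2) zn));
   Cmul (0, - / two_sqrt2) (Csub (Cdiv A (Csub C1 zn)) (Cmul (RtoC 2) zn))].
Proof.
  intros H; destruct two_sqrt2_inv as [_ P].
  assert (N : two_sqrt2 <> 0) by (intros E; rewrite E, Rinv_0 in P; lra).
  assert (N1 : RtoC two_sqrt2 <> C0) by (intros h; injection h; auto).
  assert (N2 : (0, two_sqrt2) <> C0) by (intros h; injection h; auto).
  assert (E1 : RtoC (/ two_sqrt2) = Cinv (RtoC two_sqrt2)).
  { apply Ceq; unfold Cinv; cunf; field; auto. }
  assert (E2 : (0, - / two_sqrt2) = Cinv (0, two_sqrt2)).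
  { apply Ceq; unfold Cinv; cunf; field; auto. }
  unfold pole_tail, Csq; rewrite E1, E2; f_equal; [|f_equal]; field; auto.
Qed.

Lemma pole_neq0 zn : Cabs zn < 1 -> Csub C1 zn <> C0.
Proof. intros H; apply neq_of_mod_lt; now rewrite Cabs_1. Qed.

Lemma ball_coord n z j : (j < n)%nat -> inBall n z -> Cabs (z j) < 1.
Proof.
  intros Hj [Hz _]; apply Cabs_lt_sq; [lra|]; pose proof (coord_le_normsq n z j Hj); lra.
Qed.

Lemma pole_tail_min_isometry n p m theta : (p < n)%nat -> m = (p + n + 1)%nat -> (4 <= m)%nat ->
  theta_ok p theta ->
  is_min_holo_isometry n m (fun z => vecOfList (pairs p theta z ++ plain (S p) (n - 1) z ++
    pole_tail (quad p (n - 1) theta z) (z (n - 1)%nat))).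
Proof.
  intros Hp Em Hm Hth; destruct two_sqrt2_inv as [E P].
  assert (Hn1 : (n - 1 < n)%nat) by lia.
  assert (NZ : forall z, inBall n z -> Csub C1 (z (n - 1)%nat) <> C0).
  { intros z Hz; apply pole_neq0; now apply ball_coord with n. }
  assert (N2 : two_sqrt2 <> 0) by (intros h; rewrite h, Rinv_0 in P; lra).
  assert (NS : forall z, normsq n z = normsq (n - 1) z + Cnorm2 (z (n - 1)%nat)).
  { intros z; destruct n as [|n']; [lia|]; replace (S n' - 1)%nat with n' by lia; reflexivity. }
  apply (std_min_isometry n p (n - 1) 2 m theta
    (fun z => pole_tail (quad p (n - 1) theta z) (z (n - 1)%nat))); auto; try lia.
  - assert (HA : isHol n (inBall n) (quad p (n - 1) theta)) by (apply isHol_quad; lia).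
    assert (Hz : isHol n (inBall n) (fun z => z (n - 1)%nat)) by now apply isHol_coord.
    assert (H2 : isHol n (inBall n) (fun z => Cmul (RtoC 2) (z (n - 1)%nat)))
      by (apply isHol_mul; auto; apply isHol_const).
    assert (H3 : isHol n (inBall n) (fun z => Cmul (RtoC 2) (Csq (z (n - 1)%nat))))
      by (unfold Csq; apply isHol_mul; [apply isHol_const|now apply isHol_mul]).
    assert (H4 : forall a, isHol n (inBall n) (fun z => Cmul a (Csub C1 (z (n - 1)%nat)))).
    { intros a; apply isHol_mul; [apply isHol_const|]; apply isHol_sub; auto; apply isHol_const. }
    unfold pole_tail; apply hol_list_cons; [|apply hol_list_cons; [|apply hol_list_nil]];
      apply isHol_div; auto.
    + intros z Hb; apply Cmul_neq0; auto; intros h; injection h; auto.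
    + apply isHol_add; auto; now apply isHol_sub.
    + intros z Hb; apply Cmul_neq0; auto; intros h; injection h; auto.
    + apply isHol_sub; auto; now apply isHol_add.
  - intros z Hz; rewrite pole_tail_eq by auto.
    pose proof (quad_bound p (n - 1) theta z ltac:(lia)) as QB.
    set (A := quad p (n - 1) theta z) in *; set (w := z (n - 1)%nat) in *.
    assert (HB : Cmul (Cdiv A (Csub C1 w)) (Csub C1 w) = A) by (field; now apply NZ).
    set (B := Cdiv A (Csub C1 w)) in *.
    exists (/ 4 * Cnorm2 B); split; [|split].
    (* [|B| < 1 + |w| < 2], because [|A| <= |z|^2 - |w|^2 < (1 - |w|) (1 + |w|)] and
       [|1 - w| >= 1 - |w|]. *)
    + pose proof (Cabs_sub_ge C1 w) as h; rewrite Cabs_1 in h.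
      assert (hA : Cabs B * Cabs (Csub C1 w) = Cabs A) by (rewrite <- Cabs_mul; now f_equal).
      assert (hw : Cabs w < 1) by now apply ball_coord with n.
      destruct Hz as [Hz _]; rewrite NS in Hz; fold w in Hz.
      rewrite <- Cabs_sq in *; pose proof (Cabs_pos w); pose proof (Cabs_pos B).
      assert (Cabs B < 1 + Cabs w).
      { apply Rmult_lt_reg_r with (Cabs (Csub C1 w)); [lra|]; nra. }
      nra.
    + rewrite NS; fold w; unfold lnorm; cbn [fold_right]; rewrite !Cnorm2_mul.
      replace (Cnorm2 (RtoC (/ two_sqrt2))) with (/ 8) by (rewrite <- E; cunf; ring).
      replace (Cnorm2 (0, - / two_sqrt2)) with (/ 8) by (rewrite <- E; cunf; ring).
      clearbody B; cunf; field.
    + do 2 f_equal; rewrite <- HB; clearbody B; unfold lsq, sumL; cbn [map fold_right].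
      transitivity (Cadd (Cmul B (Csub C1 w)) (Cmul (RtoC (8 * (/ two_sqrt2 * / two_sqrt2))) (Cmul B w))).
      * apply Ceq; cunf; ring.
      * rewrite E; apply Ceq; cunf; field.
  - rewrite quad_zero by lia; rewrite pole_tail_eq by (apply (NZ vzero), zero_in_ball).
    unfold vzero; simpl; repeat f_equal; unfold Cdiv; apply Ceq; cunf; ring.
  - intros t i Hi _; rewrite quad_evec_even by lia; f_equal; unfold evec.
    destruct (Nat.eqb_spec (n - 1) i); auto; lia.
  (* On the axis of [z_n] the form [A] vanishes, so the two tail entries are a real and a purely
     imaginary nonzero number, independent over the reals. *)
  - intros b d Hd H; destruct (small_radius d Hd) as [t [Ht [Ht1 Htd]]].
    assert (Bt : inBall n (evec t (n - 1))) by now apply evec_in_ball.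
    specialize (H _ Bt ltac:(rewrite evec_normsq; auto)).
    rewrite pole_tail_eq in H by now apply NZ.
    rewrite quad_evec_out in H by lia.
    assert (Ez : evec t (n - 1) (n - 1)%nat = RtoC t) by (unfold evec; now rewrite Nat.eqb_refl).
    rewrite Ez, !ldot_cons, ldot_nil in H.
    assert (K : (2 * t * / two_sqrt2 * b 0%nat, 2 * t * / two_sqrt2 * b 1%nat) = C0).
    { rewrite <- H; replace (Cdiv C0 (Csub C1 (RtoC t))) with C0 by (unfold Cdiv; ring).
      apply Ceq; cunf; ring. }
    assert (0 < 2 * t * / two_sqrt2) by (apply Rmult_lt_0_compat; lra).
    injection K; intros h1 h0 j Hj; destruct j as [|[|j]]; [nra|nra|lia].
Qed.

Theorem mainTheorem2 :
  forall (n k : nat) (theta : nat -> R) (th : R),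
  (2 <= n)%nat -> (2 <= k <= n + 2)%nat ->
  ((k <= n)%nat -> theta_ok (k - 1) theta ->
     is_min_holo_isometry n (n + k) (R_a n k theta) /\
     is_min_holo_isometry n (n + k) (I_a n k theta)) /\
  (k = S n ->
     (theta_ok (n - 1) theta -> is_min_holo_isometry n (n + k) (R_b n theta)) /\
     (theta_ok n theta -> not_all_pi4 n theta ->
        is_min_holo_isometry n (n + k) (I_b n theta))) /\
  (k = (n + 2)%nat -> theta_ok n theta -> not_all_pi4 n theta -> 0 < th < PI / 4 ->
     is_min_holo_isometry n (n + k) (R_c n theta) /\
     is_min_holo_isometry n (n + k) (I_c n theta th)).
Proof.
  intros n k theta th Hn Hk.
  assert (PN : forall z, plain (S n) n z = []) by (intros z; unfold plain; now rewrite Nat.sub_diag).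
  assert (QN : forall z, quad n n theta z = cos2sum n theta z).
  { intros z; unfold quad, sqsum; rewrite Nat.sub_diag; unfold sumL; simpl map; cbn [fold_right]; ring. }
  split; [|split].
  - intros Hkn Hth; destruct k as [|p]; [lia|].
    replace (S p - 1)%nat with p in * by lia; split.
    + replace (R_a n (S p) theta) with (fun z => vecOfList (pairs p theta z ++ plain (S p) (n - 1) z ++
        pole_tail (quad p (n - 1) theta z) (z (n - 1)%nat))).
      * apply pole_tail_min_isometry; auto; lia.
      * apply functional_extensionality; intros z; unfold R_a, pole_tail, quad, zc.
        now replace (S p - 1)%nat with p by lia.
    + replace (I_a n (S p) theta) with (quad_map p n theta (fun S => [rad 1 S])).
      * apply irrational_tail_min_isometry; auto; try lia; apply nondegenerate_plain; lia.
      * apply functional_extensionality; intros z; unfold I_a, quad_map, rad, quad.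
        replace (S p - 1)%nat with p by lia.
        replace (Csub C1 (Cmul (RtoC 1) (Cadd (cos2sum p theta z) (sqsum (S p) n z))))
          with (Csub (Csub C1 (cos2sum p theta z)) (sqsum (S p) n z))
          by (change (RtoC 1) with C1; ring).
        reflexivity.
  - intros ->; split.
    + intros Hth; destruct n as [|p]; [lia|].
      replace (S p - 1)%nat with p in * by lia.
      replace (R_b (S p) theta) with (quad_map p (S p) theta rational_tail).
      * apply rational_tail_min_isometry; auto; try lia; apply nondegenerate_plain; lia.
      * apply functional_extensionality; intros z; unfold R_b, quad_map, rational_tail, quad, sqsum, plain.
        replace (S (S p) - S p)%nat with 1%nat by lia; replace (S p - 1)%nat with p by lia.
        cbn [seq map app]; unfold sumL; cbn [fold_right].
        now replace (Cadd (Csq (zc z (S p))) C0) with (Csq (zc z (S p))) by ring.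
    + intros Hth Hnd.
      replace (I_b n theta) with (quad_map n n theta (fun S => [rad 1 S])).
      * apply irrational_tail_min_isometry; auto; try lia; now apply nondegenerate_pairs.
      * apply functional_extensionality; intros z; unfold I_b, quad_map, rad; rewrite PN, QN.
        now replace (Cmul (RtoC 1) (cos2sum n theta z)) with (cos2sum n theta z)
          by (change (RtoC 1) with C1; ring).
  - intros -> Hth Hnd Ht; split.
    + replace (R_c n theta) with (quad_map n n theta rational_tail).
      * apply rational_tail_min_isometry; auto; try lia; now apply nondegenerate_pairs.
      * apply functional_extensionality; intros z; unfold R_c, quad_map, rational_tail.
        now rewrite PN, QN.
    + replace (I_c n theta th) with (quad_map n n theta (fun S =>
        [Cmul (RtoC (cos th / cos (2 * th))) (rad (cos (2 * th)) S);
         Cmul (0, sin th / cos (2 * th)) (rad (cos (2 * th)) S)])).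
      * apply rotated_tail_min_isometry; auto; try lia; now apply nondegenerate_pairs.
      * apply functional_extensionality; intros z; unfold I_c, quad_map, rad.
        now rewrite PN, QN.
Qed.
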